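(* Let $1<p<\infty$, $q,Q,t\in\mathbb{R}$ and $s>-1$. Suppose that either (i) $-N-1<s+t<-1$ and $s+t+\frac{Q-q}{p}>-1$, or (ii) $s+t>-1$ and $Q\ge q$. If $\omega\in(D_p^{s,t,q,Q})$, then there is a constant $C_{s,t,p,q,Q}>0$ such that for all $f\in L^p(\omega\,d\mu_q)$, $$\int_{\mathbb{B}}\big(O'_{s,t}f(z)\big)^p\,\omega(z)\,d\mu_Q(z)\le C_{s,t,p,q,Q}\int_{\mathbb{B}}|f(z)|^p\,\omega(z)\,d\mu_q(z),$$ where $$O'_{s,t}f(z)=(1-|z|^2)^t\sup_{\zeta,\ R>1-|\zeta|:\ z\in B(\zeta,R)}\frac{1}{R^{N+1+s+t}}\int_{B(\zeta,R)}|f(w)|\,d\mu_s(w).$$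
   Context: $N\ge1$; $\langle z,w\rangle=\sum_{j=1}^N z_j\overline{w_j}$, $|z|=\sqrt{\langle z,z\rangle}$ on $\mathbb{C}^N$; $\mathbb{B}$ is the open unit ball of $\mathbb{C}^N$; $\mu$ is normalized Lebesgue measure on $\mathbb{B}$; for $c\in\mathbb{R}$, $d\mu_c(z)=(1-|z|^2)^c d\mu(z)$; $p'=p/(p-1)$. A weight is a positive (a.e.) locally integrable function on $\mathbb{B}$. For nonzero $z,w\in\mathbb{B}$, $d(z,w)=\big||z|-|w|\big|+\big|1-\frac{\langle z,w\rangle}{|z||w|}\big|$; the pseudo-ball is $B(\zeta,R)=\{z\in\mathbb{B}\setminus\{0\}:d(z,\zeta)<R\}$, $\zeta\ne0$, $R>0$. It touches the boundary, written $B\cap\partial\mathbb{B}\ne\varnothing$, when $R>1-|\zeta|$; $R_B$ denotes its radius. Class $(D_p^{s,t,q,Q})$, $s>-1$, of weights $\omega$: in case (i), $\omega\in(D_p^{s,t,q,Q})$ means $$\sup_{B:\,B\cap\partial\mathbb{B}\ne\varnothing}\left(\frac{1}{R_B^{N+1+s+t+\frac{Q-q}{p}}}\int_B\omega\,d\mu_{Q+pt}\right)\left(\frac{1}{R_B^{N+1+s+t+\frac{Q-q}{p}}}\int_B\omega^{\frac{-1}{p-1}}\,d\mu_{q+p'(s-q)}\right)^{p-1}<\infty,$$ and in case (ii) it means $$\sup_{B:\,B\cap\partial\mathbb{B}\ne\varnothing}\left(\frac{1}{\mu_{s+t+\frac{Q-q}{p}}(B)}\int_B\omega\,d\mu_{Q+pt}\right)\left(\frac{1}{\mu_{s+t+\frac{Q-q}{p}}(B)}\int_B\omega^{\frac{-1}{p-1}}\,d\mu_{q+p'(s-q)}\right)^{p-1}<\infty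 .$$ When $s+t>-1$ the paper also uses $O_{s,t}$, defined like $O'_{s,t}$ with $\mu_{s+t}(B(\zeta,R))$ in place of $R^{N+1+s+t}$; the two are comparable. *)

(* Defs.v *)
From HB Require Import structures.
From mathcomp Require Import all_boot all_order all_algebra.
From mathcomp Require Import all_classical all_reals all_analysis.
From mathcomp Require Import complex.

Set Implicit Arguments.
Unset Strict Implicit.
Unset Printing Implicit Defensive.

Import Order.TTheory GRing.Theory Num.Theory.
Import numFieldNormedType.Exports.
Import ComplexField.Normc.

Local Open Scope classical_set_scope.
Local Open Scope ring_scope.

(* [m1 \x m2] under another name: the library's sigma-finite structure on
   [_ \x _] is only inferred when both factors are subprobabilities. *)
Section sigma_finite_product.
Local Open Scope ereal_scope.
Context d1 d2 (T1 : measurableType d1) (T2 : measurableType d2) (R : realType).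
Variables (m1 : {sigma_finite_measure set T1 -> \bar R})
  (m2 : {sigma_finite_measure set T2 -> \bar R}).

Definition sprod : set (T1 * T2) -> \bar R := m1 \x m2.

HB.instance Definition _ := Measure.on sprod.

Let sprod_sigma_finite : sigma_finite setT sprod.
Proof.
have /sigma_finiteP[F [TF ndF Foo]] := sigma_finiteT m1.
have /sigma_finiteP[G [TG ndG Goo]] := sigma_finiteT m2.
exists (fun n => F n `*` G n).
  rewrite -setXTT TF TG predeqE => -[x y]; split.
    move=> [/= [n _ Fnx] [k _ Gky]]; exists (maxn n k) => //; split.
    - by move: x Fnx; exact/subsetPset/ndF/leq_maxl.
    - by move: y Gky; exact/subsetPset/ndG/leq_maxr.
  by move=> [n _ []/= ? ?]; split; exists n.
move=> k; have [? ?] := Foo k; have [? ?] := Goo k.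
split; first exact: measurableX.
by rewrite /sprod product_measure1E// lte_mul_pinfty// ge0_fin_numE.
Qed.

HB.instance Definition _ :=
  Measure_isSigmaFinite.Build _ _ _ sprod sprod_sigma_finite.

End sigma_finite_product.

(* [pushforward m f], with the measurability of [f] as an argument, so that
   the measure structure can be inferred; the measurable left inverse [g] of
   [f] preserves sigma-finiteness. *)
Section transport.
Local Open Scope ereal_scope.
Context d d' (T : measurableType d) (U : measurableType d') (R : realType).
Variables (m : {sigma_finite_measure set T -> \bar R}) (f : T -> U) (g : U -> T).

Definition transport of measurable_fun setT f & measurable_fun setT g
  & cancel f g : set U -> \bar R := pushforward m f.

Hypotheses (mf : measurable_fun setT f) (mg : measurable_fun setT g)
  (fK : cancel f g).

Let transport0 : transport mf mg fK set0 = 0.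
Proof. by rewrite /transport /pushforward preimage_set0 measure0. Qed.

Let transport_ge0 A : 0 <= transport mf mg fK A.
Proof. exact: measure_ge0. Qed.

Let transport_sigma_additive : semi_sigma_additive (transport mf mg fK).
Proof.
move=> F mF tF mUF; rewrite /transport /pushforward preimage_bigcup.
apply: measure_semi_sigma_additive.
- by move=> n; rewrite -[X in measurable X]setTI; exact: mf.
- apply/trivIsetP => /= i j _ _ ij; rewrite -preimage_setI.
  by move/trivIsetP : tF => /(_ _ _ _ _ ij) ->//; rewrite preimage_set0.
- by rewrite -preimage_bigcup -[X in measurable X]setTI; exact: mf.
Qed.

HB.instance Definition _ := isMeasure.Build _ _ _ (transport mf mg fK)
  transport0 transport_ge0 transport_sigma_additive.

Let transport_sigma_finite : sigma_finite setT (transport mf mg fK).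
Proof.
have [F FT Foo] := sigma_finiteT m.
exists (fun k => g @^-1` F k).
  by rewrite -preimage_bigcup -FT preimage_setT.
move=> k; have [mF Fk] := Foo k; split.
  by rewrite -[X in measurable X]setTI; exact: mg.
rewrite /transport /pushforward -comp_preimage (_ : g \o f = id) ?preimage_id//.
exact/funext.
Qed.

HB.instance Definition _ := Measure_isSigmaFinite.Build _ _ _
  (transport mf mg fK) transport_sigma_finite.

End transport.

Definition complex_display : measure_display -> measure_display.
Proof. exact. Qed.

Section complex_measurable.
Context {R : realType}.

HB.instance Definition _ := isPointed.Build R[i] 0.

Let coorU := g_sigma_preimageU (@complex.Re R) (@complex.Im R).

Let complex_set0 : coorU set0.
Proof. exact: sigma_algebra0. Qed.

Let complex_setC A : coorU A -> coorU (~` A).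
Proof. exact: sigma_algebraC. Qed.

Let complex_bigcup (F : (set R[i])^nat) :
  (forall i, coorU (F i)) -> coorU (\bigcup_i (F i)).
Proof. exact: sigma_algebra_bigcup. Qed.

HB.instance Definition _ :=
  @isMeasurable.Build (complex_display default_measure_display)
    R[i] coorU complex_set0 complex_setC complex_bigcup.

End complex_measurable.

Section complex_lebesgue.
Context {R : realType}.

Lemma measurable_complex_Re : measurable_fun [set: R[i]] (@complex.Re R).
Proof.
move=> _ A mA; rewrite setTI; apply: sub_sigma_algebra; left.
by exists A => //; rewrite setTI.
Qed.

Lemma measurable_complex_Im : measurable_fun [set: R[i]] (@complex.Im R).
Proof.
move=> _ A mA; rewrite setTI; apply: sub_sigma_algebra; right.
by exists A => //; rewrite setTI.
Qed.

(* [lebesgue_measure] lives on [measurableTypeR R], an alias of [R]. *)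
Definition pair_of_complex (z : R[i]) :
  measurableTypeR R * measurableTypeR R := (complex.Re z, complex.Im z).
Definition complex_of_pair (u : measurableTypeR R * measurableTypeR R) : R[i] :=
  Complex u.1 u.2.

Lemma measurable_pair_of_complex : measurable_fun setT pair_of_complex.
Proof.
apply: measurable_fun_pair.
- exact: measurable_complex_Re.
- exact: measurable_complex_Im.
Qed.

Lemma measurable_complex_of_pair : measurable_fun setT complex_of_pair.
Proof.
apply: (@measurability _ _ _ _ _ _
  (preimage_set_system setT (@complex.Re R) measurable `|`
   preimage_set_system setT (@complex.Im R) measurable)) => //.
move=> _ [_ [[A mA <-]|[A mA <-]] <-]; rewrite !setTI.
- by rewrite -[X in measurable X]setTI; exact: measurable_fst.
- by rewrite -[X in measurable X]setTI; exact: measurable_snd.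
Qed.

Lemma complex_of_pairK : cancel complex_of_pair pair_of_complex.
Proof. by case. Qed.

Definition lebesgueC : {sigma_finite_measure set R[i] -> \bar R} :=
  transport (sprod (@lebesgue_measure R) (@lebesgue_measure R))
    measurable_complex_of_pair measurable_pair_of_complex complex_of_pairK.

End complex_lebesgue.

Definition measure_rV_display : measure_display -> measure_display.
Proof. exact. Qed.

Section rV_measurable.
Context {d} {T : measurableType d} (n : nat).

Let coors : 'I_n -> 'rV[T]_n -> T := fun i x => x 0 i.

Let rV_set0 : g_sigma_preimage coors set0.
Proof. exact: sigma_algebra0. Qed.

Let rV_setC A : g_sigma_preimage coors A -> g_sigma_preimage coors (~` A).
Proof. exact: sigma_algebraC. Qed.

Let rV_bigcup (F : (set 'rV[T]_n)^nat) :
  (forall i, g_sigma_preimage coors (F i)) ->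
  g_sigma_preimage coors (\bigcup_i (F i)).
Proof. exact: sigma_algebra_bigcup. Qed.

HB.instance Definition _ := @isMeasurable.Build (measure_rV_display d)
  'rV[T]_n (g_sigma_preimage coors) rV_set0 rV_setC rV_bigcup.

End rV_measurable.

Section rV_coordinates.
Context d (T : measurableType d).

Lemma measurable_rV_coord n (i : 'I_n) :
  measurable_fun [set: 'rV[T]_n] (fun x => x 0 i).
Proof.
move=> _ Y mY; rewrite setTI; apply: sub_sigma_algebra => /=.
rewrite -bigcup_seq/=; exists i => /=; first by rewrite mem_index_enum.
by exists Y => //; rewrite setTI.
Qed.

Lemma measurable_fun_rV d' (U : measurableType d') n (f : U -> 'rV[T]_n) :
  (forall i, measurable_fun [set: U] (fun u => f u 0 i)) ->
  measurable_fun [set: U] f.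
Proof.
move=> mf; pose coors (i : 'I_n) (x : 'rV[T]_n) := x 0 i.
apply: (@measurability _ _ _ _ _ _
  (\big[setU/set0]_(i < n) preimage_set_system setT (coors i) measurable)) => //.
move=> _ [B + <-]; rewrite -bigcup_seq => -[i _ [A mA <-]].
rewrite setTI; have := mf i measurableT A mA; rewrite !setTI; exact.
Qed.

Definition rV_cons n (u : T * 'rV[T]_n) : 'rV[T]_n.+1 :=
  row_mx (\row_(_ < 1) u.1) u.2.
Definition rV_uncons n (v : 'rV[T]_n.+1) : T * 'rV[T]_n :=
  (v 0 ord0, \row_i v 0 (lift ord0 i)).

Lemma rV_cons0 n (u : T * 'rV[T]_n) : rV_cons u 0 ord0 = u.1.
Proof.
by rewrite mxE; case: splitP => // j _; rewrite mxE.
Qed.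

Lemma rV_cons_lift n (u : T * 'rV[T]_n) i : rV_cons u 0 (lift ord0 i) = u.2 0 i.
Proof.
rewrite mxE; case: splitP => [[[]]//|j /= [ij]].
by congr (u.2 0 _); exact/val_inj.
Qed.

Lemma rV_consK n : cancel (@rV_cons n) (@rV_uncons n).
Proof.
move=> [x v]; rewrite /rV_uncons rV_cons0; congr pair.
by apply/rowP => i; rewrite mxE rV_cons_lift.
Qed.

Lemma measurable_rV_cons n : measurable_fun setT (@rV_cons n).
Proof.
apply: measurable_fun_rV => i; have [j ->|->] := unliftP ord0 i.
- apply: (@eq_measurable_fun _ _ _ _ _ ((fun v : 'rV[T]_n => v 0 j) \o snd)).
    by move=> u _; rewrite rV_cons_lift.
  exact: (measurableT_comp (@measurable_rV_coord n j)).
- apply: (@eq_measurable_fun _ _ _ _ _ fst) => //.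
  by move=> u _; rewrite rV_cons0.
Qed.

Lemma measurable_rV_uncons n : measurable_fun setT (@rV_uncons n).
Proof.
apply: measurable_fun_pair; first exact: measurable_rV_coord.
apply: measurable_fun_rV => i.
apply: (@eq_measurable_fun _ _ _ _ _ (fun v : 'rV[T]_n.+1 => v 0 (lift ord0 i))).
  by move=> v _; rewrite mxE.
exact: measurable_rV_coord.
Qed.

End rV_coordinates.

Fixpoint prod_rV d (T : measurableType d) (R : realType)
    (m : {sigma_finite_measure set T -> \bar R}) (n : nat) :
    {sigma_finite_measure set 'rV[T]_n -> \bar R} :=
  match n with
  | 0 => \d_(point : 'rV[T]_0)
  | k.+1 => transport (sprod m (prod_rV m k)) (@measurable_rV_cons _ T k)
              (@measurable_rV_uncons _ T k) (@rV_consK _ T k)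
  end.

Section unit_ball.
Context {R : realType} {N : nat}.
Implicit Types (z w zeta : 'rV[R[i]]_N) (r c : R) (A : set 'rV[R[i]]_N).

Definition cdot z w : R[i] := \sum_(j < N) z 0 j * (w 0 j)^*%C.

Definition cnorm z : R := Num.sqrt (complex.Re (cdot z z)).

Definition unit_ball : set 'rV[R[i]]_N := [set z | cnorm z < 1].

Lemma unit_ball_scale_ge0 : 0 <= (fine (prod_rV lebesgueC N unit_ball))^-1.
Proof. by rewrite invr_ge0 fine_ge0. Qed.

(* Lebesgue measure scaled so that the unit ball has measure 1; it is not
   restricted to the unit ball, but is only used inside it. *)
Definition mu : {measure set 'rV[R[i]]_N -> \bar R} :=
  mscale (NngNum unit_ball_scale_ge0) (prod_rV lebesgueC N).

(* The integral against dmu_c(w) = (1 - |w|^2)^c dmu(w). *)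
Definition integral_mu c A (g : 'rV[R[i]]_N -> \bar R) : \bar R :=
  (\int[mu]_(w in A) (g w * ((1 - cnorm w ^+ 2) `^ c)%:E))%E.

Definition mu_ c A : \bar R := integral_mu c A (cst 1%E).

Definition pdist z w : R :=
  `|cnorm z - cnorm w| +
  normc (1 - cdot z w / ((cnorm z * cnorm w)%:C)%C).

Definition pball zeta r : set 'rV[R[i]]_N :=
  [set z | [/\ unit_ball z, z != 0 & pdist z zeta < r]].

(* [pball zeta r] is a pseudo-ball that touches the boundary; its radius is
   then positive. *)
Definition touches_boundary zeta r : Prop :=
  [/\ unit_ball zeta, zeta != 0 & 1 - cnorm zeta < r].

End unit_ball.

Section weights.
Context {R : realType} {N : nat}.
Implicit Types (p q Q s t : R) (omega : 'rV[R[i]]_N -> R)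
  (f : 'rV[R[i]]_N -> R[i]).

Definition is_weight omega : Prop :=
  [/\ measurable_fun unit_ball omega,
      {ae mu, forall z, unit_ball z -> 0 < omega z} &
      forall z, unit_ball z -> exists2 e : R, 0 < e &
        (\int[mu]_(w in unit_ball `&` [set w | (cnorm (w - z) < e)%R])
           `|omega w|%:E < +oo)%E].

Definition case_i (n : nat) p q Q s t : Prop :=
  [/\ - n%:R - 1 < s + t, s + t < -1 & -1 < s + t + (Q - q) / p].

Definition case_ii p q Q s t : Prop := -1 < s + t /\ q <= Q.

(* [den] is the normalizing factor, which differs between the two cases. *)
Definition D_characteristic p q Q s t omega
    (den : 'rV[R[i]]_N -> R -> \bar R) : \bar R :=
  ereal_sup [set x | exists zeta r, touches_boundary zeta r /\
    x = (integral_mu (Q + p * t) (pball zeta r) (EFin \o omega) / den zeta r *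
         (integral_mu (q + p / (p - 1) * (s - q)) (pball zeta r)
            (fun w => (omega w `^ (- 1 / (p - 1)))%:E) / den zeta r)
         `^ (p - 1))%E].

Definition D_class p q Q s t omega : Prop :=
  (case_i N p q Q s t ->
    (D_characteristic p q Q s t omega
       (fun _ r => (r `^ (N%:R + 1 + s + t + (Q - q) / p))%:E) < +oo)%E) /\
  (case_ii p q Q s t ->
    (D_characteristic p q Q s t omega
       (fun zeta r => mu_ (s + t + (Q - q) / p) (pball zeta r)) < +oo)%E).

Definition in_Lp_weighted p q omega f : Prop :=
  measurable_fun unit_ball f /\
  (integral_mu q unit_ball (fun z => (normc (f z) `^ p * omega z)%:E) < +oo)%E.

(* For z = 0, which no pseudo-ball contains, the supremum is that of the empty
   set, -oo; its powers [`^ p] with p != 0 are 0. *)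
Definition Oprime s t f (z : 'rV[R[i]]_N) : \bar R :=
  (((1 - cnorm z ^+ 2) `^ t)%:E *
   ereal_sup [set x | exists zeta r,
     [/\ touches_boundary zeta r, pball zeta r z &
         x = integral_mu s (pball zeta r) (fun w => (normc (f w))%:E) /
             (r `^ (N%:R + 1 + s + t))%:E]])%E.

End weights.

(* Main.v *)
From HB Require Import structures.
Require Import Defs.
From mathcomp Require Import all_boot all_order all_algebra.
From mathcomp Require Import all_classical all_reals all_analysis.
From mathcomp Require Import complex ring lra measurable_realfun.

Set Implicit Arguments.
Unset Strict Implicit.
Unset Printing Implicit Defensive.

Import Order.TTheory GRing.Theory Num.Theory.
Import numFieldNormedType.Exports.
Import ComplexField.Normc.

Local Open Scope classical_set_scope.
Local Open Scope ring_scope.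

(* Put h(z) = 1 - |z|, and let dl be the square root of the pseudo-distance.
   The proof is a Schur test on the pseudo-balls; it uses no covering lemma.
   By the identity <a, c> = <a, b> <b, c> + <a - <a, b> b, c - <c, b> b> for unit
   vectors, dl is a metric, so that a pseudo-ball touching the boundary and
   containing z lies in a comparable one centred at z, whose radius can be
   taken among the 4 r with r = 4^(1-k), k >= 0.  Let
     v = omega (1 - |z|^2)^(Q + p t),
     sg = omega^(-1/(p-1)) (1 - |z|^2)^(q + p' (s - q)),
     g = |f|^p omega (1 - |z|^2)^q.
   Then |f| (1 - |z|^2)^s = g^(1/p) sg^(1/p'), and in both cases the class D
   gives v(B) sg(B)^(p-1) <= C R_B^(b p) with b = N + 1 + s + t + (Q - q) / p.
   Hoelder's inequality on the part e^2 <= h < 4 e^2 of a ball B of radius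
   about e^2 bounds the same product from below, with that part in place of B
   in the factor of sg; hence the rest of B carries no more sg-mass than this
   part, up to a constant.  Averaging over the centre of B, the sg-mass of
   the strip h < e^2 decays geometrically in log (1/e), so that
   int_B h^(-gam) sg <= C R_B^(-gam) sg(B') for some gam > 0 and a larger B'.
   With h^gam as test weight, Hoelder and Tonelli bound the contribution of
   the scale r by r^(Q - q) times the integral of g (h / r)^gam over h < 6 r.
   Here Q >= q in both cases, and the (h / r)^gam sum to a constant. *)

(** The gain (h / r)^gam is what makes the scales summable: a point w is seen by every scale r with
    6 r > h(w), about log (1 / h(w)) of them, and for Q = q each would contribute a fixed multiple
    of g(w) without it. It has to come from balls touching the boundary alone, since the class D
    says nothing about the others. The lower bound by Hoelder's inequality works because the part
    e^2 <= h < 4 e^2 fills a fixed proportion of the volume of B, while v^(1/p) sg^(1/p') is a power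
    of 1 - |z|^2 from which omega has cancelled. That dl is a true metric matters for the decay: the
    strip is halved arbitrarily often, each time at the cost of a larger ball; a quasi-triangle
    inequality would multiply the radius at each step, whereas a metric only adds to it. The
    supremum over pseudo-balls is replaced by an l^p sum over the scales, which the geometric decay
    makes affordable and which is measurable. Volumes are found by slicing in one coordinate,
    without a change of variables. *)

(** * Hoelder's inequality and Tonelli's theorem on sets *)

Section hoelder_on_sets.
Context {d} {T : measurableType d} {R : realType}.
Variable m : {measure set T -> \bar R}.
Local Open Scope ereal_scope.

(** Hoelder's inequality raised to the power [p]: the right side is then the kind of product that
    the class D controls, and infinite integrals need no separate treatment. *)
Lemma hoelder_setX (A : set T) (F G : T -> R) (p : R) :
  measurable A -> measurable_fun setT F -> measurable_fun setT G ->
  (forall x, 0 <= F x)%R -> (forall x, 0 <= G x)%R -> (1 < p)%R ->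
  (\int[m]_(x in A) (F x `^ p^-1 * G x `^ (1 - p^-1))%:E) `^ p <=
  \int[m]_(x in A) (F x)%:E * (\int[m]_(x in A) (G x)%:E) `^ (p - 1).
Proof.
move=> mA mF mG F0 G0 p1.
have p0 : (0 < p)%R by lra.
have pV1 : (p^-1 < 1)%R by rewrite invf_lt1.
have q0 : (0 < 1 - p^-1)%R by lra.
pose f x := (F x `^ p^-1 * \1_A x)%R; pose g x := (G x `^ (1 - p^-1) * \1_A x)%R.
have mI : measurable_fun setT (\1_A : T -> R) by exact/measurable_indicP.
have mf : measurable_fun setT f.
  by apply: measurable_funM => //; exact: (measurableT_comp (measurable_powR _)).
have mg : measurable_fun setT g.
  by apply: measurable_funM => //; exact: (measurableT_comp (measurable_powR _)).
have qV0 : (0 < (1 - p^-1)^-1)%R by rewrite invr_gt0.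
have := @hoelder _ _ _ m f g p (1 - p^-1)^-1%R mf mg p0 qV0.
rewrite invrK addrCA subrr addr0 => /(_ erefl).
rewrite !Lnorm.unlock /= invr1 poweRe1; last first.
  by apply: integral_ge0 => x _; rewrite lee_fin powR_ge0.
rewrite invrK => H.
have indpow x (h : T -> R) r : (0 < r)%R -> (0 <= h x)%R ->
    (((h x `^ r * \1_A x) `^ r^-1)%R = h x * \1_A x)%R.
  move=> r0 hx; rewrite powRM ?powR_ge0// -powRrM mulfV ?gt_eqF// powRr1//.
  by congr (_ * _)%R; rewrite indicE; case: (_ \in _); rewrite ?powR1// powR0// gt_eqF// invr_gt0.
pose I1 := \int[m]_(x in A) (F x `^ p^-1 * G x `^ (1 - p^-1))%:E.
pose I2 := \int[m]_(x in A) (F x)%:E.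
pose I3 := \int[m]_(x in A) (G x)%:E.
have E1 : \int[m]_(x in A) (F x `^ p^-1 * G x `^ (1 - p^-1))%:E =
   \int[m]_x (`|f x * g x| `^ 1)%:E.
  rewrite integral_mkcond; apply: eq_integral => x _.
  rewrite powRr1 ?normr_ge0// ger0_norm; last first.
    by rewrite /f /g !mulr_ge0 ?powR_ge0 ?indicE ?ler0n.
  rewrite /patch/= /f /g indicE; case: ifPn => _ /=; rewrite ?mulr1//.
  by rewrite !mulr0.
have E2 : \int[m]_(x in A) (F x)%:E = \int[m]_x (`|f x| `^ p)%:E.
  rewrite integral_mkcond; apply: eq_integral => x _ /=.
  rewrite ger0_norm ?mulr_ge0 ?powR_ge0 ?indicE ?ler0n//.
  have := indpow x F p^-1%R; rewrite invrK invr_gt0 indicE => -> //.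
  by rewrite /patch; case: ifPn => _ /=; rewrite ?mulr1// mulr0.
have E3 : \int[m]_(x in A) (G x)%:E = \int[m]_x (`|g x| `^ (1 - p^-1)^-1)%:E.
  rewrite integral_mkcond; apply: eq_integral => x _ /=.
  rewrite ger0_norm ?mulr_ge0 ?powR_ge0 ?indicE ?ler0n//.
  have := indpow x G (1 - p^-1)%R; rewrite indicE => -> //.
  by rewrite /patch; case: ifPn => _ /=; rewrite ?mulr1// mulr0.
have {}H : I1 <= I2 `^ p^-1 * I3 `^ (1 - p^-1).
  by rewrite /I1 E1 /I2 E2 /I3 E3; exact: H.
rewrite -/I1 -/I2 -/I3.
have iF0 : 0 <= I2 by apply: integral_ge0 => x _; rewrite lee_fin.
have iG0 : 0 <= I3 by apply: integral_ge0 => x _; rewrite lee_fin.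
have H0 : 0 <= I1.
  by apply: integral_ge0 => x _; rewrite lee_fin mulr_ge0 ?powR_ge0.
have /(_ _ _ _ _ H) := gt0_ler_poweR (ltW p0).
rewrite !in_itv/= !leey !andbT mule_ge0 ?poweR_ge0// H0 => /(_ isT isT).
rewrite poweRM ?poweR_ge0// -!poweRrM mulVf ?gt_eqF// poweRe1//.
by rewrite mulrBl mul1r mulVf ?gt_eqF.
Qed.

End hoelder_on_sets.

Section symmetric_tonelli.
Context {d} {T : measurableType d} {R : realType}.
Variable m : {sigma_finite_measure set T -> \bar R}.
Local Open Scope ereal_scope.
Variables (E : set (T * T)) (mE : measurable E).

Lemma measurable_int_xsection (G : T -> \bar R) :
  measurable_fun setT G -> (forall x, 0 <= G x) ->
  measurable_fun setT (fun x => \int[m]_(y in xsection E x) G y).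
Proof.
move=> mG G0.
pose f (u : T * T) : \bar R := G u.2 * (\1_E u)%:E.
have mf : measurable_fun setT f.
  apply: emeasurable_funM; first exact: measurableT_comp.
  by apply/measurable_EFinP; exact/measurable_indicP.
have f0 u : 0 <= f u by rewrite mule_ge0// lee_fin indicE ler0n.
have := @measurable_fun_fubini_tonelli_F _ _ T T R m f mf f0.
apply: eq_measurable_fun => x _; rewrite /fubini_F [RHS]integral_mkcond.
apply: eq_integral => y _; rewrite /patch /f mem_xsection indicE.
by case: ifPn; rewrite ?mule1 ?mule0.
Qed.

Lemma tonelli_xsection (A G : T -> \bar R) :
  measurable_fun setT A -> measurable_fun setT G ->
  (forall x, 0 <= A x) -> (forall x, 0 <= G x) ->
  \int[m]_x (A x * \int[m]_(y in xsection E x) G y) =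
  \int[m]_y (G y * \int[m]_(x in ysection E y) A x).
Proof.
move=> mA mG A0 G0.
pose f (u : T * T) : \bar R := (A u.1 * G u.2) * (\1_E u)%:E.
have mf : measurable_fun setT f.
  apply: emeasurable_funM; first by apply: emeasurable_funM; exact: measurableT_comp.
  by apply/measurable_EFinP; exact/measurable_indicP.
have f0 u : 0 <= f u by rewrite !mule_ge0// lee_fin indicE ler0n.
have := @fubini_tonelli _ _ T T R m m f mf f0.
have mind (B : set T) (H : T -> \bar R) : measurable B -> measurable_fun setT H ->
    measurable_fun setT (H \_ B).
  by move=> mB mH; apply/(measurable_restrictT _ mB); exact: measurable_funTS.
have pat0 (B : set T) (H : T -> \bar R) x : (forall x, 0 <= H x) -> 0 <= (H \_ B) x.
  by move=> H0; rewrite /patch; case: ifP.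
under [X in X = _ -> _]eq_integral => x _.
  rewrite (_ : \int[m]_y f (x, y) = A x * \int[m]_(y in xsection E x) G y); last first.
    rewrite [in RHS]integral_mkcond -ge0_integralZl//; last 2 first.
    - by apply: mind => //; exact: measurable_xsection.
    - by move=> *; exact: pat0.
    apply: eq_integral => y _; rewrite /patch /f mem_xsection indicE/=.
    by case: ifPn; rewrite ?mule1 ?mule0.
  over.
under [X in _ = X -> _]eq_integral => y _.
  rewrite (_ : \int[m]_x f (x, y) = G y * \int[m]_(x in ysection E y) A x); last first.
    rewrite [in RHS]integral_mkcond -ge0_integralZl//; last 2 first.
    - by apply: mind => //; exact: measurable_ysection.
    - by move=> *; exact: pat0.
    apply: eq_integral => x _; rewrite /patch /f mem_ysection indicE/=.
    by case: ifPn; rewrite ?mule1 ?mule0// muleC.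
  over.
by [].
Qed.

End symmetric_tonelli.


(** * Geometric sums, and cancellation in the extended reals *)

Lemma nneseries_le {R : realType} (u : nat -> \bar R) (K : \bar R) :
  (forall n, 0 <= u n)%E -> (forall n, \sum_(0 <= i < n) u i <= K)%E ->
  (\sum_(0 <= i <oo) u i <= K)%E.
Proof.
move=> u0 uK; apply: lime_le; first by apply: is_cvg_nneseries => *.
by near=> n; exact: uK.
Unshelve. all: by end_near. Qed.

Lemma sum_geometric_le {R : realFieldType} (x : R) n : 0 <= x -> x < 1 ->
  \sum_(0 <= i < n) x ^+ i <= (1 - x)^-1.
Proof.
move=> x0 x1; have xx : 0 < 1 - x by rewrite subr_gt0.
rewrite -[_^-1]mul1r ler_pdivlMr// big_mkord mulrC -opprB mulNr -subrX1 opprB.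
by rewrite gerBl exprn_ge0.
Qed.

(* Summing up to the first term reaching [M]: each earlier term is
   [(t_(k+1) - t_k) / (l - 1)], so the sum telescopes. *)
Lemma sum_geometric_below {R : realFieldType} (c l M : R) n :
  0 < c -> 1 < l -> 0 < M ->
  \sum_(0 <= k < n) (if c * l ^+ k < M then c * l ^+ k else 0) <= l * M / (l - 1).
Proof.
move=> c0 l1 M0; have l0 : 0 < l - 1 by rewrite subr_gt0.
have t0 k : 0 < c * l ^+ k by rewrite mulr_gt0// exprn_gt0// (lt_trans ltr01).
suff : \sum_(0 <= k < n) (if c * l ^+ k < M then c * l ^+ k else 0) <=
    Num.min (c * l ^+ n) (l * M) / (l - 1).
  by move=> /le_trans; apply; rewrite ler_pM2r ?invr_gt0// ge_min lexx orbT.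
elim: n => [|n IH].
  rewrite big_geq// divr_ge0 ?(ltW l0)// le_min (ltW (t0 0%N))/=.
  by rewrite mulr_ge0// ?(ltW M0)// ltW// (lt_trans ltr01).
rewrite big_nat_recr//= exprS mulrCA.
case: ifPn => [tM|]; last rewrite -leNgt => tM.
  apply: (@le_trans _ _ (c * l ^+ n / (l - 1) + c * l ^+ n)).
    by rewrite lerD2r (le_trans IH)// ler_pM2r ?invr_gt0// ge_min lexx.
  rewrite [leRHS](_ : _ = l * (c * l ^+ n) / (l - 1)); last first.
    congr (_ / _); apply/min_idPl; rewrite ler_pM2l ?(ltW tM)//.
    exact: lt_trans ltr01 l1.
  rewrite le_eqVlt; apply/orP; left; apply/eqP; field.
  by rewrite gt_eqF.
rewrite addr0 (le_trans IH)// ler_pM2r ?invr_gt0// le_min !ge_min lexx orbT andbT.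
by rewrite ler_peMl ?orbT// ?(ltW (t0 n))// ltW.
Qed.
(** Cancels a common factor [a] that may be infinite. The lower bound forces [a] and [s'] to be
    positive; if [a] is infinite, the upper bound forces [s] to be 0. *)
Lemma le_of_mul_powR {R : realType} (a s s' : \bar R) (r k K : R) :
  (0 <= a)%E -> (0 <= s)%E -> (0 <= s')%E -> 0 < r -> 0 < k -> 0 < K ->
  (k%:E <= a * s' `^ r)%E -> (a * s `^ r <= K%:E)%E ->
  (s <= ((K / k) `^ r^-1)%:E * s')%E.
Proof.
move=> a0 s0 s'0 r0 k0 K0 H1 H2.
have C0 : 0 < (K / k) `^ r^-1 by rewrite powR_gt0 ?divr_gt0.
have ap : (0 < a)%E.
  rewrite lt0e a0 andbT; apply: contraTneq H1 => ->.
  by rewrite mul0e -ltNge lte_fin.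
have s'p : (0 < s')%E.
  rewrite lt0e s'0 andbT; apply: contraTneq H1 => ->.
  by rewrite -ltNge poweRE gt_eqF//= powR0 ?gt_eqF// mule0 lte_fin.
move: s'0 s'p H1 => /gee0P[->|[s'r s'r0 ->]] s'p H1; first by rewrite gt0_muley ?leey ?lte_fin.
move: a0 ap H1 H2 => /gee0P[->|[ar ar0 ->]] ap H1 H2.
  have : (s `^ r = 0)%E.
    apply/eqP; rewrite eq_le poweR_ge0 andbT leNgt; apply/negP => sr0.
    by move: H2; rewrite gt0_mulye// leNgt ltry.
  by move/(poweR_eq0_eq0 s0) => ->; rewrite mule_ge0// lee_fin ltW.
move: s0 H2 => /gee0P[->|[sr sr0 ->]] H2.
  by move: H2; rewrite poweRE gt_eqF// eqxx gt0_muley// leNgt ltry.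
rewrite !poweR_EFin -!EFinM !lee_fin !lte_fin in s'p ap H1 H2 *.
have {H2} H : sr `^ r <= K / k * s'r `^ r.
  rewrite -(ler_pM2l ap) (le_trans H2)// mulrCA -[leLHS]mulr1.
  by rewrite -mulrA ler_pM2l// mulrC ler_pdivlMr// mul1r.
have := @ge0_ler_powR _ r^-1 _ _ _ _ _ H.
rewrite !nnegrE invr_ge0 (ltW r0) powR_ge0 mulr_ge0 ?powR_ge0 ?(ltW (divr_gt0 K0 k0))//.
move=> /(_ isT isT isT).
rewrite powRM ?powR_ge0 ?(ltW (divr_gt0 K0 k0))// -!powRrM mulfV ?gt_eqF//.
by rewrite !powRr1.
Qed.

(** * A maximal bound near the boundary of an abstract space *)

(* Here [dl] is the square root of the pseudo-distance, hence [r ^+ 2] and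
   [e ^+ 2] below are radii and heights, and [b0] is [N + 1]. *)
Section strip.
Context {d} {T : measurableType d} {R : realType}.
Variable m : {sigma_finite_measure set T -> \bar R}.
Variables (X : set T) (dl : T -> T -> R) (h : T -> R) (b0 e0 cL CU : R).
Hypotheses (mX : measurable X)
  (mdl : measurable_fun setT (fun u : T * T => dl u.1 u.2))
  (mh : measurable_fun setT h)
  (dl_ge0 : forall x y, 0 <= dl x y)
  (dl_sym : forall x y, X x -> X y -> dl x y = dl y x)
  (dl_tri : forall x y z, X x -> X y -> X z -> dl x z <= dl x y + dl y z)
  (h_gt0 : forall x, X x -> 0 < h x)
  (h_dl : forall x y, X x -> X y -> h y <= h x + dl x y ^+ 2).

Definition dball x r := [set y | X y /\ dl x y < r].

Let prox r := [set u : T * T | [/\ X u.1, X u.2 & dl u.1 u.2 < r]].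

Let mE r : measurable (prox r).
Proof.
rewrite (_ : prox r = (X `*` X) `&` ((fun u : T * T => dl u.1 u.2) @^-1` `]-oo, r[)).
  apply: measurableI; first exact: measurableX.
  by rewrite -[X in measurable X]setTI; apply: mdl => //; exact: measurable_itv.
by apply/seteqP; split => u /=; rewrite in_itv/=; [move=> []|move=> [[]]].
Qed.

Let xsecE r x : X x -> xsection (prox r) x = dball x r.
Proof.
by move=> Xx; apply/seteqP; split => y; rewrite /xsection/= inE/=;
  [case|case].
Qed.

Let ysecE r y : X y -> ysection (prox r) y = dball y r.
Proof.
move=> Xx; apply/seteqP; split => x; rewrite /ysection/= inE/=.
  by case=> *; split=> //; rewrite dl_sym.
by case=> *; split=> //; rewrite dl_sym.
Qed.

Lemma measurable_dball x r : X x -> measurable (dball x r).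
Proof. by move=> Xx; rewrite -xsecE//; exact: measurable_xsection. Qed.

Local Open Scope ereal_scope.

Lemma measurable_int_dball r (G : T -> \bar R) :
  measurable_fun setT G -> (forall x, 0 <= G x) ->
  measurable_fun X (fun x => \int[m]_(y in dball x r) G y).
Proof.
move=> mG G0; have := measurable_int_xsection m (mE r) mG G0.
move/(measurable_funS measurableT (@subsetT _ X)).
by apply: eq_measurable_fun => x /[!inE] Xx; rewrite xsecE.
Qed.

(** The kernel [prox r] is symmetric on [X], hence balls of the same kind on both sides; symmetry is
    assumed on [X] only, so both functions are first cut off to [X]. *)
Lemma tonelli_dball r (A G : T -> \bar R) :
  measurable_fun X A -> measurable_fun setT G ->
  (forall x, 0 <= A x) -> (forall x, 0 <= G x) ->
  \int[m]_(x in X) (A x * \int[m]_(y in dball x r) G y) =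
  \int[m]_(y in X) (G y * \int[m]_(x in dball y r) A x).
Proof.
move=> mA mG A0 G0.
have pat0 (H : T -> \bar R) x : (forall x, 0 <= H x) -> 0 <= (H \_ X) x.
  by move=> H0; rewrite /patch; case: ifP.
have mAX : measurable_fun setT (A \_ X).
  by apply/(measurable_restrictT _ mX).
have mGX : measurable_fun setT (G \_ X).
  by apply/(measurable_restrictT _ mX); exact: measurable_funTS.
transitivity (\int[m]_x ((A \_ X) x * \int[m]_(y in xsection (prox r) x) (G \_ X) y)).
  rewrite integral_mkcond; apply: eq_integral => x _; rewrite /patch.
  case: ifPn => xX; last by rewrite mul0e.
  rewrite xsecE//; last exact: set_mem.
  congr (_ * _); apply: eq_integral => y.
  by rewrite inE => -[Xy _]; rewrite mem_set.
transitivity (\int[m]_y ((G \_ X) y * \int[m]_(x in ysection (prox r) y) (A \_ X) x)).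
  by apply: tonelli_xsection => // x; exact: pat0.
rewrite [RHS]integral_mkcond; apply: eq_integral => x _; rewrite /patch.
case: ifPn => xX; last by rewrite mul0e.
rewrite ysecE//; last exact: set_mem.
  congr (_ * _); apply: eq_integral => y.
by rewrite inE => -[Xy _]; rewrite mem_set.
Qed.

Definition annulus e := [set y | X y /\ (e ^+ 2 <= h y < 4 * e ^+ 2)%R].

Lemma measurable_annulus e : measurable (annulus e).
Proof.
rewrite (_ : annulus e = X `&` (h @^-1` `[e ^+ 2, 4 * e ^+ 2[)%R).
  apply: measurableI => //.
  by rewrite -[X in measurable X]setTI; apply: mh => //; exact: measurable_itv.
by apply/seteqP; split => u /=; rewrite in_itv.
Qed.

Hypotheses (e0_gt0 : (0 < e0)%R) (cL_gt0 : (0 < cL)%R) (CU_gt0 : (0 < CU)%R).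
Hypothesis ball_ub : forall x (r : R), X x -> (0 < r)%R -> (h x < r ^+ 2)%R ->
  m (dball x r) <= (CU * (r ^+ 2) `^ b0)%:E.
Hypothesis annulus_lb : forall x (e : R), X x -> (0 < e <= e0)%R ->
  (h x < 4 * e ^+ 2)%R ->
  (cL * (e ^+ 2) `^ b0)%:E <= m (dball x (5 * e)%R `&` annulus e).

Variables (p b DC kap : R) (v sg : T -> R).
Hypotheses (p1 : (1 < p)%R) (DC_gt0 : (0 < DC)%R) (kap_gt0 : (0 < kap)%R)
  (mv : measurable_fun setT v) (msg : measurable_fun setT sg)
  (v_ge0 : forall x, (0 <= v x)%R) (sg_ge0 : forall x, (0 <= sg x)%R).
Hypothesis Dp : forall x (r : R), X x -> (0 < r)%R -> (h x < r ^+ 2)%R ->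
  \int[m]_(y in dball x r) (v y)%:E *
    (\int[m]_(y in dball x r) (sg y)%:E) `^ (p - 1)
  <= (DC * (r ^+ 2) `^ (b * p))%:E.
Hypothesis v_sg : forall x, X x ->
  (kap * h x `^ (b - b0) <= v x `^ p^-1 * sg x `^ (1 - p^-1))%R.

(* Hoelder and [v_sg] bound the product of [Dp], with the second factor taken
   over the annulus only, from below by the same power of [e] as [Dp] does from
   above. *)
Lemma doubling_annulus : exists2 C : R, (0 < C)%R &
  forall x (e : R), X x -> (0 < e <= e0)%R -> (h x < 4 * e ^+ 2)%R ->
  \int[m]_(y in dball x (5 * e)%R) (sg y)%:E <=
  C%:E * \int[m]_(y in dball x (5 * e)%R `&` annulus e) (sg y)%:E.
Proof.
have p0 : (0 < p)%R by exact: lt_trans ltr01 p1.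
(* On the annulus h / e^2 lies between 1 and 4, so [cmin] bounds its power [b - b0] from below for
   either sign of the exponent. *)
pose cmin : R := Num.min 1%R (4 `^ (b - b0))%R.
have cmin0 : (0 < cmin)%R by rewrite /cmin lt_min ltr01 powR_gt0.
pose k1 : R := (kap * cmin * cL)%R.
have kap0 := ltW kap_gt0.
have cL0 := ltW cL_gt0.
have DC0 := ltW DC_gt0.
have cmin0' := ltW cmin0.
have p0' := ltW p0.
have k10 : (0 < k1)%R by rewrite !mulr_gt0.
(* The 25 is the square of the 5 in the radius [5 * e]. In [K / k] below the powers of [e] cancel,
   so the constant does not depend on [e]. *)
exists ((DC * 25 `^ (b * p) / (k1 `^ p)) `^ (p - 1)^-1)%R.
  by rewrite powR_gt0 ?divr_gt0 ?mulr_gt0 ?powR_gt0.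
move=> x e Xx ee hx; have /andP[e_gt0 _] := ee.
have e2 : (0 < e ^+ 2)%R by rewrite exprn_gt0.
have e2' := ltW e2.
have k10' := ltW k10.
set B := dball x (5 * e)%R; set A := B `&` annulus e.
have mB : measurable B by exact: measurable_dball.
have mA : measurable A by apply: measurableI => //; exact: measurable_annulus.
have int_ge0 (F : T -> R) D : (forall x, 0 <= F x)%R -> 0 <= \int[m]_(x in D) (F x)%:E.
  by move=> F0; apply: integral_ge0 => *; rewrite lee_fin.
have mEF (F : T -> R) D : measurable_fun setT F -> measurable_fun D (EFin \o F).
  by move=> mF; apply/measurable_EFinP; exact: measurable_funTS.
(* The pointwise bound [v_sg] times the volume of [A]: (e^2)^(b - b0) (e^2)^b0 = (e^2)^b. *)
have H1 : (k1 * (e ^+ 2) `^ b)%:E <=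
    \int[m]_(y in A) (v y `^ p^-1 * sg y `^ (1 - p^-1))%:E.
  apply: (@le_trans _ _ (\int[m]_(y in A) (kap * cmin * (e ^+ 2) `^ (b - b0))%:E)).
    rewrite integral_cst// /k1.
    have -> : (kap * cmin * cL * (e ^+ 2) `^ b =
      kap * cmin * (e ^+ 2) `^ (b - b0) * (cL * (e ^+ 2) `^ b0))%R.
      rewrite -!mulrA; congr (_ * (_ * _))%R; rewrite mulrCA; congr (_ * _)%R.
      by rewrite -powRD ?subrK// (gt_eqF e2) implybT.
    rewrite EFinM; apply: lee_pmul => //; rewrite ?lee_fin ?mulr_ge0 ?powR_ge0// //.
    exact: annulus_lb.
  apply: ge0_le_integral => //.
  - by move=> y _; rewrite lee_fin !mulr_ge0 ?powR_ge0//.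
  - apply: mEF; apply: measurable_funM;
      exact: (measurableT_comp (measurable_powR _)).
  - move=> y [_ [Xy /andP[h1 h2]]]; rewrite lee_fin (le_trans _ (v_sg Xy))//.
    rewrite -mulrA ler_pM2l//.
    have [bb|bb] := leP 0%R (b - b0)%R.
      apply: (@le_trans _ _ ((e ^+ 2) `^ (b - b0))%R).
        by rewrite ger_pMl ?powR_gt0// /cmin ge_min lexx.
      by apply: ge0_ler_powR; rewrite ?nnegrE // (le_trans e2').
    apply: (@le_trans _ _ ((4 * e ^+ 2) `^ (b - b0))%R).
      rewrite powRM //; apply: ler_wpM2r; first exact: powR_ge0.
      by rewrite /cmin ge_min lexx orbT.
    have hy0 := h_gt0 Xy; have e42 : (0 < 4 * e ^+ 2)%R by rewrite mulr_gt0.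
    have -> : (b - b0 = - (b0 - b))%R by rewrite opprB.
    rewrite (powRN (h y)) (powRN (4 * _)) lef_pV2 ?posrE ?powR_gt0//.
    by apply: ge0_ler_powR; rewrite ?nnegrE ?(ltW hy0) ?(ltW e42) ?(ltW h2)// subr_ge0 -subr_le0 ltW.
set k : R := (k1 `^ p * (e ^+ 2) `^ (b * p))%R.
set K : R := (DC * 25 `^ (b * p) * (e ^+ 2) `^ (b * p))%R.
have H2 : k%:E <= \int[m]_(y in B) (v y)%:E * (\int[m]_(y in A) (sg y)%:E) `^ (p - 1).
  apply: (@le_trans _ _ (\int[m]_(y in A) (v y)%:E * (\int[m]_(y in A) (sg y)%:E) `^ (p - 1))).
    apply: le_trans (hoelder_setX m mA mv msg v_ge0 sg_ge0 p1).
    rewrite /k powRrM -powRM ?powR_ge0 // -poweR_EFin.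
    apply: gt0_ler_poweR; rewrite ?in_itv//= ?leey ?andbT ?lee_fin.
      by rewrite mulr_ge0 ?powR_ge0.
    by apply: int_ge0 => y; rewrite mulr_ge0 ?powR_ge0.
  apply: lee_pmul => //; rewrite ?int_ge0 ?poweR_ge0//.
  by apply: ge0_subset_integral => //; [exact: mEF|move=> *; rewrite lee_fin|move=> ? []].
have H3 : \int[m]_(y in B) (v y)%:E * (\int[m]_(y in B) (sg y)%:E) `^ (p - 1) <= K%:E.
  have := Dp Xx (_ : 0 < 5 * e)%R; rewrite mulr_gt0// => /(_ isT).
  rewrite exprMn -natrX => D'; apply: le_trans (D' _) _.
    by rewrite (lt_le_trans hx)// ler_pM2r// ler_nat.
  by rewrite lee_fin powRM // mulrA.
have pm1 : (0 < p - 1)%R by rewrite subr_gt0.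
have k0 : (0 < k)%R by rewrite mulr_gt0// powR_gt0.
have K0 : (0 < K)%R by rewrite !mulr_gt0// powR_gt0.
apply: le_trans (le_of_mul_powR _ _ _ pm1 k0 K0 H2 H3) _; rewrite ?int_ge0//.
rewrite le_eqVlt; apply/orP; left; apply/eqP; congr ((_ `^ _)%:E * _)%E.
by rewrite /K /k -mulf_div divff ?mulr1// gt_eqF// powR_gt0.
Qed.

Definition strip_mass x r e : \bar R :=
  \int[m]_(y in dball x r `&` [set y | (h y < e ^+ 2)%R]) (sg y)%:E.

Let strip_measurable e : measurable [set y | (h y < e ^+ 2)%R].
Proof.
rewrite (_ : [set y | _] = h @^-1` `]-oo, (e ^+ 2)%R[).
  by rewrite -[X in measurable X]setTI; apply: mh => //; exact: measurable_itv.
by apply/seteqP; split => u /=; rewrite in_itv.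
Qed.

(* Integrate [doubling_annulus] over the centres [x] in the annulus and exchange
   the integrals: a point of the strip sees about as many centres as a point of
   the annulus. *)
Lemma strip_step : exists2 eta : R, (0 < eta)%R &
  forall x0 r (e : R), X x0 -> (0 < e <= e0)%R ->
  (1 + eta)%:E * strip_mass x0 r e <= strip_mass x0 (r + 10 * e)%R (2 * e)%R.
Proof.
have [C0 C0_gt0 HC0] := doubling_annulus.
(* [C0] is the doubling constant. The other factor compares the largest measure of centres that see
   a point of the annulus with the least measure of those that see a point of the strip. *)
pose C1 : R := (C0 * (CU * 25 `^ b0 / cL))%R.
have C1_gt0 : (0 < C1)%R by rewrite !mulr_gt0 ?powR_gt0 ?invr_gt0.
exists C1^-1%R; first by rewrite invr_gt0.
move=> x0 r e Xx0 ee; have /andP[e_gt0 _] := ee.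
have e2 : (0 < e ^+ 2)%R by rewrite exprn_gt0.
have e5 : (0 < 5 * e)%R by rewrite mulr_gt0.
pose W := dball x0 r `&` [set y | (h y < e ^+ 2)%R].
pose Y := annulus e.
(* A point within [5 * e] of a centre that is itself within [5 * e] of [W] is within [r + 10 * e] of
   [x0]. *)
pose Z := Y `&` dball x0 (r + 10 * e)%R.
have mY : measurable Y by exact: measurable_annulus.
have mW : measurable W by apply: measurableI; [exact: measurable_dball|].
have mZ : measurable Z by apply: measurableI; [|exact: measurable_dball].
pose f : T -> \bar R := EFin \o sg.
have mf D : measurable_fun D f by apply/measurable_EFinP; exact: measurable_funTS.
have f0 y : 0 <= f y by rewrite lee_fin.
have mpat D : measurable D -> measurable_fun setT (f \_ D).
  by move=> mD; apply/(measurable_restrictT _ mD).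
have mpatX D : measurable D -> measurable_fun X (f \_ D).
  by move=> mD; apply: measurable_funTS; exact: mpat.
have pat0 D y : 0 <= (f \_ D) y by rewrite /patch; case: ifP.
pose A : T -> \bar R := EFin \o \1_Y.
have mA D : measurable_fun D A.
  by apply/measurable_EFinP; apply: measurable_funTS; exact/measurable_indicP.
have A0 y : 0 <= A y by rewrite lee_fin indicE ler0n.
have XD D (F : T -> \bar R) : D `<=` X -> \int[m]_(y in X) (F \_ D) y = \int[m]_(y in D) F y.
  by move=> DX; rewrite -integral_mkcondr setIidr.
have intA y : X y -> \int[m]_(x in dball y (5 * e)%R) A x = m (dball y (5 * e)%R `&` Y).
  by move=> Xy; rewrite integral_indic ?setIT// 1?setIC//; exact: measurable_dball.
have H1 : (cL * (e ^+ 2) `^ b0)%:E * strip_mass x0 r e <=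
    \int[m]_(y in X) ((f \_ W) y * \int[m]_(x in dball y (5 * e)%R) A x).
  rewrite /strip_mass -/W -(XD W f); last by move=> y [[]].
  have K0 : (0 <= cL * (e ^+ 2) `^ b0)%R by rewrite !mulr_ge0 ?powR_ge0 ?(ltW cL_gt0).
  rewrite -(ge0_integralZl m mX (mpatX _ mW) (fun y _ => pat0 W y) (_ : 0 <= _%:E)) ?lee_fin//.
  apply: (ge0_le_integral m mX).
  - by move=> y _; apply: mule_ge0; rewrite ?lee_fin.
  - by apply: measurable_funeM; exact: mpatX.
  - apply: emeasurable_funM; first exact: mpatX.
    exact: measurable_int_dball.
  - move=> y Xy; rewrite intA// muleC {1 2}/patch.
    case: ifPn => [/set_mem[_ hy]|_]; last by rewrite !mul0e.
    apply: lee_wpmul2l => //; apply: annulus_lb => //.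
    by rewrite (lt_le_trans hy)// ler_peMl ?ler1n// ltW.
have H2 : \int[m]_(y in X) ((f \_ W) y * \int[m]_(x in dball y (5 * e)%R) A x) =
    \int[m]_(x in X) (A x * \int[m]_(y in dball x (5 * e)%R) (f \_ W) y).
  by apply/esym/tonelli_dball => //; exact: mpat.
have H3 : \int[m]_(x in X) (A x * \int[m]_(y in dball x (5 * e)%R) (f \_ W) y) <=
    C0%:E * \int[m]_(x in X) (A x * \int[m]_(y in dball x (5 * e)%R) (f \_ Z) y).
  have mAI D : measurable D ->
      measurable_fun X (fun x => A x * \int[m]_(y in dball x (5 * e)%R) (f \_ D) y).
    move=> mD; apply: emeasurable_funM => //.
    by apply: measurable_int_dball => //; exact: mpat.
  have AI0 D x : 0 <= A x * \int[m]_(y in dball x (5 * e)%R) (f \_ D) y.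
    by rewrite mule_ge0 ?integral_ge0.
  rewrite -(ge0_integralZl m mX (mAI _ mZ) (fun y _ => AI0 Z y) (_ : 0 <= _%:E)) ?lee_fin ?(ltW C0_gt0)//.
  apply: (ge0_le_integral m mX) => [x _| | |].
  - exact: AI0.
  - exact: mAI.
  - by apply: measurable_funeM; exact: mAI.
  - move=> x Xx; rewrite /A /= indicE; case: (boolP (x \in Y)) => [/set_mem Yx|_]; last first.
      by rewrite !mul0e mule0.
    rewrite !mul1e -!integral_mkcondr.
    (* A centre whose ball misses [W] contributes nothing on the left; otherwise a point [w0] of [W]
       ties the centre to [x0]. *)
    have [->|/set0P[w0 [[_ dw0] [[Xw0 dw0'] _]]]] := eqVneq (dball x (5 * e)%R `&` W) set0.
      by rewrite integral_set0 mule_ge0 ?lee_fin ?(ltW C0_gt0) ?integral_ge0.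
    have mB := measurable_dball (5 * e)%R Xx.
    have dx : (dl x0 x < r + 5 * e)%R.
      by rewrite (le_lt_trans (dl_tri Xx0 Xw0 Xx)) ?ltrD ?(dl_sym Xw0 Xx).
    apply: (@le_trans _ _ (\int[m]_(y in dball x (5 * e)%R) f y)).
      by apply: (ge0_subset_integral m (measurableI _ _ mB mW) mB (mf _)) => [? _|? []].
    case: (Yx) => _ /andP[_ hx].
    apply: (le_trans (HC0 x e Xx ee hx)); apply: lee_wpmul2l; first by rewrite lee_fin ltW.
    apply: (ge0_subset_integral m (measurableI _ _ mB mY) (measurableI _ _ mB mZ) (mf _)).
      by move=> ? _; exact: f0.
    move=> w [[Xw dw] Yw]; split; first by split.
    split; first exact: Yw.
    split; first exact: Xw.
    rewrite (le_lt_trans (dl_tri Xx0 Xx Xw))//.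
    by rewrite (_ : 10 * e = 5 * e + 5 * e)%R ?addrA ?ltrD// -mulrDl; congr (_ * _)%R; lra.
have H4 : \int[m]_(x in X) (A x * \int[m]_(y in dball x (5 * e)%R) (f \_ Z) y) =
    \int[m]_(y in X) ((f \_ Z) y * \int[m]_(x in dball y (5 * e)%R) A x).
  by apply: tonelli_dball => //; exact: mpat.
have H5 : \int[m]_(y in X) ((f \_ Z) y * \int[m]_(x in dball y (5 * e)%R) A x) <=
    (CU * 25 `^ b0 * (e ^+ 2) `^ b0)%:E * \int[m]_(y in Z) f y.
  have K0 : (0 <= CU * 25 `^ b0 * (e ^+ 2) `^ b0)%R by rewrite !mulr_ge0 ?powR_ge0 ?(ltW CU_gt0).
  rewrite -(XD Z f); last by move=> y [[]].
  rewrite -(ge0_integralZl m mX (mpatX _ mZ) (fun y _ => pat0 Z y) (_ : 0 <= _%:E)) ?lee_fin//.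
  apply: (ge0_le_integral m mX).
  - by move=> y _; apply: mule_ge0; [exact: pat0|apply: integral_ge0 => ? _; exact: A0].
  - apply: emeasurable_funM; first exact: mpatX.
    exact: measurable_int_dball.
  - by apply: measurable_funeM; exact: mpatX.
  - move=> y Xy; rewrite intA// muleC {1 2}/patch.
    case: ifPn => [/set_mem[[_ /andP[_ hy]] _]|_]; last by rewrite !mule0.
    apply: lee_wpmul2r => //.
    have mB := measurable_dball (5 * e)%R Xy.
    apply: (@le_trans _ _ (m (dball y (5 * e)%R))).
      by apply: le_measure; rewrite ?inE//; exact: measurableI.
    apply: (le_trans (ball_ub Xy e5 _)); rewrite exprMn -natrX.
      by rewrite (lt_le_trans hy)// ler_pM2r// ler_nat.
    by rewrite lee_fin powRM// ?mulrA// ltW.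
have H6 : strip_mass x0 r e <= C1%:E * \int[m]_(y in Z) f y.
  have cE : (0 < cL * (e ^+ 2) `^ b0)%R by rewrite mulr_gt0 ?powR_gt0.
  rewrite -(@lee_pmul2l _ (cL * (e ^+ 2) `^ b0)%:E)// ?lte_fin//.
  apply: (le_trans H1); rewrite H2; apply: (le_trans H3); rewrite H4.
  apply: (@le_trans _ _ (C0%:E * ((CU * 25 `^ b0 * (e ^+ 2) `^ b0)%:E * \int[m]_(y in Z) f y))).
    by apply: lee_wpmul2l => //; rewrite lee_fin ltW.
  rewrite !muleA -!EFinM le_eqVlt; apply/orP; left; apply/eqP; congr (_%:E * _).
  by rewrite /C1; field; rewrite gt_eqF.
clear H1 H2 H3 H4 H5.
have IZ0 : 0 <= \int[m]_(y in Z) f y by apply: integral_ge0.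
rewrite EFinD ge0_muleDl ?lee_fin ?invr_ge0 ?(ltW C1_gt0)// mul1e.
have mB1 := measurable_dball (r + 10 * e)%R Xx0.
(* [W] and [Z] are separated by the height e^2 and both lie in the strip h < (2 e)^2, so their
   masses add up there. *)
apply: (@le_trans _ _ (strip_mass x0 r e + \int[m]_(y in Z) f y)).
  apply: leeD2l; rewrite -(@lee_pmul2l _ C1%:E) ?lte_fin//.
  by rewrite muleA -EFinM divff ?gt_eqF// mul1e.
rewrite /strip_mass -/W -(ge0_integral_setU m mW mZ (mf _) (fun y _ => f0 y)); last first.
  by apply/disj_setPLR => y [_ /=] hy [[_ /andP[]]]; rewrite leNgt hy.
apply: (ge0_subset_integral m (measurableU _ _ mW mZ) (measurableI _ _ mB1 (strip_measurable _)) (mf _)).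
  by move=> y _; exact: f0.
have e2E : ((2 * e) ^+ 2 = 4 * e ^+ 2)%R by rewrite exprMn -natrX.
move=> y [[[Xy dy] /= hy]|[[Xy /andP[hy1 hy2]] [_ dy]]]; do !split => //=.
- by rewrite (lt_le_trans dy)// lerDl mulr_ge0// ltW.
- by rewrite e2E (lt_le_trans hy)// ler_peMl ?ler1n// ltW.
- by rewrite e2E.
Qed.

(** The enlargements of the radius form the series 10 e (1/2 + 1/4 + ...), so the ball grows by less
    than [10 * e] however thin the strip is. *)
Lemma strip_iter : exists2 eta : R, (0 < eta)%R &
  forall x0 r (e : R) n, X x0 -> (0 < e <= e0)%R ->
  ((1 + eta) ^+ n)%:E * strip_mass x0 r (2^-1 ^+ n * e)%R <=
  strip_mass x0 (r + 10 * e * (1 - 2^-1 ^+ n))%R e.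
Proof.
have [eta eta0 step] := strip_step; exists eta => // x0 r e n Xx0 /andP[e_gt0 ee].
elim: n r => [|n IH] r.
  by rewrite !expr0 subrr mulr0 addr0 !mul1r mul1e.
pose e' : R := (2^-1 ^+ n.+1 * e)%R.
have e'0 : (0 < e' <= e0)%R.
  rewrite mulr_gt0 ?exprn_gt0//= (le_trans _ ee)// ler_piMl ?(ltW e_gt0)//.
  by rewrite exprn_ile1 ?invr_ge0// invf_le1 ?ler1n.
have /(step _ r) := e'0 => /(_ _ Xx0) {}step.
rewrite exprSr EFinM -muleA.
have eta1 : 0 <= ((1 + eta) ^+ n)%:E by rewrite lee_fin exprn_ge0 ?addr_ge0 ?(ltW eta0).
apply: (le_trans (lee_wpmul2l eta1 step)).
have -> : (2 * e' = 2^-1 ^+ n * e)%R.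
  by rewrite /e' exprS !mulrA divff ?mul1r ?pnatr_eq0.
apply: (le_trans (IH _)); rewrite (_ : (_ + _ + _)%R = r + 10 * e * (1 - 2^-1 ^+ n.+1))%R//.
by rewrite /e' exprS; field.
Qed.

Lemma strip_mass_le x0 (r r' e : R) : X x0 -> (r <= r')%R ->
  strip_mass x0 r e <= \int[m]_(y in dball x0 r') (sg y)%:E.
Proof.
move=> Xx0 rr'; have mB := measurable_dball r Xx0; have mB' := measurable_dball r' Xx0.
apply: (ge0_subset_integral m (measurableI _ _ mB (strip_measurable e)) mB').
- by apply/measurable_EFinP; exact: measurable_funTS.
- by move=> y _; rewrite lee_fin.
- by move=> y [[Xy /lt_le_trans dy] _]; split => //; exact: dy.
Qed.

Lemma powR_dyadic (g : R) k :
  (((2^-1 ^+ k) ^+ 2) `^ (- g) = (4 `^ g) ^+ k)%R.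
Proof.
elim: k => [|k IH]; first by rewrite !expr0 expr1n powR1.
rewrite (exprS 2^-1%R k) (exprS (4 `^ g)%R k) -IH exprMn powRM ?exprn_ge0 ?invr_ge0//; congr (_ * _)%R.
have -> : (2^-1 ^+ 2 = (4 : R) `^ (-1) :> R)%R.
  by rewrite powR_inv1// exprVn -natrX.
by rewrite -powRrM mulN1r opprK.
Qed.

(** If [t] is below e^2, the term of the thinnest strip containing [t] already dominates; otherwise
    the first summand does. This turns an integral of h^(-gam) into a series of strip masses. *)
Lemma powR_dyadic_strip (gam e t : R) : (0 < gam)%R -> (0 < e)%R -> (0 < t)%R ->
  (t `^ (- gam))%:E <= ((e ^+ 2) `^ (- gam))%:E +
    \sum_(0 <= n <oo) (if (t < (2^-1 ^+ n * e) ^+ 2)%R then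
      (e ^+ 2) `^ (- gam) * (4 `^ gam) ^+ n.+1 else 0)%:E.
Proof.
move=> gam0 e_gt0 t_gt0.
have e2 : (0 < e ^+ 2)%R by rewrite exprn_gt0.
pose u n : \bar R := (if (t < (2^-1 ^+ n * e) ^+ 2)%R then
      (e ^+ 2) `^ (- gam) * (4 `^ gam) ^+ n.+1 else 0)%:E.
have u0 n : 0 <= u n.
  by rewrite lee_fin; case: ifP => // _; rewrite mulr_ge0 ?exprn_ge0 ?powR_ge0.
have powN (x y : R) : (0 < x)%R -> (x <= y)%R -> (y `^ (- gam) <= x `^ (- gam))%R.
  move=> x0 xy; have y0 := lt_le_trans x0 xy.
  rewrite (powRN x) (powRN y) lef_pV2 ?posrE ?powR_gt0//.
  by apply: ge0_ler_powR; rewrite ?nnegrE ?(ltW gam0) ?(ltW x0) ?(ltW y0).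
have [et|te] := leP (e ^+ 2)%R t.
  rewrite -[leLHS]adde0; apply: leeD; last by apply: nneseries_ge0 => n _ _; exact: u0.
  by rewrite lee_fin powN.
have exN : exists n, ((2^-1 ^+ n * e) ^+ 2 <= t)%R.
  have [n Hn] : exists n : nat, (e ^+ 2 / t <= n%:R)%R.
    exists (Num.trunc (e ^+ 2 / t)).+1; exact: ltW (truncnS_gt _).
  exists n; rewrite exprMn -exprM mulnC exprM exprVn -natrX exprVn ler_pdivrMl ?exprn_gt0 ?ltr0n//.
  move: Hn; rewrite ler_pdivrMr// => /le_trans; apply; rewrite ler_pM2r//.
  by rewrite -natrX ler_nat ltnW// ltn_expl.
have := ex_minnP exN; case=> [[|n]] Hn min_n.
  by move: te; rewrite ltNge; rewrite expr0 mul1r in Hn; rewrite Hn.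
have tn : (t < (2^-1 ^+ n * e) ^+ 2)%R.
  by rewrite ltNge; apply/negP => /min_n; rewrite ltnn.
rewrite -[leLHS]add0e; apply: leeD; first by rewrite lee_fin powR_ge0.
apply: le_trans (nneseries_lim_ge n.+1 (fun k _ _ => u0 k)).
rewrite big_nat_recr//= -[leLHS]add0e; apply: leeD; first by rewrite sume_ge0.
rewrite /u tn lee_fin (le_trans (powN _ _ _ Hn)) ?exprn_gt0 ?mulr_gt0 ?exprn_gt0//.
rewrite exprMn powRM ?exprn_ge0 ?mulr_ge0 ?(ltW e_gt0)// mulrC.
by rewrite ler_pM2l ?powR_gt0// powR_dyadic.
Qed.

(** Halving [e] divides the strip mass by at least 1 + eta, while the weight h^(-gam) grows by 4^gam
    only, so any gam with 4^gam < 1 + eta works. The bound [R1] on the radii allows [e] to be a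
    fixed fraction of [r] and still at most [e0]. *)
Lemma weighted_strip (R1 : R) : (0 < R1)%R ->
  exists gam C : R, [/\ (0 < gam)%R, (0 < C)%R &
  forall x0 (r : R), X x0 -> (0 < r <= R1)%R ->
  \int[m]_(y in dball x0 r) (sg y * h y `^ (- gam))%:E <=
  (C * (r ^+ 2) `^ (- gam))%:E * \int[m]_(y in dball x0 (11 * r)%R) (sg y)%:E].
Proof.
move=> R10; have [eta eta0 iter] := strip_iter.
have ln40 : (0 < ln (4 : R))%R by rewrite ln_gt0// ltr1n.
(* Any [l] strictly between 1 and [1 + eta] would do; [gam] solves 4^gam = l. *)
pose l : R := (1 + eta / 2)%R; have l1 : (1 < l)%R by rewrite ltrDl divr_gt0.
have l0 : (0 < l)%R by exact: lt_trans ltr01 l1.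
pose gam : R := (ln l / ln 4)%R.
have gam0 : (0 < gam)%R by rewrite divr_gt0// ln_gt0.
have El : (4 `^ gam = l)%R.
  by rewrite /powR pnatr_eq0/= /gam divfK ?gt_eqF// lnK ?posrE.
pose th : R := (l / (1 + eta))%R.
have e10 : (0 < 1 + eta)%R by rewrite addr_gt0.
have th0 : (0 <= th)%R by rewrite divr_ge0 ?(ltW l0) ?(ltW e10).
have th1 : (th < 1)%R by rewrite ltr_pdivrMr// mul1r /l ltrD2l ltr_pdivrMr// ltr_pMr// ltr1n.
pose e1 : R := Num.min 1%R (e0 / R1)%R.
have e1_gt0 : (0 < e1)%R by rewrite lt_min ltr01 divr_gt0.
(* The 1 comes from the summand that involves no strip, the rest from the geometric series of ratio
   [th]. *)
pose K : R := (1 + l * (1 - th)^-1)%R.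
have th1' : (0 < 1 - th)%R by rewrite subr_gt0.
have K0 : (0 < K)%R by rewrite addr_gt0// mulr_gt0// invr_gt0.
exists gam, ((e1 ^+ 2) `^ (- gam) * K)%R; split => //.
  by rewrite mulr_gt0// powR_gt0 ?exprn_gt0.
move=> x0 r Xx0 /andP[r0 rR].
pose e : R := (e1 * r)%R.
have e_gt0 : (0 < e)%R by rewrite mulr_gt0.
have er : (e <= r)%R by rewrite ler_piMl ?(ltW r0)// ge_min lexx.
have ee0 : (0 < e <= e0)%R.
  rewrite e_gt0/= (@le_trans _ _ (e0 / R1 * r)%R)//.
    by rewrite ler_pM2r// ge_min lexx orbT.
  by rewrite mulrAC ler_pdivrMr// ler_pM2l.
pose B := dball x0 r; have mB : measurable B by exact: measurable_dball.
pose I := \int[m]_(y in dball x0 (11 * r)%R) (sg y)%:E.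
have I0 : 0 <= I by apply: integral_ge0 => y _; rewrite lee_fin.
pose c : R := ((e ^+ 2) `^ (- gam))%R; have c0 : (0 <= c)%R by exact: powR_ge0.
pose Dn n := [set y | (h y < (2^-1 ^+ n * e) ^+ 2)%R].
have mD n : measurable (Dn n) by exact: strip_measurable.
pose u n y : \bar R := (c * l ^+ n.+1)%:E * ((EFin \o sg) \_ (Dn n)) y.
have mf D : measurable_fun D (EFin \o sg).
  by apply/measurable_EFinP; exact: measurable_funTS.
have cl0 n : 0 <= (c * l ^+ n.+1)%:E by rewrite lee_fin mulr_ge0 ?exprn_ge0 ?(ltW l0).
have pat0 n y : 0 <= ((EFin \o sg) \_ (Dn n)) y.
  by rewrite /patch; case: ifP => // _; rewrite lee_fin.
have mpat n : measurable_fun B ((EFin \o sg) \_ (Dn n)).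
  apply: measurable_funTS; apply/(measurable_restrictT _ (mD n)); exact: mf.
have mu_ n : measurable_fun B (u n) by exact: measurable_funeM.
have u0 n y : 0 <= u n y by rewrite mule_ge0.
have H1 : \int[m]_(y in B) (sg y * h y `^ (- gam))%:E <=
    \int[m]_(y in B) (c%:E * (sg y)%:E + \sum_(0 <= n <oo) u n y).
  apply: (ge0_le_integral m mB).
  - by move=> y _; rewrite lee_fin mulr_ge0 ?powR_ge0.
  - apply/measurable_EFinP; apply: measurable_funM; first exact: measurable_funTS.
    by apply: measurable_funTS; exact: (measurableT_comp (measurable_powR _)).
  - apply: emeasurable_funD; first by apply: measurable_funeM; exact: mf.
    by apply: ge0_emeasurable_sum => // n y _ _; exact: u0.
  - move=> y [Xy _]; rewrite EFinM.
    have sy : 0 <= (sg y)%:E by rewrite lee_fin.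
    apply: (le_trans (lee_wpmul2l sy (powR_dyadic_strip gam0 e_gt0 (h_gt0 Xy)))).
    rewrite ge0_muleDr ?lee_fin//; last first.
      by apply: nneseries_ge0 => n _ _; rewrite lee_fin; case: ifP => // _;
        rewrite mulr_ge0 ?exprn_ge0 ?powR_ge0.
    rewrite muleC; apply: leeD => //.
    rewrite -nneseriesZl//; last first.
      by move=> n _; rewrite lee_fin; case: ifP => // _;
        rewrite mulr_ge0 ?exprn_ge0 ?powR_ge0.
    apply: lee_nneseries => [n _ _|n _].
      by rewrite mule_ge0// lee_fin; case: ifP => // _;
        rewrite mulr_ge0 ?exprn_ge0 ?powR_ge0.
    rewrite /u /patch El -/c; case: (boolP (y \in Dn n)) => [/set_mem|/negP yD].
      by rewrite /Dn/= => ->; rewrite muleC.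
    by rewrite ifN ?mule0//; apply/negP => hy; apply: yD; rewrite inE.
apply: (le_trans H1); clear H1.
have mS : measurable_fun B (fun y => \sum_(0 <= n <oo) u n y).
  by apply: ge0_emeasurable_sum => // n y _ _; exact: u0.
have S0 y : B y -> 0 <= \sum_(0 <= n <oo) u n y.
  by move=> _; apply: nneseries_ge0 => n _ _; exact: u0.
have mcf : measurable_fun B (fun y => c%:E * (sg y)%:E).
  by apply: measurable_funeM; exact: mf.
have cf0 y : B y -> 0 <= c%:E * (sg y)%:E by rewrite mule_ge0 ?lee_fin.
rewrite (ge0_integralD m mB cf0 mcf S0 mS).
have f0 y : B y -> 0 <= (EFin \o sg) y by rewrite lee_fin.
rewrite (ge0_integralZl m mB (mf _) f0) ?lee_fin//.
rewrite (integral_nneseries m mB mu_ (fun n y _ => u0 n y)).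
have HI : \int[m]_(y in B) (sg y)%:E <= I.
  apply: (ge0_subset_integral m mB (measurable_dball _ Xx0) (mf _)).
    by move=> y _; rewrite lee_fin.
  move=> y [Xy dy]; split => //; rewrite (lt_le_trans dy)// ler_peMl ?ler1n ?(ltW r0)//.
have Hser : \sum_(0 <= n <oo) \int[m]_(y in B) u n y <= (c * (l * (1 - th)^-1))%:E * I.
  apply: nneseries_le => [n|n]; first by apply: integral_ge0 => y _; exact: u0.
  apply: (@le_trans _ _ (\sum_(0 <= i < n) (c * l * th ^+ i)%:E * I)).
    apply: lee_sum => i _.
    rewrite (ge0_integralZl m mB (mpat i) (fun y _ => pat0 i y) (cl0 i)) -integral_mkcondr.
    have -> : (c * l ^+ i.+1 = c * l * th ^+ i * (1 + eta) ^+ i)%R.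
      rewrite /th expr_div_n exprS -!mulrA mulVf ?mulr1//.
      by rewrite gt_eqF// exprn_gt0.
    rewrite EFinM -muleA; apply: lee_wpmul2l.
      by rewrite lee_fin !mulr_ge0 ?exprn_ge0 ?(ltW l0).
    apply: (le_trans (iter x0 r e i Xx0 ee0)); apply: strip_mass_le => //.
    rewrite (_ : 11 * r = r + 10 * r)%R; last by ring.
    rewrite lerD2l -mulrA ler_pM2l//.
    rewrite (le_trans _ er)// ler_piMr ?(ltW e_gt0)// gerBl exprn_ge0 ?invr_ge0//.
  rewrite -ge0_sume_distrl; last first.
    by move=> i _; rewrite lee_fin !mulr_ge0 ?exprn_ge0 ?(ltW l0).
  apply: lee_wpmul2r => //; rewrite sumEFin lee_fin -mulr_sumr mulrA.
  by apply: ler_wpM2l; [rewrite mulr_ge0 ?(ltW l0)|exact: sum_geometric_le].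
apply: (le_trans (leeD (lee_wpmul2l _ HI) Hser)); first by rewrite lee_fin.
rewrite -ge0_muleDl ?lee_fin ?mulr_ge0 ?invr_ge0 ?(ltW l0) ?(ltW th1')//.
rewrite le_eqVlt; apply/orP; left; apply/eqP; congr (_%:E * _).
rewrite /c /e exprMn powRM ?exprn_ge0 ?(ltW e1_gt0) ?(ltW r0)// /K.
by ring.
Qed.

(* The Schur test, with [h `^ (- gam)] as test weight, at a single scale. *)
Lemma level_bound : exists gam K : R, [/\ (0 < gam)%R, (0 < K)%R &
  forall (g : T -> R) (e : R), measurable_fun setT g -> (forall x, 0 <= g x)%R ->
  (0 < e <= 2)%R ->
  \int[m]_(z in X) ((if (h z < 2 * e ^+ 2)%R then v z else 0)%:E *
    (\int[m]_(w in dball z (2 * e)%R)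
       (g w `^ p^-1 * sg w `^ (1 - p^-1))%:E) `^ p) <=
  \int[m]_(w in X) (if (h w < 6 * e ^+ 2)%R then
     K * (e ^+ 2) `^ (b * p - gam) * (g w * h w `^ gam) else 0)%:E].
Proof.
(* The strip estimate is applied to balls of radius [4 * e], which is at most 8. *)
have [gam [C [gam0 C0 HJ]]] := weighted_strip (ltr0n R 8 : (0 < 8)%R).
have pm1 : (0 < p - 1)%R by rewrite subr_gt0.
have p0 : (0 < p)%R by exact: lt_trans ltr01 p1.
(* The 16 is the square of the 4 in this radius; 44 = 11 * 4 is the enlarged radius at which the
   class D is then applied. *)
pose K : R := ((C * 16 `^ (- gam)) `^ (p - 1) * (DC * (44 ^+ 2) `^ (b * p)))%R.
have K0 : (0 < K)%R by rewrite !mulr_gt0 ?powR_gt0 ?mulr_gt0 ?powR_gt0 ?exprn_gt0.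
exists (gam * (p - 1))%R, K; split; [exact: mulr_gt0|exact: K0|].
move=> g e mg g0 /andP[e_gt0 e2].
have ee : (0 < e ^+ 2)%R by rewrite exprn_gt0.
have mpow (q : R) : measurable_fun setT (fun x => h x `^ q)%R.
  exact: (measurableT_comp (measurable_powR _)).
have mEF (F : T -> R) D : measurable_fun setT F -> measurable_fun D (EFin \o F).
  by move=> mF; apply/measurable_EFinP; exact: measurable_funTS.
(* The powers of [h] in [s1] and [g1] are matched: gam (p - 1) / p = gam (1 - 1/p), so they cancel
   in Hoelder's product. *)
pose s1 w : R := (sg w * h w `^ (- gam))%R.
have ms1 : measurable_fun setT s1 by exact: measurable_funM.
have s10 w : (0 <= s1 w)%R by rewrite mulr_ge0 ?powR_ge0.
pose g1 w : R := (g w * h w `^ (gam * (p - 1)))%R.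
have mg1 : measurable_fun setT g1 by exact: measurable_funM.
have g10 w : (0 <= g1 w)%R by rewrite mulr_ge0 ?powR_ge0.
have eg0 w : 0 <= (EFin \o g1) w by rewrite /= lee_fin.
pose J z := \int[m]_(w in dball z (2 * e)%R) (EFin \o s1) w.
have mJ : measurable_fun X J by apply: measurable_int_dball => //; exact: mEF.
pose v1 z : R := if (h z < 2 * e ^+ 2)%R then v z else 0%R.
have mv1 : measurable_fun setT v1.
  apply: measurable_fun_ifT => //; apply: measurable_fun_ltr => //.
have v10 z : (0 <= v1 z)%R by rewrite /v1; case: ifP.
pose A z := (v1 z)%:E * J z `^ (p - 1).
have mA : measurable_fun X A.
  apply: emeasurable_funM; first exact: mEF.
  exact: (measurableT_comp (measurable_poweR _)).
have A0 z : 0 <= A z by rewrite mule_ge0 ?lee_fin ?poweR_ge0.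
have holder z : X z ->
    (\int[m]_(w in dball z (2 * e)%R) (g w `^ p^-1 * sg w `^ (1 - p^-1))%:E) `^ p <=
    \int[m]_(w in dball z (2 * e)%R) (EFin \o g1) w * J z `^ (p - 1).
  move=> Xz; apply: le_trans (hoelder_setX m (measurable_dball _ Xz) mg1 ms1 g10 s10 p1).
  rewrite le_eqVlt; apply/orP; left; apply/eqP; congr (_ `^ p).
  apply: eq_integral => w /set_mem[Xw _]; congr (_%:E).
  rewrite !powRM ?powR_ge0// mulrACA -!powRrM -powRD; last first.
    by rewrite (gt_eqF (h_gt0 Xw)) implybT.
  have -> : (gam * (p - 1) * p^-1 + - gam * (1 - p^-1) = 0)%R by field; rewrite gt_eqF.
  by rewrite powRr0 mulr1.
apply: (@le_trans _ _ (\int[m]_(z in X) (A z * \int[m]_(w in dball z (2 * e)%R) (EFin \o g1) w))).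
  apply: (ge0_le_integral m mX).
  - by move=> z _; rewrite mule_ge0 ?lee_fin ?poweR_ge0 ?v10.
  - apply: emeasurable_funM; first exact: (mEF v1).
    apply: (measurableT_comp (measurable_poweR _)).
    apply: measurable_int_dball.
      by apply: mEF; apply: measurable_funM; exact: (measurableT_comp (measurable_powR _)).
    by move=> w; rewrite lee_fin mulr_ge0 ?powR_ge0.
  - apply: emeasurable_funM; first exact: mA.
    by apply: measurable_int_dball; [exact: mEF|exact: eg0].
  - move=> z Xz; rewrite /A -muleA; apply: lee_wpmul2l; first by rewrite lee_fin; exact: v10.
    by rewrite muleC; exact: holder.
rewrite (tonelli_dball _ mA (mEF g1 setT mg1) A0 eg0).
apply: (ge0_le_integral m mX).
- by move=> w _; apply: mule_ge0; [exact: eg0|apply: integral_ge0 => z _; exact: A0].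
- have mAX : measurable_fun setT (A \_ X) by apply/(measurable_restrictT _ mX).
  have A0X z : 0 <= (A \_ X) z by rewrite /patch; case: ifP.
  apply: emeasurable_funM; first exact: mEF.
  have := measurable_int_dball (2 * e)%R mAX A0X; apply: eq_measurable_fun => y _.
  apply: eq_integral => x /set_mem[Xx _].
  by rewrite /patch mem_set.
- apply/measurable_EFinP; apply: measurable_funTS.
  apply: measurable_fun_ifT => //; first exact: measurable_fun_ltr.
  exact: measurable_funM.
move=> w Xw.
(* If [z] has height below 2 e^2 and lies within [2 * e] of [w], then [w] has height below 2 e^2 + 4
   e^2. *)
have [hw|hw] := ltP (h w) (6 * e ^+ 2)%R; last first.
  rewrite integral0_eq ?mule0//.
  move=> z [Xz dz]; rewrite /A /v1 ifF ?mul0e//.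
  apply/negbTE; rewrite -leNgt.
  have dz' : (dl w z ^+ 2 <= (2 * e) ^+ 2)%R.
    by rewrite ler_pXn2r ?nnegrE ?(ltW dz)// mulr_ge0// ltW.
  have h1 := h_dl Xz Xw; rewrite dl_sym// in h1.
  rewrite exprMn -natrX in dz'.
  rewrite -(lerD2r (4 * e ^+ 2)%R) -mulrDl -natrD.
  by rewrite (le_trans hw)// (le_trans h1)// lerD2l.
pose V := \int[m]_(z in dball w (44 * e)%R) (v z)%:E.
pose S := \int[m]_(z in dball w (44 * e)%R) (sg z)%:E.
have V0 : 0 <= V by apply: integral_ge0 => z _; rewrite lee_fin.
have S0 : 0 <= S by apply: integral_ge0 => z _; rewrite lee_fin.
pose c : R := (C * ((4 * e) ^+ 2) `^ (- gam))%R.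
have c0 : (0 < c)%R by rewrite mulr_gt0 ?powR_gt0 ?exprn_gt0 ?mulr_gt0.
(* The ball of radius [2 * e] about [z] lies in the ball of radius [4 * e] about [w]; this makes the
   bound of [J z] independent of [z]. *)
have Jle z : dball w (2 * e)%R z -> J z `^ (p - 1) <= (c%:E * S) `^ (p - 1).
  move=> [Xz dz]; apply: (gt0_ler_poweR (ltW pm1)).
  - by rewrite in_itv/= leey andbT; apply: integral_ge0 => y _; rewrite lee_fin.
  - by rewrite in_itv/= leey andbT mule_ge0// lee_fin ltW.
  have r8 : (0 < 4 * e <= 8)%R by rewrite mulr_gt0//= -(@ler_pM2l _ 4)// -natrM in e2 *; lra.
  have := HJ w (4 * e)%R Xw r8; rewrite mulrA -natrM; apply: le_trans.
  apply: (ge0_subset_integral m (measurable_dball _ Xz) (measurable_dball _ Xw)).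
  - exact: mEF.
  - by move=> y _; rewrite lee_fin.
  - move=> y [Xy dy]; split => //; rewrite (le_lt_trans (dl_tri Xw Xz Xy))//.
    rewrite (_ : 4 * e = 2 * e + 2 * e)%R ?ltrD//; ring.
have H1 : \int[m]_(z in dball w (2 * e)%R) A z <= V * (c%:E * S) `^ (p - 1).
  have cS0 : 0 <= (c%:E * S) `^ (p - 1) by exact: poweR_ge0.
  have mB := measurable_dball (2 * e)%R Xw.
  have mB' := measurable_dball (44 * e)%R Xw.
  have v0e y : 0 <= (EFin \o v) y by rewrite /= lee_fin.
  rewrite -(ge0_integralZr m mB' (mEF v _ mv) (fun y _ => v0e y) cS0).
  apply: (@le_trans _ _ (\int[m]_(z in dball w (2 * e)%R) ((v z)%:E * (c%:E * S) `^ (p - 1)))).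
    apply: (ge0_le_integral m mB).
    - by move=> z _; exact: A0.
    - by apply: measurable_funS mA => // z [].
    - by apply: emeasurable_funM; [exact: mEF|exact: measurable_cst].
    - move=> z Bz; apply: lee_pmul; [by rewrite lee_fin|exact: poweR_ge0| |exact: Jle].
      by rewrite lee_fin /v1; case: ifP.
  apply: (ge0_subset_integral m mB mB').
  - by apply: emeasurable_funM; [exact: mEF|exact: measurable_cst].
  - by move=> z _; rewrite mule_ge0// lee_fin.
  - move=> y [Xy dy]; split => //; rewrite (lt_le_trans dy)// ler_pM2r// ler_nat//.
have H2 : V * (c%:E * S) `^ (p - 1) <= (K * (e ^+ 2) `^ (b * p - gam * (p - 1)))%:E.
  rewrite poweRM ?lee_fin ?(ltW c0)// muleCA.
  have e44 : (0 < 44 * e)%R by rewrite mulr_gt0.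
  have hw44 : (h w < (44 * e) ^+ 2)%R.
    by rewrite (lt_trans hw)// exprMn ltr_pM2r// -natrX ltr_nat.
  apply: (@le_trans _ _ ((c%:E `^ (p - 1)) * (DC * ((44 * e) ^+ 2) `^ (b * p))%:E)).
    by apply: lee_wpmul2l; [exact: poweR_ge0|exact: Dp].
  rewrite poweR_EFin -EFinM lee_fin le_eqVlt; apply/orP; left; apply/eqP.
  rewrite /c; have -> : ((4 * e) ^+ 2 = 16 * e ^+ 2)%R by rewrite exprMn -natrX.
  rewrite (exprMn 2 44%R e) /K; move: (e ^+ 2)%R ee (44 ^+ 2 : R)%R (sqr_ge0 (44 : R)) => E E0 F F0.
  rewrite !powRM ?mulr_ge0 ?powR_ge0 ?(ltW C0) ?(ltW E0) ?exprn_ge0//.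
  rewrite (@powRD _ E (b * p) (- (gam * (p - 1)))); last by rewrite (gt_eqF E0) implybT.
  rewrite -(powRrM E) mulNr.
  by ring.
apply: (@le_trans _ _ ((g1 w)%:E * (K * (e ^+ 2) `^ (b * p - gam * (p - 1)))%:E)).
  by apply: lee_wpmul2l; [rewrite lee_fin|exact: le_trans H1 H2].
by rewrite -EFinM mulrC.
Qed.

(* The radii are [(2 * 2^-k)^2 = 4^(1-k)]: all of them are at most 4, and the
   pseudo-distance is less than 16, so that [k = 0] already covers [X]. *)
Definition dyadic_sum (a : R) (g : T -> R) z : \bar R := \sum_(0 <= k <oo)
    ((if (h z < 2 * (2 * 2^-1 ^+ k) ^+ 2)%R then v z else 0)%:E *
     ((((2 * 2^-1 ^+ k) ^+ 2) `^ (- a))%:E *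
     (\int[m]_(w in dball z (2 * (2 * 2^-1 ^+ k))%R)
       (g w `^ p^-1 * sg w `^ (1 - p^-1))%:E)) `^ p).

Lemma dyadic_sum_ge0 (a : R) (g : T -> R) z : 0 <= dyadic_sum a g z.
Proof.
apply: nneseries_ge0 => k _ _; rewrite mule_ge0 ?poweR_ge0// lee_fin.
by case: ifP.
Qed.

(** At the scale e_k the level bound leaves (e_k^2)^(b p - a p), which is bounded because e_k <= 2,
    times (h / e_k^2)^gam. The latter grows geometrically in k, and only scales where it is below
    6^gam count, so its sum is bounded independently of h. Measurability is part of the conclusion
    because a constant is later pulled out of the integral of this sum. *)
Lemma maximal_bound (a : R) : (0 <= b * p - a * p)%R ->
  exists2 C : R, (0 < C)%R & forall g : T -> R,
  measurable_fun setT g -> (forall x, 0 <= g x)%R ->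
  measurable_fun X (dyadic_sum a g) /\
  \int[m]_(z in X) dyadic_sum a g z <= C%:E * \int[m]_(w in X) (g w)%:E.
Proof.
move=> ab; have [gam [K [gam0 K0 H]]] := level_bound.
have p0 : (0 < p)%R by exact: lt_trans ltr01 p1.
pose e k : R := (2 * 2^-1 ^+ k)%R.
have e_gt0 k : (0 < e k)%R by rewrite mulr_gt0 ?exprn_gt0 ?invr_gt0.
have e2 k : (e k <= 2)%R.
  by rewrite ler_piMr// exprn_ile1 ?invr_ge0// invf_le1 ?ler1n.
have e2_gt0 k : (0 < e k ^+ 2)%R by rewrite exprn_gt0.
have ele k : (0 < e k <= 2)%R by rewrite e_gt0 e2.
pose l : R := (4 `^ gam)%R.
have l1 : (1 < l)%R.
  by rewrite /l /powR pnatr_eq0/= expR_gt1 mulr_gt0// ln_gt0// ltr1n.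
have l1' : (0 < l - 1)%R by rewrite subr_gt0.
(* The bound of [sum_geometric_below] for the ratio [l] and the threshold 6^gam. *)
pose S : R := (l * 6 `^ gam / (l - 1))%R.
have S0 : (0 < S)%R by rewrite divr_gt0// mulr_gt0 ?powR_gt0// (lt_trans ltr01).
pose C : R := (K * 4 `^ (b * p - a * p) * S)%R.
have C0 : (0 < C)%R by apply: mulr_gt0 S0; apply: mulr_gt0 K0 _; exact: powR_gt0.
exists C => // g mg g0.
have mpow (q : R) : measurable_fun setT (fun x => h x `^ q)%R.
  exact: (measurableT_comp (measurable_powR _)).
have mEF (F : T -> R) D : measurable_fun setT F -> measurable_fun D (EFin \o F).
  by move=> mF; apply/measurable_EFinP; exact: measurable_funTS.
pose I k z := \int[m]_(w in dball z (2 * e k)%R)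
       (g w `^ p^-1 * sg w `^ (1 - p^-1))%:E.
have I0 k z : 0 <= I k z.
  by apply: integral_ge0 => w _; rewrite lee_fin mulr_ge0 ?powR_ge0.
pose c k : R := ((e k ^+ 2) `^ (- (a * p)))%R.
have c0 k : (0 <= c k)%R by exact: powR_ge0.
pose v1 k z : R := if (h z < 2 * e k ^+ 2)%R then v z else 0%R.
have v10 k z : (0 <= v1 k z)%R by rewrite /v1; case: ifP.
have mI k : measurable_fun X (fun z => (v1 k z)%:E * (I k z) `^ p).
  apply: emeasurable_funM.
    apply: mEF; apply: measurable_fun_ifT => //; exact: measurable_fun_ltr.
  apply: (measurableT_comp (measurable_poweR _)).
  apply: measurable_int_dball.
    by apply: mEF; apply: measurable_funM; exact: (measurableT_comp (measurable_powR _)).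
  by move=> w; rewrite lee_fin mulr_ge0 ?powR_ge0.
pose u k z := (c k)%:E * ((v1 k z)%:E * (I k z) `^ p).
have u0 k z : 0 <= u k z by rewrite !mule_ge0 ?poweR_ge0 ?lee_fin ?c0 ?v10.
have mu_ k : measurable_fun X (u k) by apply: measurable_funeM; exact: mI.
pose t k w : R := if (h w < 6 * e k ^+ 2)%R then
  (K * 4 `^ (b * p - a * p) * (h w `^ gam * (e k ^+ 2) `^ (- gam)) * g w)%R else 0%R.
have t0 k w : (0 <= t k w)%R.
  by rewrite /t; case: ifP => // _; rewrite !mulr_ge0 ?powR_ge0 ?(ltW K0).
have mt k : measurable_fun setT (t k).
  apply: measurable_fun_ifT => //; first exact: measurable_fun_ltr.
  apply: measurable_funM => //; apply: measurable_funM => //; exact: measurable_funM.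
have Hk k : \int[m]_(z in X) u k z <= \int[m]_(w in X) (t k w)%:E.
  rewrite (ge0_integralZl m mX (mI k)); last 2 first.
  - by move=> z _; rewrite mule_ge0 ?poweR_ge0 ?lee_fin ?v10.
  - by rewrite lee_fin.
  apply: (le_trans (lee_wpmul2l _ (H g (e k) mg g0 (ele k)))); first by rewrite lee_fin.
  have mr : measurable_fun X (fun w => (if (h w < 6 * e k ^+ 2)%R then
     K * (e k ^+ 2) `^ (b * p - gam) * (g w * h w `^ gam) else 0)%:E).
    apply/measurable_EFinP; apply: measurable_funTS.
    apply: measurable_fun_ifT => //; first exact: measurable_fun_ltr.
    by apply: measurable_funM => //; exact: measurable_funM.
  have r0 w : 0 <= (if (h w < 6 * e k ^+ 2)%R then
     K * (e k ^+ 2) `^ (b * p - gam) * (g w * h w `^ gam) else 0)%:E.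
    by rewrite lee_fin; case: ifP => // _; rewrite !mulr_ge0 ?powR_ge0 ?(ltW K0).
  rewrite -(ge0_integralZl m mX mr (fun w _ => r0 w)) ?lee_fin//.
  apply: (ge0_le_integral m mX).
  - by move=> w _; apply: mule_ge0; [rewrite lee_fin|exact: r0].
  - exact: measurable_funeM.
  - exact: mEF.
  - move=> w _; rewrite -EFinM lee_fin /t; case: ifP => hw; last by rewrite mulr0.
    have Ek := e2_gt0 k; have Ek4 : (e k ^+ 2 <= 4)%R.
      have -> : (4 = 2 ^+ 2 :> R)%R by rewrite -natrX.
      by rewrite ler_pXn2r ?nnegrE ?(ltW (e_gt0 k)).
    rewrite /c; move: (e k ^+ 2)%R Ek Ek4 => E E0 E4.
    have -> : (E `^ (- (a * p)) * (K * E `^ (b * p - gam) * (g w * h w `^ gam)) =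
      K * E `^ (b * p - a * p) * (h w `^ gam * E `^ (- gam)) * g w)%R.
      rewrite !powRD; [|by rewrite (gt_eqF E0) implybT..].
      by ring.
    apply: ler_wpM2r => //; apply: ler_wpM2r; first by rewrite mulr_ge0 ?powR_ge0.
    rewrite ler_pM2l//; apply: ge0_ler_powR; rewrite ?nnegrE ?(ltW E0)//.
have SE z : dyadic_sum a g z = \sum_(0 <= k <oo) u k z.
  apply: eq_eseriesr => k _.
  rewrite -/(e k) -/(I k z) -/(v1 k z) poweRM ?lee_fin ?powR_ge0// poweR_EFin.
  by rewrite -powRrM mulNr muleCA.
have -> : dyadic_sum a g = (fun z => \sum_(0 <= k <oo) u k z) by apply/funext.
split; first by apply: ge0_emeasurable_sum => [k z _ _|k _]; [exact: u0|exact: mu_].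
rewrite (integral_nneseries m mX mu_ (fun k z _ => u0 k z)).
apply: (@le_trans _ _ (\sum_(0 <= k <oo) \int[m]_(w in X) (t k w)%:E)).
  by apply: lee_nneseries => k _; [move=> _; apply: integral_ge0 => z _; exact: u0|exact: Hk].
have tE0 k w : X w -> 0 <= (t k w)%:E by rewrite lee_fin.
rewrite -(integral_nneseries m mX (fun k => mEF _ X (mt k)) tE0).
have gE0 w : X w -> 0 <= (EFin \o g) w by rewrite /= lee_fin.
rewrite -(ge0_integralZl m mX (mEF _ X mg) gE0) ?lee_fin ?(ltW C0)//.
apply: (ge0_le_integral m mX).
- by move=> w Xw; apply: nneseries_ge0 => k _ _; exact: tE0.
- by apply: ge0_emeasurable_sum => [k w Xw _|k _]; [exact: tE0|exact: mEF].
- by apply: measurable_funeM; exact: mEF.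
- move=> w Xw; apply: nneseries_le => n; first exact: tE0.
  rewrite sumEFin -EFinM lee_fin.
  (* The square of [e k] is 4 * 4^(-k), whence the division by 4^gam here and the factor [l ^+ k]
     below. *)
  pose c1 : R := (h w `^ gam * (4 `^ gam)^-1)%R.
  have c10 : (0 < c1)%R by rewrite divr_gt0 ?powR_gt0 ?h_gt0.
  have E1 k : (h w `^ gam * (e k ^+ 2) `^ (- gam) = c1 * l ^+ k)%R.
    rewrite /c1 -mulrA; congr (_ * _)%R.
    rewrite /e exprMn powRM ?exprn_ge0 ?invr_ge0// powR_dyadic -powRN -natrX.
    by [].
  have E2 k : (h w < 6 * e k ^+ 2)%R = (c1 * l ^+ k < 6 `^ gam)%R.
    rewrite -E1 powRN ltr_pdivrMr ?powR_gt0// -powRM ?(ltW (e2_gt0 k))//.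
    apply/idP/idP => [hw|].
      by apply: gt0_ltr_powR; rewrite ?nnegrE ?(ltW (h_gt0 Xw)) ?mulr_ge0 ?(ltW (e2_gt0 k)).
    apply: contraTT; rewrite -!leNgt => hw.
    by apply: ge0_ler_powR; rewrite ?nnegrE ?(ltW gam0) ?(ltW (h_gt0 Xw)) ?mulr_ge0 ?(ltW (e2_gt0 k)).
  have := @sum_geometric_below R c1 l (6 `^ gam) n c10 l1 (powR_gt0 _ _) => /(_ (ltr0n _ _)) Hs.
  rewrite /C /= -/S in Hs *.
  apply: (@le_trans _ _ (K * 4 `^ (b * p - a * p) * g w *
     \sum_(0 <= k < n) (if (c1 * l ^+ k < 6 `^ gam)%R then (c1 * l ^+ k)%R else 0%R))%R).
    rewrite mulr_sumr; apply: ler_sum => k _; rewrite /t E2 E1.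
    by case: ifP => _; rewrite ?mulr0// mulrAC.
  rewrite [leRHS]mulrAC ler_wpM2l// !mulr_ge0 ?powR_ge0 ?(ltW K0)//.
Qed.

End strip.

(** * The pseudo-distance *)

Section complex_facts.
Context {R : realType}.
Implicit Types x y : R[i].

Lemma sqr_normcE x : normc x ^+ 2 = complex.Re x ^+ 2 + complex.Im x ^+ 2.
Proof. by case: x => a b; rewrite /normc sqr_sqrtr// addr_ge0 ?sqr_ge0. Qed.

Lemma normc_ge0 x : 0 <= normc x.
Proof. by case: x => a b; exact: sqrtr_ge0. Qed.

Lemma normc_conj x : normc (x^*)%C = normc x.
Proof. by case: x => a b /=; rewrite sqrrN. Qed.

Lemma normc_real (a : R) : normc (a%:C)%C = `|a|.
Proof. by rewrite /normc/= expr0n/= addr0 sqrtr_sqr. Qed.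

Lemma Re_le_normc x : `|complex.Re x| <= normc x.
Proof.
rewrite -(@ler_pXn2r _ 2) ?nnegrE ?normc_ge0// sqr_normcE real_normK ?num_real//.
by rewrite lerDl sqr_ge0.
Qed.

Lemma Im_le_normc x : `|complex.Im x| <= normc x.
Proof.
rewrite -(@ler_pXn2r _ 2) ?nnegrE ?normc_ge0// sqr_normcE real_normK ?num_real//.
by rewrite lerDr sqr_ge0.
Qed.

Lemma normc_le_ReIm x (a : R) : `|complex.Re x| <= a -> `|complex.Im x| <= a -> normc x <= 2 * a.
Proof.
move=> Ra Ia; have a0 : 0 <= a by exact: le_trans Ra.
rewrite -(@ler_pXn2r _ 2) ?nnegrE ?normc_ge0 ?mulr_ge0// sqr_normcE.
rewrite -(real_normK (num_real (complex.Re x))) -(real_normK (num_real (complex.Im x))).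
have H b : 0 <= b -> b <= a -> b ^+ 2 <= a ^+ 2.
  by move=> b0 ba; rewrite ler_pXn2r ?nnegrE.
have := H _ (normr_ge0 _) Ra; have := H _ (normr_ge0 _) Ia.
rewrite exprMn; have := sqr_ge0 a; lra.
Qed.

End complex_facts.

Section hermitian.
Context {R : realType} {N : nat}.
Implicit Types (x y z : 'rV[R[i]]_N) (a b : R[i]).

Lemma cdotDl x y z : cdot (x + y) z = cdot x z + cdot y z.
Proof. by rewrite /cdot -big_split/=; apply: eq_bigr => j _; rewrite mxE mulrDl. Qed.

Lemma cdotZl a x z : cdot (a *: x) z = a * cdot x z.
Proof. by rewrite /cdot mulr_sumr; apply: eq_bigr => j _; rewrite mxE mulrA. Qed.

Lemma cdotC x y : cdot y x = ((cdot x y)^*)%C.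
Proof.
rewrite /cdot rmorph_sum; apply: eq_bigr => j _.
by rewrite rmorphM/= conjcK mulrC.
Qed.

Lemma cdotDr x y z : cdot z (x + y) = cdot z x + cdot z y.
Proof. by rewrite cdotC cdotDl rmorphD/= -!cdotC. Qed.

Lemma cdotZr a x z : cdot z (a *: x) = (a^*)%C * cdot z x.
Proof. by rewrite cdotC cdotZl rmorphM/= -cdotC. Qed.

Lemma cdotNl x z : cdot (- x) z = - cdot x z.
Proof. by rewrite -scaleN1r cdotZl mulN1r. Qed.

Lemma cdotNr x z : cdot z (- x) = - cdot z x.
Proof. by rewrite cdotC cdotNl rmorphN/= -cdotC. Qed.

Lemma Re_cdot_self x : complex.Re (cdot x x) = \sum_(j < N) normc (x 0 j) ^+ 2.
Proof.
rewrite /cdot (raddf_sum (@complex.Re R : R[i] -> R)); apply: eq_bigr => j _.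
by rewrite sqr_normcE; case: (x 0 j) => a b /=; rewrite mulrN opprK -!expr2.
Qed.

Lemma Re_cdot_self_ge0 x : 0 <= complex.Re (cdot x x).
Proof. by rewrite Re_cdot_self; apply: sumr_ge0 => j _; rewrite sqr_ge0. Qed.

Lemma sqr_cnorm x : cnorm x ^+ 2 = complex.Re (cdot x x).
Proof. by rewrite /cnorm sqr_sqrtr// Re_cdot_self_ge0. Qed.

Lemma cnorm_ge0 x : 0 <= cnorm x.
Proof. exact: sqrtr_ge0. Qed.

Lemma cdot_self x : cdot x x = ((cnorm x ^+ 2)%:C)%C.
Proof.
(* [cdot x x] is its own conjugate, so twice its imaginary part is 0. *)
rewrite sqr_cnorm; have := cdotC x x; case: (cdot x x) => a b /= [] bN.
by apply/eqP; rewrite eq_complex/= eqxx/= -(@mulrI_eq0 _ 2)//; [lra|]; apply/lregP; rewrite pnatr_eq0.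
Qed.

Lemma normc_coord_le x j : normc (x 0 j) <= cnorm x.
Proof.
rewrite -(@ler_pXn2r _ 2) ?nnegrE ?normc_ge0 ?cnorm_ge0// sqr_cnorm Re_cdot_self.
by rewrite (bigD1 j)//= lerDl sumr_ge0// => i _; rewrite sqr_ge0.
Qed.

Lemma cnorm_eq0 x : (cnorm x == 0) = (x == 0).
Proof.
apply/eqP/eqP => [x0|->].
  apply/rowP => j; rewrite mxE; apply: eq0_normc; apply/eqP.
  by rewrite eq_le normc_ge0 andbT -x0 normc_coord_le.
rewrite /cnorm /cdot big1 ?sqrtr0// => j _; by rewrite mxE mul0r.
Qed.

Lemma cnorm_gt0 x : x != 0 -> 0 < cnorm x.
Proof. by move=> x0; rewrite lt0r cnorm_eq0 x0 cnorm_ge0. Qed.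

Lemma cnormZ_real (r : R) x : cnorm ((r%:C)%C *: x) = `|r| * cnorm x.
Proof.
apply/eqP; rewrite -(@eqrXn2 _ 2) ?mulr_ge0 ?normr_ge0 ?cnorm_ge0//.
rewrite sqr_cnorm cdotZl cdotZr cdot_self exprMn real_normK ?num_real//=.
by apply/eqP; ring.
Qed.

Lemma sqr_cnormB x y a : cnorm (x - a *: y) ^+ 2 =
  cnorm x ^+ 2 - 2 * complex.Re ((a^*)%C * cdot x y) + normc a ^+ 2 * cnorm y ^+ 2.
Proof.
rewrite sqr_cnorm cdotDl !cdotDr !cdotNl !cdotNr opprK !cdotZl !cdotZr !cdot_self.
rewrite [cdot y x]cdotC sqr_normcE; case: a => a1 a2; case: (cdot x y) => s1 s2 /=.
by ring.
Qed.

Lemma cauchy_schwarz x y : normc (cdot x y) <= cnorm x * cnorm y.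
Proof.
rewrite -(@ler_pXn2r _ 2) ?nnegrE ?normc_ge0 ?mulr_ge0 ?cnorm_ge0// exprMn.
have [/eqP|y0] := eqVneq (cnorm y) 0.
  rewrite cnorm_eq0 => /eqP ->.
  suff -> : cdot x 0 = 0 by rewrite normc0 expr0n/= mulr_ge0// sqr_ge0.
  by rewrite /cdot big1// => j _; rewrite mxE rmorph0 mulr0.
have y2 : 0 < cnorm y ^+ 2 by rewrite exprn_gt0// lt0r y0 cnorm_ge0.
(* The distance from [x] to its orthogonal projection on the line of [y]. *)
have := sqr_ge0 (cnorm (x - ((((cnorm y ^+ 2)^-1)%:C)%C * cdot x y) *: y)).
rewrite sqr_cnormB normcM normc_real ger0_norm ?invr_ge0 ?(ltW y2)//.
rewrite (_ : complex.Re _ = normc (cdot x y) ^+ 2 / cnorm y ^+ 2); last first.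
  rewrite (rmorphM (@conjc R))/= sqr_normcE.
  by case: (cdot x y) => a b /=; ring.
rewrite -ler_pdivrMr//.
rewrite (_ : _ + _ = cnorm x ^+ 2 - normc (cdot x y) ^+ 2 / cnorm y ^+ 2) ?subr_ge0//.
by field; rewrite ?expf_neq0 ?y0.
Qed.

(* Splitting [a] and [c] along the unit vector [b],
   [<a, c> = <a, b> <b, c> + <a - <a, b> b, c - <c, b> b>]. *)
Lemma normc_1Bcdot_triangle x y z : cnorm x = 1 -> cnorm y = 1 -> cnorm z = 1 ->
  normc (1 - cdot x z) <= normc (1 - cdot x y) + normc (1 - cdot y z) +
    2 * (Num.sqrt (normc (1 - cdot x y)) * Num.sqrt (normc (1 - cdot y z))).
Proof.
move=> x1 y1 z1; set u := cdot x y; set v := cdot y z.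
set al := normc (1 - u); set be := normc (1 - v).
have al0 : 0 <= al by exact: normc_ge0. have be0 : 0 <= be by exact: normc_ge0.
(* 1 - |w|^2 = (1 - |w|) (1 + |w|) is at most 2 (1 - |w|), and 1 - |w| is at most |1 - w|. *)
have tangent (w : R[i]) : normc w <= 1 -> 1 - normc w ^+ 2 <= 2 * normc (1 - w).
  move=> w1; have := le_normcD (1 - w) w; rewrite subrK normc1 => H.
  have := normc_ge0 w; have := normc_ge0 (1 - w); nra.
have u1 : normc u <= 1 by rewrite (le_trans (cauchy_schwarz _ _))// x1 y1 mulr1.
have v1 : normc v <= 1 by rewrite (le_trans (cauchy_schwarz _ _))// z1 y1 mulr1.
(* The components of [x] and [z] orthogonal to [y]; <z, y> is the conjugate of [v]. *)
pose p := x - u *: y; pose q := z - (v^*)%C *: y.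
have p2 : cnorm p ^+ 2 = 1 - normc u ^+ 2.
  rewrite sqr_cnormB x1 y1 -/u expr1n mulr1 sqr_normcE; case: (u) => a b /=; ring.
have q2 : cnorm q ^+ 2 = 1 - normc v ^+ 2.
  rewrite sqr_cnormB z1 y1 expr1n mulr1 normc_conj (cdotC y z) -/v conjcK sqr_normcE.
  case: (v) => a b /=; ring.
have pq : cdot p q = cdot x z - u * v.
  rewrite /p /q cdotDl !cdotDr !cdotNl !cdotNr !cdotZl !cdotZr conjcK cdot_self y1.
  by rewrite expr1n -/u -/v rmorph1; ring.
have pqle : normc (cdot p q) <= 2 * (Num.sqrt al * Num.sqrt be).
  apply: (le_trans (cauchy_schwarz _ _)).
  rewrite -(@ler_pXn2r _ 2) ?nnegrE ?mulr_ge0 ?cnorm_ge0 ?sqrtr_ge0//.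
  rewrite exprMn p2 q2 exprMn [in leRHS]exprMn (sqr_sqrtr al0) (sqr_sqrtr be0).
  have -> : 2 ^+ 2 * (al * be) = (2 * al) * (2 * be) by ring.
  apply: ler_pM; rewrite ?subr_ge0 ?exprn_ile1 ?normc_ge0//; exact: tangent.
have -> : 1 - cdot x z = ((1 - u) + u * (1 - v)) + - cdot p q by rewrite pq; ring.
apply: (le_trans (le_normcD _ _)); rewrite normcN.
have := le_normcD (1 - u) (u * (1 - v)); rewrite normcM -/al -/be => H1.
have H2 : normc u * be <= be by rewrite ler_piMl.
lra.
Qed.

Lemma sqr_cnorm_sub x y :
  cnorm (x - y) ^+ 2 = cnorm x ^+ 2 + cnorm y ^+ 2 - 2 * complex.Re (cdot x y).
Proof.
have := sqr_cnormB x y 1; rewrite scale1r normc1 expr1n mul1r conjc1 mul1r => ->.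
by ring.
Qed.

End hermitian.

Section pseudo_distance.
Context {R : realType} {N : nat}.
Implicit Types (x y z w : 'rV[R[i]]_N).

Definition pdomain : set 'rV[R[i]]_N := [set z | unit_ball z /\ z != 0].

Definition height z : R := 1 - cnorm z.

Definition sdist z w : R := Num.sqrt (pdist z w).

Let cdir z : 'rV[R[i]]_N := (((cnorm z)^-1)%:C)%C *: z.

Let cnorm_cdir z : z != 0 -> cnorm (cdir z) = 1.
Proof.
move=> z0; have zp := cnorm_gt0 z0.
by rewrite cnormZ_real ger0_norm ?mulVf ?gt_eqF ?invr_ge0 ?cnorm_ge0.
Qed.

Lemma pdist_ge0 z w : 0 <= pdist z w.
Proof. by rewrite addr_ge0 ?normr_ge0 ?normc_ge0. Qed.

Let pdistE z w : pdist z w =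
  `|cnorm z - cnorm w| + normc (1 - cdot (cdir z) (cdir w)).
Proof.
congr (_ + normc (1 - _)); rewrite cdotZl cdotZr conjc_real.
have -> : ((((cnorm z * cnorm w)%:C)%C)^-1 = ((cnorm z)^-1)%:C * ((cnorm w)^-1)%:C :> R[i])%C.
  by rewrite -rmorphM/= -invfM -[LHS](fmorphV (real_complex R)).
by ring.
Qed.

Lemma pdistC z w : pdist z w = pdist w z.
Proof.
rewrite !pdistE distrC; congr (_ + _).
rewrite -normc_conj (cdotC (cdir w)); congr normc.
case: (cdot _ _) => a b; congr Complex => /=; ring.
Qed.

Lemma sdist_ge0 z w : 0 <= sdist z w.
Proof. exact: sqrtr_ge0. Qed.

Lemma sqr_sdist z w : sdist z w ^+ 2 = pdist z w.
Proof. by rewrite sqr_sqrtr// pdist_ge0. Qed.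

Lemma sdistC z w : sdist z w = sdist w z.
Proof. by rewrite /sdist pdistC. Qed.

(** After squaring, the radial parts obey the usual triangle inequality, and the cross term on the
    right, twice the root of d(x,y) d(y,z), absorbs the cross term of [normc_1Bcdot_triangle]. *)
Lemma sdist_triangle x y z : x != 0 -> y != 0 -> z != 0 ->
  sdist x z <= sdist x y + sdist y z.
Proof.
move=> x0 y0 z0.
rewrite -(@ler_pXn2r _ 2) ?nnegrE ?addr_ge0 ?sdist_ge0// sqrrD !sqr_sdist !pdistE.
have := normc_1Bcdot_triangle (cnorm_cdir x0) (cnorm_cdir y0) (cnorm_cdir z0).
rewrite /sdist !pdistE.
set al := normc (1 - cdot (cdir x) (cdir y)); set be := normc (1 - cdot (cdir y) (cdir z)).
set A := `|cnorm x - cnorm y|; set B := `|cnorm y - cnorm z|.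
have al0 : 0 <= al by exact: normc_ge0. have be0 : 0 <= be by exact: normc_ge0.
have A0 : 0 <= A by exact: normr_ge0. have B0 : 0 <= B by exact: normr_ge0.
have AB : `|cnorm x - cnorm z| <= A + B by exact: ler_distD.
have : Num.sqrt al * Num.sqrt be <= Num.sqrt (A + al) * Num.sqrt (B + be).
  by apply: ler_pM; rewrite ?sqrtr_ge0// ler_sqrt ?lerDr// addr_ge0.
by rewrite !mulr2n; lra.
Qed.

Lemma height_le z w : height w <= height z + pdist z w.
Proof.
rewrite /height /pdist; have := normc_ge0 (1 - cdot z w / ((cnorm z * cnorm w)%:C)%C).
have := ler_norm (cnorm z - cnorm w); lra.
Qed.

Lemma height_gt0 z : pdomain z -> 0 < height z.
Proof. by case=> z1 _; rewrite subr_gt0. Qed.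

Lemma height_le1 z : height z <= 1.
Proof. by rewrite gerBl cnorm_ge0. Qed.

(** Removes the normalization, since <z, w> itself is linear in each coordinate of [z], which the
    slicing below exploits. With u the normalized product, 1 - <z, w> = (1 - |z||w|) + |z||w| (1 -
    u), and 1 - |z||w| is at most the sum of the heights. *)
Lemma normc_1Bcdot_le z w : pdomain z -> pdomain w ->
  normc (1 - cdot z w) <= pdist z w + height z + height w.
Proof.
move=> [z1 z0] [w1 w0]; have zp := cnorm_gt0 z0; have wp := cnorm_gt0 w0.
rewrite /unit_ball/= in z1 w1.
set u := cdot z w / ((cnorm z * cnorm w)%:C)%C.
have zwp : 0 < cnorm z * cnorm w by rewrite mulr_gt0.
have zwE : cdot z w = ((cnorm z * cnorm w)%:C)%C * u.
  by rewrite /u mulrCA divff ?mulr1// fmorph_eq0 gt_eqF.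
have -> : 1 - cdot z w = ((1 - cnorm z * cnorm w)%:C)%C + ((cnorm z * cnorm w)%:C)%C * (1 - u).
  by rewrite zwE rmorphB rmorph1; ring.
apply: (le_trans (le_normcD _ _)); rewrite normcM !normc_real.
rewrite (ger0_norm (ltW zwp)) ger0_norm; last by nra.
rewrite /pdist -/u /height.
have n0 := normc_ge0 (1 - u).
have zw1 : cnorm z * cnorm w <= 1 by rewrite mulr_ile1 ?(ltW zp) ?(ltW wp) ?(ltW z1) ?(ltW w1).
have h1 : 0 <= (1 - cnorm z * cnorm w) * normc (1 - u) by rewrite mulr_ge0// subr_ge0.
have h2 : 0 <= (1 - cnorm z) * (1 - cnorm w) by rewrite mulr_ge0// subr_ge0 ltW.
have := normr_ge0 (cnorm z - cnorm w); lra.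
Qed.

(** As |z|^2 + |w|^2 is at most 2, the left side is at most 2 Re (1 - <z, w>). *)
Lemma sqr_cnorm_sub_le z w : unit_ball z -> unit_ball w ->
  cnorm (z - w) ^+ 2 <= 2 * normc (1 - cdot z w).
Proof.
rewrite /unit_ball/= => z1 w1; rewrite sqr_cnorm_sub.
have := Re_le_normc (1 - cdot z w).
have := ler_norm (complex.Re (1 - cdot z w)).
rewrite raddfB /= => h1 h2.
have := cnorm_ge0 z; have := cnorm_ge0 w; nra.
Qed.

End pseudo_distance.

(** * Volumes of pseudo-balls *)

Section product_sections.
Context {d1 d2} {T1 : measurableType d1} {T2 : measurableType d2} {R : realType}.
Variables (m1 : {sigma_finite_measure set T1 -> \bar R})
  (m2 : {sigma_finite_measure set T2 -> \bar R}).
Local Open Scope ereal_scope.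
Variables (A : set (T1 * T2)) (mA : measurable A) (b : \bar R).
Hypothesis b0 : 0 <= b.

Lemma product_measure1_le (B : set T1) : measurable B ->
  (forall x, xsection A x !=set0 -> B x) ->
  (forall x, B x -> m2 (xsection A x) <= b) -> (m1 \x m2) A <= m1 B * b.
Proof.
move=> mB BA Ab; rewrite /product_measure1 muleC -integral_cst//.
rewrite [leRHS]integral_mkcond; apply: ge0_le_integral => //.
- exact: measurable_fun_xsection.
- by apply/(measurable_restrictT _ mB); exact: measurable_cst.
- move=> x _; rewrite /patch /=; case: ifPn => [/set_mem/Ab//|/negP xB].
  have [->|/set0P/BA Bx] := eqVneq (xsection A x) set0; first by rewrite measure0.
  by case: xB; rewrite inE.
Qed.

Lemma product_measure1_ge (B : set T1) : measurable B ->
  (forall x, B x -> b <= m2 (xsection A x)) -> m1 B * b <= (m1 \x m2) A.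
Proof.
move=> mB Ab; rewrite /product_measure1 muleC -integral_cst//.
rewrite [leLHS]integral_mkcond; apply: ge0_le_integral => //.
- by move=> x _; rewrite /patch/=; case: ifP.
- by apply/(measurable_restrictT _ mB); exact: measurable_cst.
- exact: measurable_fun_xsection.
- by move=> x _; rewrite /patch /=; case: ifPn => [/set_mem/Ab//|_]; exact: measure_ge0.
Qed.

Let product_measure21 : (m1 \x m2) A = (m1 \x^ m2) A.
Proof. by apply: product_measure_unique => // B C mB mC; exact: product_measure2E. Qed.

Lemma product_measure2_le (B : set T2) : measurable B ->
  (forall y, ysection A y !=set0 -> B y) ->
  (forall y, B y -> m1 (ysection A y) <= b) -> (m1 \x m2) A <= m2 B * b.
Proof.
move=> mB BA Ab; rewrite product_measure21 /product_measure2 muleC -integral_cst//.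
rewrite [leRHS]integral_mkcond; apply: ge0_le_integral => //.
- exact: measurable_fun_ysection.
- by apply/(measurable_restrictT _ mB); exact: measurable_cst.
- move=> x _; rewrite /patch /=; case: ifPn => [/set_mem/Ab//|/negP xB].
  have [->|/set0P/BA Bx] := eqVneq (ysection A x) set0; first by rewrite measure0.
  by case: xB; rewrite inE.
Qed.

Lemma product_measure2_ge (B : set T2) : measurable B ->
  (forall y, B y -> b <= m1 (ysection A y)) -> m2 B * b <= (m1 \x m2) A.
Proof.
move=> mB Ab; rewrite product_measure21 /product_measure2 muleC -integral_cst//.
rewrite [leLHS]integral_mkcond; apply: ge0_le_integral => //.
- by move=> x _; rewrite /patch/=; case: ifP.
- by apply/(measurable_restrictT _ mB); exact: measurable_cst.
- exact: measurable_fun_ysection.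
- by move=> x _; rewrite /patch /=; case: ifPn => [/set_mem/Ab//|_]; exact: measure_ge0.
Qed.

End product_sections.

(** * Slicing the product measure on row vectors in one coordinate *)

Section rV_slices.
Context {d} {T : measurableType d} {R : realType}.
Variable m : {sigma_finite_measure set T -> \bar R}.

Definition rV_upd n (z : 'rV[T]_n) (j : 'I_n) (x : T) : 'rV[T]_n :=
  \row_k (if k == j then x else z 0 k).

Lemma rV_updE n (z : 'rV[T]_n) j x k :
  rV_upd z j x 0 k = if k == j then x else z 0 k.
Proof. by rewrite mxE. Qed.

Lemma measurable_rV_upd n (z : 'rV[T]_n) j :
  measurable_fun [set: T] (rV_upd z j).
Proof.
apply: measurable_fun_rV => k; under eq_fun do rewrite rV_updE.
by case: (k == j); [exact: measurable_id|exact: measurable_cst].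
Qed.

Lemma rV_cons_upd n (y x : T) (v : 'rV[T]_n) j :
  rV_cons (y, rV_upd v j x) = rV_upd (rV_cons (y, v)) (lift ord0 j) x.
Proof.
apply/rowP => k; rewrite rV_updE; have [k' ->|->] := unliftP ord0 k.
  by rewrite !rV_cons_lift rV_updE (inj_eq lift_inj).
by rewrite !rV_cons0 (negbTE (neq_lift _ _)).
Qed.

Lemma rV_cons_upd0 n (y x : T) (v : 'rV[T]_n) :
  rV_cons (x, v) = rV_upd (rV_cons (y, v)) ord0 x.
Proof.
apply/rowP => k; rewrite rV_updE; have [k' ->|->] := unliftP ord0 k.
  by rewrite !rV_cons_lift eq_sym (negbTE (neq_lift _ _)).
by rewrite !rV_cons0 eqxx.
Qed.

Local Open Scope ereal_scope.

Let measurable_cons n (P : set 'rV[T]_n.+1) : measurable P ->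
  measurable (@rV_cons _ T n @^-1` P).
Proof.
by move=> mP; rewrite -[X in measurable X]setTI; exact: measurable_rV_cons.
Qed.

Lemma measurable_rV_box n (A : 'I_n -> set T) : (forall k, measurable (A k)) ->
  measurable [set v : 'rV[T]_n | forall k, A k (v 0%R k)].
Proof.
move=> mA; rewrite (_ : [set v | _] = \bigcap_(k in [set: 'I_n])
    ((fun v : 'rV[T]_n => v 0%R k) @^-1` A k)).
  apply: fin_bigcap_measurable => //.
    by move=> k _; rewrite -[X in measurable X]setTI; exact: measurable_rV_coord.
  by apply/seteqP; split => v /= H k => [_|]; exact: H.
Qed.

Lemma prod_rV_box n (A : 'I_n -> set T) (M : R) :
  (forall k, measurable (A k)) -> (forall k, m (A k) = M%:E) ->
  prod_rV m n [set v : 'rV[T]_n | forall k, A k (v 0%R k)] = (M ^+ n)%:E.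
Proof.
elim: n A => [|n IH] A mA AM.
  rewrite /= diracE mem_set ?expr0// => -[]//.
have -> : prod_rV m n.+1 [set v : 'rV[T]_n.+1 | forall k, A k (v 0%R k)] =
    (m \x prod_rV m n) (@rV_cons _ T n @^-1` [set v : 'rV[T]_n.+1 | forall k, A k (v 0%R k)]) by [].
rewrite (_ : @rV_cons _ T n @^-1` _ = A ord0 `*` [set v : 'rV[T]_n | forall k, A (lift ord0 k) (v 0%R k)]).
  have mA' : forall k : 'I_n, measurable (A (lift ord0 k)) by [].
  transitivity (m (A ord0) * prod_rV m n [set v : 'rV[T]_n | forall k, A (lift ord0 k) (v 0%R k)]).
    exact: (product_measure1E m (prod_rV m n) (mA ord0) (measurable_rV_box mA')).
  by rewrite AM (IH (fun k => A (lift ord0 k)))// -EFinM exprS.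
apply/seteqP; split => -[x v] /=.
  by move=> H; split=> [|k]; [have := H ord0; rewrite rV_cons0|
    have := H (lift ord0 k); rewrite rV_cons_lift].
by move=> [H0 H1] k; have [k' ->|->] := unliftP ord0 k;
  rewrite ?rV_cons_lift ?rV_cons0.
Qed.

(** The direction [j] is arbitrary although the measure is built by adding coordinates in front. In
    the induction a first coordinate other than [j] is split off as a factor of measure at most [M];
    once [j] comes first, the others form a box. *)
Lemma prod_rV_slice_le n (j : 'I_n.+1) (P : set 'rV[T]_n.+1)
    (A : 'I_n.+1 -> set T) (M b : R) :
  measurable P -> (forall k, measurable (A k)) -> (forall k, m (A k) = M%:E) ->
  (0 <= b)%R -> (forall z k, P z -> k != j -> A k (z 0%R k)) ->
  (forall z, m [set x | P (rV_upd z j x)] <= b%:E) ->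
  prod_rV m n.+1 P <= (M ^+ n * b)%:E.
Proof.
move=> mP mA AM b0; have M0 : (0 <= M)%R by rewrite -lee_fin -(AM j) measure_ge0.
elim: n j P A mP mA AM => [|n IH] j P A mP mA AM PA Pb.
  rewrite expr0 mul1r; have -> : prod_rV m 1 P = (m \x prod_rV m 0) (@rV_cons _ T 0 @^-1` P) by [].
  have := @product_measure2_le _ _ _ _ _ m (prod_rV m 0) _ (measurable_cons mP) b%:E setT measurableT.
  rewrite /= diracT mul1e; apply => // v _.
  apply: le_trans (Pb (rV_cons (point, v))); rewrite le_eqVlt; apply/orP; left; apply/eqP.
  congr (m _); apply/seteqP; split => x; rewrite /ysection/= ?inE/= (ord1 j) -rV_cons_upd0//.
have -> : prod_rV m n.+2 P = (m \x prod_rV m n.+1) (@rV_cons _ T n.+1 @^-1` P) by [].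
have mP' := measurable_cons mP.
have [j' jj'|jj'] := unliftP ord0 j.
  rewrite exprS -mulrA EFinM -(AM ord0).
  apply: product_measure1_le => //.
  - move=> x [v]; rewrite /xsection/= inE/= => Pv.
    by have := PA _ ord0 Pv; rewrite rV_cons0 jj'; apply; exact: neq_lift.
  - move=> x _; apply: (IH j' _ (fun k => A (lift ord0 k))) => //.
    + exact: measurable_xsection.
    + move=> v k; rewrite /xsection/= inE/= => Pv kj.
      by have := PA _ (lift ord0 k) Pv; rewrite rV_cons_lift jj'; apply; rewrite (inj_eq lift_inj).
    + move=> v; apply: le_trans (Pb (rV_cons (x, v))).
      rewrite le_eqVlt; apply/orP; left; apply/eqP; congr (m _).
      by apply/seteqP; split => y; rewrite /xsection/= inE/= rV_cons_upd -jj'.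
rewrite EFinM -(prod_rV_box (A := fun k => A (lift ord0 k)))//.
apply: product_measure2_le => //.
- by apply: (@measurable_rV_box n.+1 (fun k => A (lift ord0 k))) => k; exact: mA.
- move=> v [x]; rewrite /ysection/= inE/= => Pv k.
  by have := PA _ (lift ord0 k) Pv; rewrite rV_cons_lift; apply; rewrite jj' eq_sym neq_lift.
- move=> v _; apply: le_trans (Pb (rV_cons (point, v))).
  rewrite le_eqVlt; apply/orP; left; apply/eqP; congr (m _).
  by apply/seteqP; split => y; rewrite /ysection/= inE/= jj' -rV_cons_upd0.
Qed.

Lemma prod_rV_slice_ge n (j : 'I_n.+1) (P : set 'rV[T]_n.+1)
    (A : 'I_n.+1 -> set T) (M b : R) :
  measurable P -> (forall k, measurable (A k)) -> (forall k, m (A k) = M%:E) ->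
  (0 <= b)%R ->
  (forall z : 'rV[T]_n.+1, (forall k, k != j -> A k (z 0%R k)) -> b%:E <= m [set x | P (rV_upd z j x)]) ->
  (M ^+ n * b)%:E <= prod_rV m n.+1 P.
Proof.
move=> mP mA AM b0; have M0 : (0 <= M)%R by rewrite -lee_fin -(AM j) measure_ge0.
elim: n j P A mP mA AM => [|n IH] j P A mP mA AM Pb.
  rewrite expr0 mul1r; have -> : prod_rV m 1 P = (m \x prod_rV m 0) (@rV_cons _ T 0 @^-1` P) by [].
  have := @product_measure2_ge _ _ _ _ _ m (prod_rV m 0) _ (measurable_cons mP) b%:E b0 setT measurableT.
  rewrite /= diracT mul1e; apply => // v _.
  apply: (le_trans (Pb (rV_cons (point, v)) _)); first by move=> k; rewrite !ord1.
  rewrite le_eqVlt; apply/orP; left; apply/eqP.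
  congr (m _); apply/seteqP; split => x; rewrite /ysection/= ?inE/= (ord1 j) -rV_cons_upd0//.
have -> : prod_rV m n.+2 P = (m \x prod_rV m n.+1) (@rV_cons _ T n.+1 @^-1` P) by [].
have mP' := measurable_cons mP.
have [j' jj'|jj'] := unliftP ord0 j.
  rewrite exprS -mulrA EFinM -(AM ord0).
  apply: product_measure1_ge => //.
  - by rewrite lee_fin mulr_ge0 ?exprn_ge0.
  - move=> x Ax; apply: (IH j' _ (fun k => A (lift ord0 k))) => //.
    + exact: measurable_xsection.
    + move=> v Av; apply: (le_trans (Pb (rV_cons (x, v)) _)).
        move=> k; have [k' ->|->] := unliftP ord0 k; rewrite ?rV_cons_lift ?rV_cons0//.
        by rewrite jj' (inj_eq lift_inj) => /Av.
      rewrite le_eqVlt; apply/orP; left; apply/eqP; congr (m _).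
      by apply/seteqP; split => y; rewrite /xsection/= inE/= rV_cons_upd -jj'.
rewrite EFinM -(prod_rV_box (A := fun k => A (lift ord0 k)))//.
apply: product_measure2_ge => //.
- by apply: (@measurable_rV_box n.+1 (fun k => A (lift ord0 k))) => k; exact: mA.
- move=> v Av; apply: (le_trans (Pb (rV_cons (point, v)) _)).
    move=> k; have [k' ->|->] := unliftP ord0 k; rewrite ?rV_cons_lift ?rV_cons0//.
    by rewrite jj' eqxx.
  rewrite le_eqVlt; apply/orP; left; apply/eqP; congr (m _).
  by apply/seteqP; split => y; rewrite /ysection/= inE/= jj' -rV_cons_upd0.
Qed.

End rV_slices.

(** * Measurability of the norm and of the pseudo-distance *)

Section measurability.
Context {R : realType} {N : nat}.
Context {d} {T : measurableType d}.
Implicit Types (f g : T -> R[i]) (F G : T -> 'rV[R[i]]_N).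

Lemma measurable_Re f : measurable_fun setT f ->
  measurable_fun setT (fun x => complex.Re (f x)).
Proof. exact: (measurableT_comp measurable_complex_Re). Qed.

Lemma measurable_Im f : measurable_fun setT f ->
  measurable_fun setT (fun x => complex.Im (f x)).
Proof. exact: (measurableT_comp measurable_complex_Im). Qed.

Lemma measurable_sqrt (r : T -> R) : measurable_fun setT r ->
  (forall x, 0 <= r x) -> measurable_fun setT (fun x => Num.sqrt (r x)).
Proof.
move=> mr r0; under eq_fun do rewrite -powR12_sqrt//.
exact: (measurableT_comp (measurable_powR _)).
Qed.

Lemma measurable_inv_ge0 (r : T -> R) : measurable_fun setT r ->
  (forall x, 0 <= r x) -> measurable_fun setT (fun x => (r x)^-1).
Proof.
move=> mr r0; under eq_fun do rewrite -powR_inv1//.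
exact: (measurableT_comp (measurable_powR _)).
Qed.

Lemma measurable_sqrt_ReIm (a b : T -> R) : measurable_fun setT a ->
  measurable_fun setT b -> measurable_fun setT (fun x => normc (Complex (a x) (b x))).
Proof.
move=> ma mb; apply: measurable_sqrt => [|x]; last by rewrite addr_ge0 ?sqr_ge0.
by apply: measurable_funD; exact: measurable_funX.
Qed.

Lemma measurable_normc f : measurable_fun setT f ->
  measurable_fun setT (fun x => normc (f x)).
Proof.
move=> mf; have := measurable_sqrt_ReIm (measurable_Re mf) (measurable_Im mf).
by apply: eq_measurable_fun => x _; case: (f x).
Qed.

Lemma measurable_coord F j : measurable_fun setT F ->
  measurable_fun setT (fun x => F x 0 j).
Proof. exact: (measurableT_comp (measurable_rV_coord j)). Qed.

Lemma measurable_Re_cdot F G : measurable_fun setT F -> measurable_fun setT G ->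
  measurable_fun setT (fun x => complex.Re (cdot (F x) (G x))).
Proof.
move=> mF mG.
rewrite (_ : (fun x => _) = fun x => \sum_(j < N)
   (complex.Re (F x 0 j) * complex.Re (G x 0 j) + complex.Im (F x 0 j) * complex.Im (G x 0 j))).
  apply: measurable_sum => j; apply: measurable_funD; apply: measurable_funM;
    by [apply/measurable_Re/measurable_coord|apply/measurable_Im/measurable_coord].
apply/funext => x; rewrite /cdot (raddf_sum (@complex.Re R : R[i] -> R)); apply: eq_bigr => j _.
by case: (F x 0 j) => a b; case: (G x 0 j) => a' b' /=; ring.
Qed.

Lemma measurable_Im_cdot F G : measurable_fun setT F -> measurable_fun setT G ->
  measurable_fun setT (fun x => complex.Im (cdot (F x) (G x))).
Proof.
move=> mF mG.
rewrite (_ : (fun x => _) = fun x => \sum_(j < N)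
   (complex.Im (F x 0 j) * complex.Re (G x 0 j) - complex.Re (F x 0 j) * complex.Im (G x 0 j))).
  apply: measurable_sum => j; apply: measurable_funB; apply: measurable_funM;
    by [apply/measurable_Re/measurable_coord|apply/measurable_Im/measurable_coord].
apply/funext => x; rewrite /cdot (raddf_sum (@complex.Im R : R[i] -> R)); apply: eq_bigr => j _.
by case: (F x 0 j) => a b; case: (G x 0 j) => a' b' /=; ring.
Qed.

Lemma measurable_cnorm_comp F : measurable_fun setT F ->
  measurable_fun setT (fun x => cnorm (F x)).
Proof.
move=> mF; apply: measurable_sqrt; first exact: measurable_Re_cdot.
by move=> x; exact: Re_cdot_self_ge0.
Qed.

Lemma measurable_pdist_comp F G : measurable_fun setT F -> measurable_fun setT G ->
  measurable_fun setT (fun x => pdist (F x) (G x)).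
Proof.
move=> mF mG; have mcF := measurable_cnorm_comp mF; have mcG := measurable_cnorm_comp mG.
apply: measurable_funD.
  by apply: measurableT_comp => //; exact: measurable_funB.
pose r x := (cnorm (F x) * cnorm (G x))^-1.
have mr : measurable_fun setT r.
  apply: measurable_inv_ge0; first exact: measurable_funM.
  by move=> x; rewrite mulr_ge0 ?cnorm_ge0.
(* Measurability is established for real and imaginary parts; the complex quotient becomes a
   multiplication of both by the real [r x]. *)
rewrite (_ : (fun x => _) = fun x => normc (Complex
    (1 - complex.Re (cdot (F x) (G x)) * r x) (- (complex.Im (cdot (F x) (G x)) * r x)))).
  apply: measurable_sqrt_ReIm.
    apply: measurable_funB => //; apply: measurable_funM => //; exact: measurable_Re_cdot.
  rewrite (_ : (fun x => _) = fun x => 0 - complex.Im (cdot (F x) (G x)) * r x).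
    by apply: measurable_funB => //; apply: measurable_funM => //; exact: measurable_Im_cdot.
  by apply/funext => x; rewrite sub0r.
apply/funext => x; congr normc.
rewrite -[(_%:C)%C^-1](fmorphV (real_complex R)) -/(r x).
by case: (cdot _ _) => a b; congr Complex => /=; ring.
Qed.

End measurability.

Section ball_measurability.
Context {R : realType} {N : nat}.

Lemma measurable_cnorm : measurable_fun [set: 'rV[R[i]]_N] (@cnorm R N).
Proof. by apply: measurable_cnorm_comp; exact: measurable_id. Qed.

Lemma measurable_height : measurable_fun [set: 'rV[R[i]]_N] (@height R N).
Proof. by apply: measurable_funB => //; exact: measurable_cnorm. Qed.

Lemma measurable_sdist : measurable_fun setT
  (fun u : 'rV[R[i]]_N * 'rV[R[i]]_N => sdist u.1 u.2).
Proof.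
apply: measurable_sqrt => [|u]; last exact: pdist_ge0.
by apply: measurable_pdist_comp.
Qed.

Lemma measurable_unit_ball : measurable (@unit_ball R N).
Proof.
rewrite (_ : unit_ball = @cnorm R N @^-1` `]-oo, 1[).
  by rewrite -[X in measurable X]setTI; apply: measurable_cnorm => //; exact: measurable_itv.
by apply/seteqP; split => z /=; rewrite in_itv.
Qed.

Lemma measurable_pdomain : measurable (@pdomain R N).
Proof.
rewrite (_ : pdomain = @unit_ball R N `&` (@cnorm R N @^-1` `]0, +oo[)).
  apply: measurableI; first exact: measurable_unit_ball.
  by rewrite -[X in measurable X]setTI; apply: measurable_cnorm => //; exact: measurable_itv.
apply/seteqP; split => z /=; rewrite in_itv/= andbT => -[z1 z0]; split => //.
  exact: cnorm_gt0.
by apply: contraTneq z0 => /eqP; rewrite -cnorm_eq0 => /eqP ->; rewrite ltxx.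
Qed.

Lemma pball_dball zeta (r : R) : pdomain zeta -> 0 < r ->
  pball zeta r = dball pdomain (@sdist R N) zeta (Num.sqrt r).
Proof.
move=> zX r0; apply/seteqP; split => z /=; rewrite /pball /dball/= /sdist ltr_sqrt// pdistC.
  by case.
by case=> -[].
Qed.

End ball_measurability.

(** * Areas of plane slices *)

Section complex_slices.
Context {R : realType}.
Local Notation leb := (@lebesgue_measure R).

Definition csquare (c : R[i]) (a : R) : set R[i] :=
  [set x | `|complex.Re x - complex.Re c| <= a /\ `|complex.Im x - complex.Im c| <= a].

Let csquareE c a : complex_of_pair @^-1` csquare c a =
  `[complex.Re c - a, complex.Re c + a] `*` `[complex.Im c - a, complex.Im c + a].
Proof. by apply/seteqP; split => -[x y]; rewrite /csquare /= !in_itv/= !ler_distl. Qed.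

Lemma measurable_csquare c a : measurable (csquare c a).
Proof.
have : measurable (@pair_of_complex R @^-1` (complex_of_pair @^-1` csquare c a)).
  rewrite -[X in measurable X]setTI; apply: measurable_pair_of_complex => //.
  by rewrite csquareE; apply: measurableX; exact: measurable_itv.
by congr measurable; apply/seteqP; split => -[x y].
Qed.

Lemma itv_measure (c a : R) : 0 <= a -> leb `[c - a, c + a] = (2 * a)%:E.
Proof.
move=> a0; rewrite lebesgue_measure_itv/= lte_fin.
have [lt|] := ltP; first by rewrite -EFinB; congr (_%:E); ring.
move=> ge; have -> : a = 0 by apply/eqP; rewrite eq_le a0 andbT; lra.
by rewrite mulr0.
Qed.

Lemma lebesgueC_csquare c a : 0 <= a -> lebesgueC (csquare c a) = (4 * a ^+ 2)%:E.
Proof.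
move=> a0; transitivity ((leb \x leb)%E (complex_of_pair @^-1` csquare c a)) => //.
rewrite csquareE.
transitivity (leb `[(complex.Re c - a)%R, (complex.Re c + a)%R] *
    leb `[(complex.Im c - a)%R, (complex.Im c + a)%R])%E.
  by apply: product_measure1E; exact: measurable_itv.
by rewrite !itv_measure// -EFinM; congr (_%:E); ring.
Qed.

(** Both numbers lie on the same side of 0, at distance at least [kap], so the factor |x + y| of
    |x^2 - y^2| is at least 2 kap. *)
Lemma sqr_diff_le (s kap rho x y : R) : 0 < kap -> `|s| = 1 -> kap <= s * x -> kap <= s * y ->
  `|x ^+ 2 - y ^+ 2| <= 2 * rho -> `|x - y| <= rho / kap.
Proof.
move=> k0 s1 sx sy; rewrite subr_sqr normrM => H; rewrite ler_pdivlMr//.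
have : 2 * kap <= `|x + y|.
  have <- : `|s * (x + y)| = `|x + y| by rewrite normrM s1 mul1r.
  by apply: le_trans (ler_norm _); rewrite mulrDr; lra.
have := normr_ge0 (x - y); nra.
Qed.

(** On a line parallel to the axis chosen by [b] the other part is constant, so |x|^2 varies like
    the square of the chosen part and [sqr_diff_le] confines the latter; across these lines the
    width is at most [2 * a]. *)
Lemma lebesgueC_slice_le (S : set R[i]) (b : bool) (s kap rho a : R) :
  measurable S -> 0 < kap -> `|s| = 1 -> 0 <= rho -> 0 <= a ->
  (forall x, S x -> kap <= s * (if b then complex.Re x else complex.Im x)) ->
  (forall x y, S x -> S y ->
    [/\ `|complex.Re x - complex.Re y| <= a, `|complex.Im x - complex.Im y| <= a &
        `|normc x ^+ 2 - normc y ^+ 2| <= 2 * rho]) ->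
  (lebesgueC S <= (2 * a * (2 * (rho / kap)))%:E)%E.
Proof.
move=> mS k0 s1 r0 a0 Sk Sd.
have rk0 : 0 <= rho / kap by rewrite divr_ge0// ltW.
have [->|/set0P[u Su]] := eqVneq S set0.
  by rewrite measure0 lee_fin !mulr_ge0 ?invr_ge0 ?(ltW k0).
have -> : lebesgueC S = (leb \x leb)%E (complex_of_pair @^-1` S) by [].
have mS' : measurable (@complex_of_pair R @^-1` S).
  by rewrite -[X in measurable X]setTI; apply: measurable_complex_of_pair.
case: b Sk => Sk; rewrite EFinM.
  rewrite -(itv_measure (complex.Im u) a0).
  apply: product_measure2_le => //.
    move=> y [x]; rewrite /ysection/= inE/= => Sxy.
    by have [_ + _] := Sd _ _ Sxy Su; rewrite /= in_itv/= ler_distl.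
  move=> y _.
  have [->|/set0P[x1]] := eqVneq (ysection (@complex_of_pair R @^-1` S) y) set0.
    by rewrite measure0 lee_fin mulr_ge0.
  rewrite /ysection/= inE/= => Sx1.
  rewrite -(itv_measure x1 rk0); apply: le_measure; rewrite ?inE.
  - exact: measurable_ysection.
  - exact: measurable_itv.
  - move=> x; rewrite /ysection/= inE/= => Sx; rewrite in_itv/= -ler_distl.
    apply: (sqr_diff_le k0 s1 (Sk _ Sx) (Sk _ Sx1)) => /=.
    have [_ _] := Sd _ _ Sx Sx1; rewrite !sqr_normcE/=.
    by rewrite opprD addrACA subrr addr0.
rewrite -(itv_measure (complex.Re u) a0).
apply: product_measure1_le => //.
  move=> x [y]; rewrite /xsection/= inE/= => Sxy.
  by have [+ _ _] := Sd _ _ Sxy Su; rewrite /= in_itv/= ler_distl.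
move=> x _.
have [->|/set0P[y1]] := eqVneq (xsection (@complex_of_pair R @^-1` S) x) set0.
  by rewrite measure0 lee_fin mulr_ge0.
rewrite /xsection/= inE/= => Sy1.
rewrite -(itv_measure y1 rk0); apply: le_measure; rewrite ?inE.
- exact: measurable_xsection.
- exact: measurable_itv.
- move=> y; rewrite /xsection/= inE/= => Sy; rewrite in_itv/= -ler_distl.
  apply: (sqr_diff_le k0 s1 (Sk _ Sy) (Sk _ Sy1)) => /=.
  have [_ _] := Sd _ _ Sy Sy1; rewrite !sqr_normcE/=.
  by rewrite opprD addrACA subrr add0r.
Qed.

End complex_slices.

Lemma le_measure_sub d (T : measurableType d) (R : realType)
    (m : {measure set T -> \bar R}) (A B : set T) :
  measurable A -> measurable B -> A `<=` B -> (m A <= m B)%E.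
Proof. by move=> mA mB AB; apply: le_measure; rewrite ?inE. Qed.

(** * Lebesgue volume of pseudo-balls, strips and annuli *)

Section volume.
Context {R : realType} {n : nat}.
Local Notation V := 'rV[R[i]]_n.+1.
Local Notation nu := (prod_rV (@lebesgueC R) n.+1).
Implicit Types (z w : V) (x : R[i]) (j k : 'I_n.+1).

Lemma measurable_pball (zeta : V) (r : R) : measurable (pball zeta r).
Proof.
rewrite (_ : pball zeta r = pdomain `&` ((fun z => pdist z zeta) @^-1` `]-oo, r[)).
  apply: measurableI; first exact: measurable_pdomain.
  have mp : measurable_fun setT (fun z : V => pdist z zeta).
    by apply: measurable_pdist_comp => //; exact: measurable_cst.
  by rewrite -[X in measurable X]setTI; apply: mp => //; exact: measurable_itv.
by apply/seteqP; split => z /=; rewrite /pball in_itv/=; [case|case => -[]].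
Qed.

Lemma measurable_height_lt (rho : R) : measurable [set z : V | height z < rho].
Proof.
rewrite (_ : [set z | _] = @height R n.+1 @^-1` `]-oo, rho[).
  by rewrite -[X in measurable X]setTI; apply: measurable_height => //; exact: measurable_itv.
by apply/seteqP; split => u /=; rewrite in_itv.
Qed.

(** By the triangle inequality through the centre, the root of the pseudo-distance is below twice
    the root of [r]: the pseudo-distance contributes 4 r, and each of the two heights 2 r. *)
Lemma pball_pair (zeta : V) r z w : pdomain zeta -> 0 < r -> height zeta < r ->
  pball zeta r z -> pball zeta r w -> normc (1 - cdot z w) <= 8 * r.
Proof.
move=> [zeta1 zeta0] r0 hr [z1 z0 dz] [w1 w0 dw].
have hz := height_le zeta z; have hw := height_le zeta w.
rewrite (pdistC zeta z) in hz; rewrite (pdistC zeta w) in hw.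
have zw : pdist z w <= 4 * r.
  have h1 : sdist z w ^+ 2 <= (sdist z zeta + sdist zeta w) ^+ 2.
    by rewrite ler_pXn2r ?nnegrE ?addr_ge0 ?sdist_ge0// sdist_triangle.
  have h2 : sdist z zeta ^+ 2 < r by rewrite sqr_sdist.
  have h3 : sdist zeta w ^+ 2 < r by rewrite sqr_sdist pdistC.
  rewrite -sqr_sdist; have := sqr_ge0 (sdist z zeta - sdist zeta w); lra.
have := @normc_1Bcdot_le R n.+1 z w (conj z1 z0) (conj w1 w0).
lra.
Qed.

Lemma pball_coord (zeta : V) r z w k : pdomain zeta -> 0 < r -> height zeta < r ->
  pball zeta r z -> pball zeta r w -> normc (z 0 k - w 0 k) <= 4 * Num.sqrt r.
Proof.
move=> zX r0 hr Bz Bw; have := pball_pair zX r0 hr Bz Bw.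
case: Bz => z1 _ _; case: Bw => w1 _ _ H.
have H1 := sqr_cnorm_sub_le z1 w1.
have := normc_coord_le (z - w) k; rewrite !mxE => /le_trans; apply.
rewrite -(@ler_pXn2r _ 2) ?nnegrE ?cnorm_ge0 ?mulr_ge0 ?sqrtr_ge0//.
apply: (le_trans H1); rewrite exprMn sqr_sqrtr ?(ltW r0)//; lra.
Qed.

Lemma cdot_upd_diff z j x y w : cdot (rV_upd z j x) w - cdot (rV_upd z j y) w =
  (x - y) * ((w 0 j)^*)%C.
Proof.
rewrite /cdot -sumrB (bigD1 j)//= big1 ?addr0 => [|k /negbTE kj].
  by rewrite !rV_updE eqxx mulrBl.
by rewrite !rV_updE kj subrr.
Qed.

Lemma sqr_cnorm_upd_diff z j x y : cnorm (rV_upd z j x) ^+ 2 - cnorm (rV_upd z j y) ^+ 2 =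
  normc x ^+ 2 - normc y ^+ 2.
Proof.
rewrite !sqr_cnorm !Re_cdot_self -sumrB (bigD1 j)//= big1 ?addr0 => [|k /negbTE kj].
  by rewrite !rV_updE eqxx.
by rewrite !rV_updE kj subrr.
Qed.

Definition half_coord (j : 'I_n.+1) (b : bool) (s kap : R) : set V :=
  [set z | kap <= s * (if b then complex.Re (z 0 j) else complex.Im (z 0 j))].

Lemma measurable_half_coord j b s kap : measurable (half_coord j b s kap).
Proof.
have mf : measurable_fun [set: V]
    (fun z => s * (if b then complex.Re (z 0 j) else complex.Im (z 0 j))).
  apply: measurable_funM; first exact: measurable_cst.
  case: b; [apply: measurable_Re|apply: measurable_Im]; exact: measurable_rV_coord.
rewrite (_ : half_coord _ _ _ _ = (fun z : V =>
   s * (if b then complex.Re (z 0 j) else complex.Im (z 0 j))) @^-1` `[kap, +oo[).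
  by rewrite -[X in measurable X]setTI; apply: mf => //; exact: measurable_itv.
by apply/seteqP; split => z /=; rewrite in_itv/= andbT.
Qed.

(* On [half_coord] a real or imaginary part of [z 0 j] stays away from 0, so with
   the other coordinates fixed the heights below [rho] confine it to an
   interval of length about [rho / kap]. *)
Lemma vol_half_strip_le (zeta : V) (r rho : R) j b s kap :
  pdomain zeta -> 0 < r -> 0 < rho -> height zeta < r -> 0 < kap -> `|s| = 1 ->
  (nu (pball zeta r `&` [set z | (height z < rho)%R] `&` half_coord j b s kap) <=
   ((64 * r) ^+ n * (64 * r * rho / kap ^+ 2))%:E)%E.
Proof.
move=> zX r0 rho0 hr k0 s1.
set P := _ `&` half_coord j b s kap.
have mP : measurable P.
  apply: measurableI; last exact: measurable_half_coord.
  by apply: measurableI; [exact: measurable_pball|exact: measurable_height_lt].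
have k2 : 0 < kap ^+ 2 by rewrite exprn_gt0.
have b0 : 0 <= 64 * r * rho / kap ^+ 2.
  by rewrite divr_ge0 ?mulr_ge0 ?(ltW r0) ?(ltW rho0) ?(ltW k0).
(* A point of [P] is needed as the centre of the box. *)
have [->|/set0P[z0 [[Bz0 _] _]]] := eqVneq P set0.
  by rewrite measure0 lee_fin mulr_ge0 ?b0 ?exprn_ge0 // mulr_ge0 ?(ltW r0).
pose a : R := 4 * Num.sqrt r.
have a0 : 0 <= a by rewrite mulr_ge0 ?sqrtr_ge0.
apply: (@prod_rV_slice_le _ _ _ _ n j P (fun k => csquare (z0 0 k) a)) => //.
- by move=> k; exact: measurable_csquare.
- move=> k; rewrite lebesgueC_csquare// /a exprMn sqr_sqrtr ?(ltW r0)//; congr (_%:E).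
  by ring.
- move=> z k [[Bz _] _] _; have H := pball_coord k zX r0 hr Bz Bz0.
  split; [have := Re_le_normc (z 0 k - z0 0 k)|have := Im_le_normc (z 0 k - z0 0 k)];
    by rewrite raddfB => /le_trans; apply.
- move=> z; have -> : 64 * r * rho / kap ^+ 2 = 2 * (16 * r / kap) * (2 * (rho / kap)).
    by field; rewrite gt_eqF.
  have mS : measurable [set x | P (rV_upd z j x)].
    by rewrite -[X in measurable X]setTI; apply: measurable_rV_upd.
  apply: (@lebesgueC_slice_le _ _ b s kap rho (16 * r / kap)) => //.
  + exact: ltW.
  + by rewrite divr_ge0 ?mulr_ge0 ?(ltW r0) ?(ltW k0).
  + by move=> x [_]; rewrite /half_coord/= rV_updE eqxx.
  + move=> x y Px Py.
    have [[Bx /= hx] kx] := Px; have [[By /= hy] ky] := Py.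
    have H1 := pball_pair zX r0 hr Bx By; have H2 := pball_pair zX r0 hr By By.
    (* Replacing [y] by [x] in the [j]-th coordinate changes the inner product with [rV_upd z j y]
       by (x - y) times the conjugate of [y]. Both values are within 8 r of 1, and |y| is at least
       [kap]. So this coordinate moves by O(r), not just by the root of [r]. *)
    have H3 : normc (x - y) * kap <= 16 * r.
      have : normc ((x - y) * (y^*)%C) <= 16 * r.
        have := cdot_upd_diff z j x y (rV_upd z j y); rewrite rV_updE eqxx => <-.
        rewrite (_ : _ - _ = (1 - cdot (rV_upd z j y) (rV_upd z j y)) -
          (1 - cdot (rV_upd z j x) (rV_upd z j y))); last by ring.
        by apply: (le_trans (le_normcD _ _)); rewrite normcN; lra.
      rewrite normcM normc_conj; apply: le_trans.
      apply: ler_wpM2l; first exact: normc_ge0.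
      move: ky; rewrite /half_coord/= rV_updE eqxx => /le_trans; apply.
      apply: (le_trans (ler_norm _)); rewrite normrM s1 mul1r.
      by case: (b); [exact: Re_le_normc|exact: Im_le_normc].
    have H4 : normc (x - y) <= 16 * r / kap by rewrite ler_pdivlMr.
    split.
    * by have := Re_le_normc (x - y); rewrite raddfB => /le_trans; apply.
    * by have := Im_le_normc (x - y); rewrite raddfB => /le_trans; apply.
    (* Only the [j]-th coordinate differs, so this is the difference of the squared norms, and both
       norms lie between 1 - rho and 1. *)
    * rewrite -(sqr_cnorm_upd_diff z j).
      have := cnorm_ge0 (rV_upd z j x); have := cnorm_ge0 (rV_upd z j y).
      case: Bx => + _ _; case: By => + _ _.
      move: hx hy; rewrite /height /unit_ball/=.
      move: (cnorm (rV_upd z j x)) (cnorm (rV_upd z j y)) => A B hA hB B1 A1 B0 A0.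
      by rewrite ler_norml; apply/andP; split; nra.
Qed.

Lemma unit_ball_csquare z k : unit_ball z -> csquare 0 1 (z 0 k).
Proof.
rewrite /unit_ball/= => z1; have H := normc_coord_le z k.
split; [have := Re_le_normc (z 0 k)|have := Im_le_normc (z 0 k)];
  by rewrite /= subr0 => /le_trans; apply; rewrite (le_trans H)// ltW.
Qed.

Lemma vol_unit_ball_le : (nu (@unit_ball R n.+1) <= (4 ^+ n.+1)%:E)%E.
Proof.
rewrite -(@prod_rV_box _ _ _ (@lebesgueC R) n.+1 (fun=> csquare 0 1)).
- apply: le_measure; rewrite ?inE.
  + exact: measurable_unit_ball.
  + by apply: (@measurable_rV_box _ _ n.+1 (fun=> csquare 0 1)) => k; exact: measurable_csquare.
  + by move=> z z1 k; exact: unit_ball_csquare.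
- by move=> _; exact: measurable_csquare.
- by move=> _; rewrite lebesgueC_csquare// expr1n mulr1.
Qed.

(** Otherwise, with N = n + 1, |z|^2 would be at most 2 N / (4 N)^2 = 1 / (8 N), which is below
    1/4. *)
Lemma large_coord z : 2^-1 <= cnorm z -> exists j b s, `|s| = 1 :> R /\
  half_coord j b s (4 * n.+1%:R)^-1 z.
Proof.
move=> hz; apply/not_existsP => H.
pose kap : R := (4 * n.+1%:R)^-1.
have N0 : (0 : R) < n.+1%:R by rewrite ltr0n.
have k0 : 0 < kap by rewrite invr_gt0 mulr_gt0.
have small j b : `|if b then complex.Re (z 0 j) else complex.Im (z 0 j)| < kap.
  rewrite ltNge; apply/negP => kle; apply: (H j); exists b.
  set t := (if b then _ else _) in kle.
  have [t0|t0] := lerP 0 t.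
    by exists 1; rewrite normr1; split => //; rewrite /half_coord/= mul1r -/t -(ger0_norm t0).
  exists (-1); rewrite normrN1; split => //.
  by rewrite /half_coord/= mulN1r -/t -(ltr0_norm t0).
have : cnorm z ^+ 2 <= \sum_(j < n.+1) 2 * kap ^+ 2.
  rewrite sqr_cnorm Re_cdot_self; apply: ler_sum => j _.
  have sq (t : R) : `|t| < kap -> t ^+ 2 <= kap ^+ 2.
    by move=> tk; rewrite -(real_normK (num_real t)) ler_pXn2r ?nnegrE ?(ltW k0)// ltW.
  by rewrite sqr_normcE mulr_natl mulr2n; apply: lerD; apply: sq;
    [exact: (small j true)|exact: (small j false)].
move=> H0; have H1 : cnorm z ^+ 2 <= n.+1%:R * (2 * kap ^+ 2).
  by apply: (le_trans H0); rewrite sumr_const card_ord -[leLHS]mulr_natl.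
have H2 : 2^-1 ^+ 2 <= cnorm z ^+ 2 by rewrite ler_pXn2r ?nnegrE ?cnorm_ge0 ?invr_ge0.
have H3 : n.+1%:R * (2 * kap ^+ 2) = (8 * n.+1%:R)^-1 by rewrite /kap; field; rewrite gt_eqF.
have H4 : ((8 : R) * n.+1%:R)^-1 <= 8^-1.
  by rewrite lef_pV2 ?posrE ?mulr_gt0// ler_peMr// ler1n.
have H5 : (2^-1 : R) ^+ 2 = 4^-1 by rewrite exprVn -natrX.
rewrite H3 in H1; rewrite H5 in H2.
have := le_trans H2 (le_trans H1 H4); rewrite lef_pV2 ?posrE// ler_nat.
by [].
Qed.

Lemma measure_finite_union (I : finType) (A : set V) (B : I -> set V) :
  measurable A -> (forall i, measurable (B i)) ->
  (forall z, A z -> exists i, B i z) -> (nu A <= \sum_(i : I) nu (B i))%E.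
Proof.
move=> mA mB AB.
have mU (s : seq I) : measurable (\big[setU/set0]_(i <- s) B i).
  by apply: bigsetU_measurable => i _; exact: mB.
apply: (@le_trans _ _ (nu (\big[setU/set0]_(i : I) B i))).
  apply: le_measure; rewrite ?inE; [exact: mA|by apply: bigsetU_measurable => i _; exact: mB|].
  move=> z /AB[i Bz]; rewrite -bigcup_seq; exists i => //=; exact: mem_index_enum.
elim: (index_enum I) => [|i s IH]; first by rewrite !big_nil measure0.
rewrite !big_cons; apply: (le_trans (measureU2 _ (mB i) (mU s))).
exact: leeD2l.
Qed.

(** Where |z| >= 1/2, finitely many sets [half_coord] cover. A point of the remaining core has
    height above 1/2, which bounds [r] and [rho] from below, so the volume of the whole unit ball is
    a good enough bound there. *)
Lemma vol_strip_le : exists2 C : R, 0 < C & forall (zeta : V) (r rho : R),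
  pdomain zeta -> 0 < r -> 0 < rho -> height zeta < r ->
  (nu (pball zeta r `&` [set z | (height z < rho)%R]) <= (C * (r ^+ n.+1 * rho))%:E)%E.
Proof.
pose kap : R := (4 * n.+1%:R)^-1.
have k0 : 0 < kap by rewrite invr_gt0 mulr_gt0.
pose C1 : R := 64 ^+ n.+1 / kap ^+ 2.
have C10 : 0 < C1 by rewrite divr_gt0 ?exprn_gt0.
(* A cube around the unit ball has volume 4^(n+1); the other factors compensate for r >= 1/4 and rho
   >= 1/2 on the core. *)
pose C2 : R := 4 ^+ n.+1 * 4 ^+ n.+1 * 2.
have C20 : 0 < C2 by rewrite !mulr_gt0 ?exprn_gt0.
(* [None] stands for the core; otherwise a coordinate, the choice of real or imaginary part, and a
   sign. *)
pose I : finType := option ('I_n.+1 * bool * bool).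
exists (\sum_(i : I) (C1 + C2)).
  rewrite (bigD1 None)//= ltr_wpDr// ?sumr_ge0// ?addr_gt0// => *.
  by rewrite addr_ge0 ?(ltW C10) ?(ltW C20).
move=> zeta r rho zX r0 rho0 hr.
have rr0 : 0 <= r ^+ n.+1 * rho by rewrite mulr_ge0 ?exprn_ge0 ?(ltW r0) ?(ltW rho0).
pose D := pball zeta r `&` [set z | (height z < rho)%R].
have mD : measurable D by apply: measurableI; [exact: measurable_pball|exact: measurable_height_lt].
pose B (i : I) : set V := if i is Some (j, b, s) then
  D `&` half_coord j b (if s then 1 else -1) kap else D `&` [set z | cnorm z < 2^-1].
have mN : measurable [set z : V | cnorm z < 2^-1].
  rewrite (_ : [set z | _] = @cnorm R n.+1 @^-1` `]-oo, 2^-1[).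
    by rewrite -[X in measurable X]setTI; apply: measurable_cnorm => //; exact: measurable_itv.
  by apply/seteqP; split => u /=; rewrite in_itv.
apply: (le_trans (@measure_finite_union I D B mD _ _)).
- by case=> [[[j b] s]|]; apply: measurableI => //; exact: measurable_half_coord.
- move=> z Dz; have [zs|zb] := ltP (cnorm z) 2^-1; first by exists None.
  have [j [b [s [s1 H]]]] := large_coord zb.
  have [s0|s0] := leP 0 s.
    by exists (Some (j, b, true)); split => //; rewrite -s1 ger0_norm.
  exists (Some (j, b, false)); split => //.
  by rewrite -s1 ltr0_norm// opprK.
rewrite mulr_suml -sumEFin; apply: lee_sum => -[[[j b] s]|] _.
  apply: (le_trans (vol_half_strip_le j b zX r0 rho0 hr k0 _)); first by case: s; rewrite ?normrN1 ?normr1.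
  rewrite lee_fin [leLHS](_ : _ = C1 * (r ^+ n.+1 * rho)); last first.
    by rewrite /C1 exprMn !exprS; field; rewrite gt_eqF.
  by rewrite ler_wpM2r// lerDl ltW.
have [->|/set0P[z [[[z1 z0 dz] /= hz] zs]]] := eqVneq (B None) set0.
  by rewrite measure0 lee_fin mulr_ge0// addr_ge0 ?(ltW C10) ?(ltW C20).
apply: (@le_trans _ _ (nu (@unit_ball R n.+1))).
  apply: (le_measure_sub nu (measurableI _ _ mD mN) measurable_unit_ball).
  by move=> w [[[]]].
apply: (le_trans vol_unit_ball_le); rewrite lee_fin.
have hz' := height_le zeta z; rewrite pdistC in hz'.
have r4 : 4^-1 <= r by move: hz' zs dz hr; rewrite /height; lra.
have rho2 : 2^-1 <= rho by move: zs hz; rewrite /height; lra.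
apply: (@le_trans _ _ (C2 * (r ^+ n.+1 * rho))); last by rewrite ler_wpM2r// lerDr ltW.
have -> : C2 * (r ^+ n.+1 * rho) = 4 ^+ n.+1 * ((4 * r) ^+ n.+1 * (2 * rho)).
  by rewrite /C2 exprMn; ring.
rewrite ler_peMr ?exprn_ge0// -[1]mulr1; apply: ler_pM => //; last lra.
by rewrite exprn_ege1//; lra.
Qed.

Let N : R := n.+1%:R.
(** The tolerance for the coordinates: one factor N is lost in summing the errors of N coordinates,
    another in dividing by a coordinate of modulus at least 1/N, and eps N^2 = 1/8 absorbs both. *)
Let eps : R := (8 * N ^+ 2)^-1.

Let N_ge1 : 1 <= N. Proof. by rewrite /N ler1n. Qed.

Let eps_gt0 : 0 < eps.
Proof. by rewrite invr_gt0 mulr_gt0// exprn_gt0// (lt_le_trans ltr01). Qed.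

Let epsN : eps * (8 * N ^+ 2) = 1.
Proof.
by rewrite /eps mulVf// mulf_neq0 ?pnatr_eq0// expf_neq0// gt_eqF// (lt_le_trans ltr01).
Qed.

Let eps_le : eps <= 8^-1.
Proof.
rewrite /eps lef_pV2 ?posrE ?mulr_gt0// ?exprn_gt0 ?(lt_le_trans ltr01 N_ge1)//.
by rewrite ler_peMr// exprn_ege1.
Qed.

Lemma large_coord_unit w : cnorm w = 1 -> exists j, N^-1 <= normc (w 0 j).
Proof.
move=> w1; apply/not_existsP => H.
have N0 : 0 < N by exact: lt_le_trans N_ge1.
have : cnorm w ^+ 2 < \sum_(j < n.+1) N^-1.
  rewrite sqr_cnorm Re_cdot_self; apply: ltr_sum => [|j _].
    by apply/hasP; exists ord0; rewrite ?mem_index_enum.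
  have wj : normc (w 0 j) < N^-1 by rewrite ltNge; apply/negP => /H.
  have N1 : N^-1 <= 1 by rewrite invf_le1.
  apply: (le_lt_trans _ wj); rewrite expr2 ler_piMl ?normc_ge0//.
  exact: le_trans (ltW wj) N1.
by rewrite w1 expr1n sumr_const card_ord -[ltRHS]mulr_natl divff ?ltxx// gt_eqF.
Qed.

(* The points around [w] at height about [2 e^2]: close to [w / |w|] in all
   coordinates but the [j]-th, which is used to tune the inner product. *)
Lemma annulus_points w (u : V) j (e : R) (a : V) :
  pdomain w -> u = ((cnorm w)^-1%:C)%C *: w -> cnorm u = 1 ->
  0 < e -> e <= eps -> height w < 4 * e ^+ 2 -> N^-1 <= normc (u 0 j) ->
  (forall k, k != j -> csquare (u 0 k) (eps * e) (a 0 k)) ->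
  normc (cdot a u - ((1 - 2 * e ^+ 2)%:C)%C) <= 2 * eps * e ^+ 2 ->
  (dball pdomain (@sdist R n.+1) w (5 * e) `&` annulus pdomain (@height R n.+1) e) a.
Proof.
move=> [w1 w0] uE u1 e0 ee hw uj ak H.
have ep := eps_gt0; have el := eps_le; have N1 := N_ge1.
have N0 : 0 < N by exact: lt_le_trans N_ge1.
set tau := cdot a u in H.
have E0 : 0 < e ^+ 2 by rewrite exprn_gt0.
have E1 : e ^+ 2 <= eps * e by rewrite expr2 ler_pM2r.
have E2 : eps * e ^+ 2 <= 8^-1 * e ^+ 2 by rewrite ler_pM2r.
have E3 : e ^+ 2 <= 64^-1.
  have -> : 64^-1 = 8^-1 ^+ 2 :> R by rewrite exprVn -natrX.
  by rewrite ler_pXn2r ?nnegrE ?invr_ge0// ?(ltW e0)// (le_trans ee).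
have tau1 : normc (tau - 1) <= 2 * e ^+ 2 + 2 * eps * e ^+ 2.
  have -> : tau - 1 = (tau - ((1 - 2 * e ^+ 2)%:C)%C) + ((- (2 * e ^+ 2))%:C)%C.
    by rewrite rmorphB rmorphN rmorph1; ring.
  apply: (le_trans (le_normcD _ _)); rewrite normc_real normrN ger0_norm; last by lra.
  lra.
pose S := \sum_(k < n.+1 | k != j) (a 0 k - u 0 k) * ((u 0 k)^*)%C.
have dk k : k != j -> normc (a 0 k - u 0 k) <= 2 * (eps * e).
  by move=> /ak[h1 h2]; apply: normc_le_ReIm; rewrite raddfB.
have uk k : normc (u 0 k) <= 1 by rewrite -u1 normc_coord_le.
have SE : tau - 1 = (a 0 j - u 0 j) * ((u 0 j)^*)%C + S.
  have <- : cdot u u = 1 by rewrite cdot_self u1 expr1n.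
  rewrite /tau /cdot -sumrB (bigD1 j)//= mulrBl; congr (_ + _).
  by apply: eq_bigr => k _; rewrite mulrBl.
have Sle : normc S <= N * (2 * (eps * e)).
  have HS : normc S <= \sum_(k < n.+1 | k != j) 2 * (eps * e).
    rewrite /S; elim/big_ind2: _ => [|x1 x2 y1 y2 h1 h2|k kj].
    - by rewrite normc0.
    - by apply: (le_trans (le_normcD _ _)); exact: lerD.
    - rewrite normcM normc_conj -[leRHS]mulr1; apply: ler_pM; rewrite ?normc_ge0//.
      exact: dk.
  apply: (le_trans HS); rewrite [leRHS](_ : _ = \sum_(k < n.+1) 2 * (eps * e)).
    rewrite [leRHS](bigD1 j)//= lerDr.
    by rewrite mulr_ge0// mulr_ge0 ?(ltW e0) ?(ltW ep).
  by rewrite sumr_const card_ord -[in RHS](mulr_natl _ n.+1).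
(* [SE] is solved for the [j]-th difference: |tau - 1| is at most 3 N eps e, |S| at most 2 N eps e,
   and the inverse of |u_j| at most N. *)
have dj : normc (a 0 j - u 0 j) <= N * (5 * N * (eps * e)).
  have : normc (a 0 j - u 0 j) * N^-1 <= 5 * N * (eps * e).
    apply: (@le_trans _ _ (normc (a 0 j - u 0 j) * normc (u 0 j))).
      by apply: ler_wpM2l; rewrite ?normc_ge0.
    rewrite -[normc (u 0 j)]normc_conj -normcM.
    have -> : (a 0 j - u 0 j) * ((u 0 j)^*)%C = (tau - 1) - S by rewrite SE addrK.
    apply: (le_trans (le_normcD _ _)); rewrite normcN.
    have ee0 : 0 < eps * e by rewrite mulr_gt0.
    have : eps * e <= N * (eps * e) by rewrite ler_peMl ?(ltW ee0).
    lra.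
  by rewrite ler_pdivrMr// mulrC.
(* Since eps N^2 = 1/8, the bound is (25/64 + 4 eps^2 N) e^2, where eps^2 N is at most 1/64. *)
have au : cnorm (a - u) ^+ 2 <= e ^+ 2.
  rewrite sqr_cnorm Re_cdot_self (bigD1 j)//= !mxE.
  have H1 : \sum_(k < n.+1 | k != j) normc ((a - u) 0 k) ^+ 2 <= N * (2 * (eps * e)) ^+ 2.
    apply: (@le_trans _ _ (\sum_(k < n.+1 | k != j) (2 * (eps * e)) ^+ 2)).
      apply: ler_sum => k kj; rewrite !mxE ler_pXn2r ?nnegrE ?normc_ge0 ?dk//.
      by rewrite mulr_ge0// mulr_ge0 ?(ltW e0) ?(ltW ep).
    rewrite [leRHS](_ : _ = \sum_(k < n.+1) (2 * (eps * e)) ^+ 2).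
      by rewrite [leRHS](bigD1 j)//= lerDr sqr_ge0.
    by rewrite sumr_const card_ord -[in RHS](mulr_natl _ n.+1).
  have H2 : normc (a 0 j - u 0 j) ^+ 2 <= (N * (5 * N * (eps * e))) ^+ 2.
    by rewrite ler_pXn2r ?nnegrE ?normc_ge0// !mulr_ge0 ?(ltW e0) ?(ltW ep) ?(ltW N0).
  apply: (le_trans (lerD H2 H1)).
  rewrite (_ : _ + _ = (25 * (eps * N ^+ 2) ^+ 2 + 4 * (eps ^+ 2 * N)) * e ^+ 2); last by ring.
  rewrite ler_piMl ?(ltW E0)//.
  have eN : eps * N ^+ 2 = 8^-1 by have := epsN; lra.
  rewrite eN.
  have : eps ^+ 2 * N <= 64^-1.
    apply: (@le_trans _ _ ((eps * N ^+ 2) ^+ 2)).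
      rewrite exprMn ler_pM2l ?exprn_gt0// -exprM.
      by rewrite -[leLHS]expr1 ler_weXn2l.
    by rewrite eN exprVn -natrX.
  have -> : 8^-1 ^+ 2 = 64^-1 :> R by rewrite exprVn -natrX.
  by move: (eps ^+ 2 * N) => y; lra.
have Retau : complex.Re tau <= 1 - 2 * e ^+ 2 + 2 * eps * e ^+ 2 /\
    1 - 2 * e ^+ 2 - 2 * eps * e ^+ 2 <= complex.Re tau.
  have := le_trans (Re_le_normc _) H; rewrite raddfB /= ler_norml => /andP[]; lra.
(* |a|^2 = 2 Re tau - 1 + |a - u|^2 is at most 1 - 4 e^2 + 4 eps e^2 + e^2, and eps is at most
   1/8. *)
have a2 : cnorm a ^+ 2 <= (1 - e ^+ 2) ^+ 2.
  have := sqr_cnorm_sub a u; rewrite u1 -/tau expr1n => h.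
  have := sqr_ge0 (e ^+ 2); case: Retau; move: h au.
  move: (cnorm (a - u) ^+ 2) (cnorm a ^+ 2) (complex.Re tau) => A B t.
  rewrite sqrrB expr1n mul1r -mulr_natl; lra.
have ha : e ^+ 2 <= height a.
  rewrite /height; suff : cnorm a <= 1 - e ^+ 2 by lra.
  by rewrite -(@ler_pXn2r _ 2) ?nnegrE ?cnorm_ge0//; lra.
have ta : complex.Re tau <= cnorm a.
  apply: (le_trans (ler_norm _)); apply: (le_trans (Re_le_normc _)).
  by apply: (le_trans (cauchy_schwarz _ _)); rewrite u1 mulr1.
have ha4 : height a < 4 * e ^+ 2 by rewrite /height; case: Retau; lra.
have an : 2^-1 <= cnorm a by move: ha4; rewrite /height; lra.
have aX : pdomain a.
  split; first by move: ha; rewrite /height /unit_ball/=; lra.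
  by rewrite -cnorm_eq0 gt_eqF//; lra.
split; last by split => //; apply/andP.
split => //=.
rewrite -(@ltr_pXn2r _ 2) ?nnegrE ?sdist_ge0 ?mulr_ge0 ?(ltW e0)// sqr_sdist pdistC /pdist.
have wp := cnorm_gt0 w0; have ap := cnorm_gt0 aX.2.
set q := cdot a w / _.
have qE : ((cnorm a)%:C)%C * q = tau.
  rewrite /tau uE cdotZr conjc_real /q.
  have -> : ((((cnorm a * cnorm w)%:C)%C)^-1 = ((cnorm a)^-1)%:C * ((cnorm w)^-1)%:C :> R[i])%C.
    by rewrite -rmorphM/= -invfM -[LHS](fmorphV (real_complex R)).
  have aa : (((cnorm a)%:C)%C * (((cnorm a)^-1)%:C)%C = 1 :> R[i]).
    by rewrite -rmorphM/= divff ?gt_eqF.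
  by rewrite -[RHS]mul1r -aa; ring.
have q1 : normc (1 - q) * cnorm a <= height a + normc (tau - 1).
  rewrite -[X in _ * X](ger0_norm (cnorm_ge0 a)) -normc_real -normcM.
  have -> : (1 - q) * ((cnorm a)%:C)%C = ((- height a)%:C)%C - (tau - 1).
    by rewrite mulrBl mul1r [q * _]mulrC qE /height rmorphN rmorphB rmorph1; ring.
  apply: (le_trans (le_normcD _ _)); rewrite normcN normc_real normrN ger0_norm//.
  exact: le_trans (ltW E0) ha.
have q2 : normc (1 - q) * 2^-1 <= normc (1 - q) * cnorm a by rewrite ler_wpM2l ?normc_ge0.
have h1 : `|cnorm a - cnorm w| <= 4 * e ^+ 2.
  have := height_gt0 (conj w1 w0); rewrite /height in ha4 hw ha * => h.
  by rewrite ler_norml; apply/andP; split; lra.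
(* [height a] is below 4 e^2 and |tau - 1| below 3 e^2, so the angular part is below 14 e^2; with at
   most 4 e^2 for the radial part, the sum stays below 25 e^2. *)
rewrite exprMn; lra.
Qed.

(** All coordinates but one range over squares of side of order e, the last one over a square of
    side of order e^2, which gives e^(2 n) e^4 = (e^2)^(n + 2). *)
Lemma vol_annulus_ge : exists c e0 : R, [/\ 0 < c, 0 < e0 &
  forall w (e : R), pdomain w -> 0 < e -> e <= e0 -> height w < 4 * e ^+ 2 ->
  ((c * (e ^+ 2) ^+ n.+2)%:E <=
   nu (dball pdomain (@sdist R n.+1) w (5 * e)%R `&` annulus pdomain (@height R n.+1) e))%E].
Proof.
have ep := eps_gt0.
exists ((4 * eps ^+ 2) ^+ n.+1), eps; split => //.
  by rewrite exprn_gt0// mulr_gt0// exprn_gt0.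
move=> w e wX e0 ee hw.
pose u := ((cnorm w)^-1%:C)%C *: w.
have u1 : cnorm u = 1.
  have wp := cnorm_gt0 wX.2.
  by rewrite cnormZ_real ger0_norm ?mulVf ?gt_eqF ?invr_ge0 ?cnorm_ge0.
have [j uj] := large_coord_unit u1.
have uj0 : u 0 j != 0.
  apply/eqP => uj0; move: uj; rewrite uj0 normc0 leNgt invr_gt0.
  by rewrite (lt_le_trans ltr01 N_ge1).
have ee0 : 0 <= eps * e by rewrite mulr_ge0 ?(ltW ep) ?(ltW e0).
have e20 : 0 <= eps * e ^+ 2 by rewrite mulr_ge0 ?(ltW ep) ?sqr_ge0.
set P := _ `&` annulus _ _ _.
have mP : measurable P.
  apply: measurableI; last exact: (measurable_annulus measurable_pdomain measurable_height).
  exact: (measurable_dball measurable_pdomain measurable_sdist).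
have -> : (4 * eps ^+ 2) ^+ n.+1 * (e ^+ 2) ^+ n.+2 =
   (4 * (eps * e) ^+ 2) ^+ n * (4 * (eps * e ^+ 2) ^+ 2).
  have -> : 4 * (eps * e) ^+ 2 = (4 * eps ^+ 2) * e ^+ 2 by ring.
  have -> : 4 * (eps * e ^+ 2) ^+ 2 = (4 * eps ^+ 2) * (e ^+ 2 * e ^+ 2) by ring.
  move: (4 * eps ^+ 2) (e ^+ 2) => A E.
  by rewrite exprMn !exprS; ring.
apply: (@prod_rV_slice_ge _ _ _ _ n j P (fun k => csquare (u 0 k) (eps * e))) => //.
- by move=> k; exact: measurable_csquare.
- by move=> k; rewrite lebesgueC_csquare.
- by rewrite mulr_ge0 ?sqr_ge0.
move=> z zk.
(* The value of the [j]-th coordinate for which the inner product with [u] is exactly 1 - 2 e^2. *)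
pose c : R[i] := (((1 - 2 * e ^+ 2)%:C)%C - \sum_(k < n.+1 | k != j) z 0 k * ((u 0 k)^*)%C)
   / ((u 0 j)^*)%C.
rewrite -(lebesgueC_csquare c e20).
have mS : measurable [set x | P (rV_upd z j x)].
  by rewrite -[X in measurable X]setTI; apply: measurable_rV_upd.
apply: (le_measure_sub lebesgueC (measurable_csquare _ _) mS).
move=> x [x1 x2] /=.
apply: (@annulus_points w u j e) => //.
  by move=> k kj; rewrite rV_updE (negbTE kj); exact: zk.
have -> : cdot (rV_upd z j x) u - ((1 - 2 * e ^+ 2)%:C)%C = (x - c) * ((u 0 j)^*)%C.
  rewrite /cdot (bigD1 j)//= rV_updE eqxx mulrBl /c divfK ?conjc_eq0//.
  rewrite (eq_bigr (fun k => z 0 k * ((u 0 k)^*)%C)); first by ring.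
  by move=> k kj; rewrite rV_updE (negbTE kj).
have -> : 2 * eps * e ^+ 2 = 2 * (eps * e ^+ 2) * 1 by ring.
rewrite normcM normc_conj; apply: ler_pM; rewrite ?normc_ge0//.
  by apply: normc_le_ReIm; rewrite raddfB.
by rewrite -u1 normc_coord_le.
Qed.
End volume.

(* A copy of [mu] on which a sigma-finite structure can be declared. *)
Definition ball_measure (R : realType) (N : nat) : set 'rV[R[i]]_N -> \bar R :=
  @mu R N.

Section ball_measure_sigma_finite.
Context (R : realType) (N : nat).
Local Open Scope ereal_scope.

HB.instance Definition _ := Measure.on (@ball_measure R N).

Let ball_measure_sigma_finite : sigma_finite setT (@ball_measure R N).
Proof.
have [F FT Foo] := sigma_finiteT (prod_rV (@lebesgueC R) N).
exists F => // k; have [mF Fk] := Foo k; split => //.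
rewrite /ball_measure /mu /mscale/=; apply: lte_mul_pinfty => //.
Qed.

HB.instance Definition _ := Measure_isSigmaFinite.Build _ _ _
  (@ball_measure R N) ball_measure_sigma_finite.

End ball_measure_sigma_finite.

(** * The volume bounds for the normalized measure *)

Section ball_volume.
Context {R : realType} {n : nat}.
Local Notation V := 'rV[R[i]]_n.+1.
Local Notation nu := (prod_rV (@lebesgueC R) n.+1).
Local Notation m := (@ball_measure R n.+1).

Lemma pdomain_height (e : R) : 0 < e -> e < 1 -> exists2 w : V, pdomain w & height w = e.
Proof.
move=> e0 e1; pose d : V := delta_mx 0 ord0.
have d1 : cnorm d = 1.
  apply/eqP; rewrite -(@eqrXn2 _ 2) ?cnorm_ge0// sqr_cnorm Re_cdot_self expr1n.
  rewrite (bigD1 ord0)//= mxE !eqxx normc1 expr1n big1 ?addr0// => j /negbTE j0.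
  by rewrite mxE j0 andbF normc0 expr0n.
have e1' : 0 < 1 - e by rewrite subr_gt0.
have c : cnorm (((1 - e)%:C)%C *: d) = 1 - e.
  by rewrite cnormZ_real d1 mulr1 ger0_norm// ltW.
exists (((1 - e)%:C)%C *: d); last by rewrite /height c subKr.
split; first by rewrite /unit_ball/= c gtrBl.
by rewrite -cnorm_eq0 c gt_eqF.
Qed.

(** The unit ball contains a set measured by [vol_annulus_ge]. With finiteness, this makes the
    scaling factor of [mu] positive, as the lower bounds require. *)
Lemma nu_unit_ball_gt0 : (0 < nu (@unit_ball R n.+1))%E.
Proof.
have [c [e0 [c0 e00 H]]] := @vol_annulus_ge R n.
pose e := Num.min e0 2^-1.
have e_gt0 : 0 < e by rewrite lt_min e00/= invr_gt0.
have e_le : e <= e0 by rewrite ge_min lexx.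
have e1 : e <= 2^-1 by rewrite ge_min lexx orbT.
have e21 : e ^+ 2 < 1.
  by rewrite expr_lt1 ?(ltW e_gt0)// (le_lt_trans e1)// invf_lt1// ltr1n.
have [w wX wh] := pdomain_height (exprn_gt0 2 e_gt0) e21.
have hw : height w < 4 * e ^+ 2 by rewrite wh ltr_pMl ?exprn_gt0// ltr1n.
apply: (lt_le_trans _ (le_trans (H w e wX e_gt0 e_le hw) _)).
  by rewrite lte_fin mulr_gt0 ?exprn_gt0.
apply: (le_measure_sub nu _ measurable_unit_ball); last by move=> z [[[]]].
apply: measurableI; last exact: (measurable_annulus measurable_pdomain measurable_height).
exact: (measurable_dball measurable_pdomain measurable_sdist).
Qed.

Lemma ball_measureE : exists2 c0 : R, 0 < c0 & forall A : set V, m A = (c0%:E * nu A)%E.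
Proof.
exists (fine (nu (@unit_ball R n.+1)))^-1 => //.
rewrite invr_gt0 fine_gt0// nu_unit_ball_gt0/=.
by apply: (le_lt_trans vol_unit_ball_le); exact: ltry.
Qed.

Lemma ball_strip_ub : exists2 C : R, 0 < C & forall (zeta : V) (r rho : R),
  pdomain zeta -> 0 < r -> 0 < rho -> height zeta < r ->
  (m (pball zeta r `&` [set z | (height z < rho)%R]) <= (C * (r ^+ n.+1 * rho))%:E)%E.
Proof.
have [c0 c0_gt0 mE] := ball_measureE; have [C C0 H] := @vol_strip_le R n.
exists (c0 * C); first exact: mulr_gt0.
move=> zeta r rho zX r0 rho0 hr; rewrite mE -mulrA EFinM.
by apply: lee_wpmul2l; [rewrite lee_fin ltW|exact: H].
Qed.

Lemma pball_height (zeta : V) (r : R) z : height zeta < r -> pball zeta r z ->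
  height z < 2 * r.
Proof.
move=> hr [z1 z0 dz]; have := height_le zeta z; rewrite pdistC; lra.
Qed.

Lemma ball_ub : exists2 C : R, 0 < C & forall (zeta : V) (r : R),
  pdomain zeta -> 0 < r -> height zeta < r ->
  (m (pball zeta r) <= (C * r ^+ n.+2)%:E)%E.
Proof.
have [C C0 H] := ball_strip_ub; exists (C * 2); first by rewrite mulr_gt0.
move=> zeta r zX r0 hr; have r2 : 0 < 2 * r by rewrite mulr_gt0.
have -> : C * 2 * r ^+ n.+2 = C * (r ^+ n.+1 * (2 * r)) by rewrite [r ^+ n.+2]exprSr; ring.
apply: le_trans (H zeta r (2 * r) zX r0 r2 hr).
rewrite [X in (_ <= m X)%E](_ : _ = pball zeta r)//.
by apply/seteqP; split => [z []//|z Bz]; split => //; exact: pball_height Bz.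
Qed.

Lemma ball_annulus_lb : exists c e0 : R, [/\ 0 < c, 0 < e0 &
  forall (w : V) (e : R), pdomain w -> 0 < e <= e0 -> height w < 4 * e ^+ 2 ->
  ((c * (e ^+ 2) ^+ n.+2)%:E <=
   m (dball pdomain (@sdist R n.+1) w (5 * e)%R `&` annulus pdomain (@height R n.+1) e))%E].
Proof.
have [c0 c0_gt0 mE] := ball_measureE; have [c [e0 [c_gt0 e00 H]]] := @vol_annulus_ge R n.
exists (c0 * c), e0; split => //; first exact: mulr_gt0.
move=> w e wX /andP[e_gt0 ee] hw; rewrite mE -mulrA EFinM.
by apply: lee_wpmul2l; [rewrite lee_fin ltW|exact: H].
Qed.

Lemma defect_height (z : V) : pdomain z ->
  height z <= 1 - cnorm z ^+ 2 <= 2 * height z.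
Proof.
case; rewrite /unit_ball/= => z1 _; have z0 := cnorm_ge0 z.
by rewrite /height; apply/andP; split; nra.
Qed.

Lemma measurable_defect : measurable_fun setT (fun z : V => 1 - cnorm z ^+ 2).
Proof. by apply: measurable_funB => //; apply: measurable_funX; exact: measurable_cnorm. Qed.

Lemma measurable_defect_powR (c : R) :
  measurable_fun setT (fun z : V => (1 - cnorm z ^+ 2) `^ c).
Proof. exact: (measurableT_comp (measurable_powR _) measurable_defect). Qed.

(** For c >= 0 the integrand is at most (4 r)^c. For c = - gam < 0, the part of the ball with height
    below 4^(-i) 2 r carries a weight of order 4^(i gam) and has volume of order 4^(-i); the ratio
    4^gam / 4 is below 1 because c > -1. *)
Lemma ball_weighted_ub (c : R) : -1 < c -> exists2 C : R, 0 < C &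
  forall (zeta : V) (r : R), pdomain zeta -> 0 < r -> height zeta < r ->
  (\int[m]_(z in pball zeta r) ((1 - cnorm z ^+ 2) `^ c)%:E <=
   (C * r `^ (n.+2%:R + c))%:E)%E.
Proof.
move=> c1; have [C C0 H] := ball_strip_ub.
have mE zeta r : measurable_fun (pball zeta r) (fun z : V => ((1 - cnorm z ^+ 2) `^ c)%:E).
  by apply/measurable_EFinP; apply: measurable_funTS; exact: measurable_defect_powR.
have powN r : 0 < r -> r `^ (n.+2%:R + c) = r ^+ n.+2 * r `^ c.
  by move=> r0; rewrite powRD ?powR_mulrn ?(ltW r0)// (gt_eqF r0) implybT.
have [c0|c0] := leP 0 c.
  have [C' C'0 H'] := ball_ub.
  exists (C' * 4 `^ c); first by rewrite mulr_gt0 ?powR_gt0.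
  move=> zeta r zX r0 hr; have mB := measurable_pball zeta r.
  apply: (@le_trans _ _ (\int[m]_(z in pball zeta r) (4 * r `^ c * 4 `^ c / 4)%:E)%E).
    apply: (ge0_le_integral m mB).
    - by move=> z _; rewrite lee_fin powR_ge0.
    - exact: mE.
    - exact: measurable_cst.
    - move=> z Bz; rewrite lee_fin.
      have zX' : pdomain z by case: Bz.
      have /andP[d1 d2] := defect_height zX'; have hz := pball_height hr Bz.
      have h0 := height_gt0 zX'.
      rewrite (_ : _ / 4 = (4 * r) `^ c); last by rewrite powRM ?(ltW r0)//; field.
      by apply: ge0_ler_powR; rewrite ?nnegrE//; lra.
  rewrite integral_cst//.
  have k0 : (0 <= (4 * r `^ c * 4 `^ c / 4)%:E)%E by rewrite lee_fin !mulr_ge0 ?powR_ge0 ?invr_ge0.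
  apply: (le_trans (lee_wpmul2l k0 (H' zeta r zX r0 hr))).
  by rewrite -EFinM lee_fin powN// le_eqVlt; apply/orP; left; apply/eqP; field.
pose gam := - c; have gam0 : 0 < gam by rewrite oppr_gt0.
pose q : R := 4 `^ gam / 4.
have q0 : 0 <= q by rewrite divr_ge0 ?powR_ge0.
have q1 : q < 1.
  rewrite ltr_pdivrMr// mul1r -[ltRHS](@powRr1 _ 4)//.
  by rewrite /powR pnatr_eq0/= ltr_expR ltr_pM2r ?ln_gt0 ?ltr1n// /gam; lra.
have q1' : 0 < 1 - q by rewrite subr_gt0.
pose C1 := C * 2 `^ (1 - gam) * (1 + 4 `^ gam / (1 - q)).
have C10 : 0 < C1.
  by rewrite !mulr_gt0 ?powR_gt0// addr_gt0// divr_gt0 ?powR_gt0.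
exists C1 => // zeta r zX r0 hr.
pose B := pball zeta r; have mB : measurable B by exact: measurable_pball.
(* All heights in [B] are below 2 r, so that the strip of index 0 contains [B]. *)
pose e := Num.sqrt (2 * r).
have r2 : 0 < 2 * r by rewrite mulr_gt0.
have e_gt0 : 0 < e by rewrite sqrtr_gt0.
have e2 : e ^+ 2 = 2 * r by rewrite sqr_sqrtr// ltW.
pose k : R := (2 * r) `^ (- gam).
have k0 : 0 <= k by exact: powR_ge0.
pose D i := [set z : V | height z < (2^-1 ^+ i * e) ^+ 2].
have mD i : measurable (D i) by exact: measurable_height_lt.
pose u i (z : V) : \bar R := ((cst (k * (4 `^ gam) ^+ i.+1)%:E) \_ (D i)) z.
have ki0 i : 0 <= k * (4 `^ gam) ^+ i.+1 by rewrite mulr_ge0 ?exprn_ge0 ?powR_ge0.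
have u0 i z : (0 <= u i z)%E by rewrite /u /patch; case: ifP => // _; rewrite lee_fin.
have mu_ i : measurable_fun B (u i).
  apply: measurable_funTS; apply/(measurable_restrictT _ (mD i)); exact: measurable_cst.
have mS : measurable_fun B (fun z => \sum_(0 <= i <oo) u i z)%E.
  by apply: ge0_emeasurable_sum => // i z _ _; exact: u0.
have S0 z : (0 <= \sum_(0 <= i <oo) u i z)%E by apply: nneseries_ge0 => i _ _; exact: u0.
apply: (@le_trans _ _ (\int[m]_(z in B) (k%:E + \sum_(0 <= i <oo) u i z))%E).
  apply: (ge0_le_integral m mB).
  - by move=> z _; rewrite lee_fin powR_ge0.
  - exact: mE.
  - by apply: emeasurable_funD => //; exact: measurable_cst.
  - move=> z Bz; have zX' : pdomain z by case: Bz.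
    have h0 := height_gt0 zX'; have /andP[d1 d2] := defect_height zX'.
    apply: (@le_trans _ _ (height z `^ (- gam))%:E).
      rewrite lee_fin -[c in leLHS]opprK -/gam (powRN (1 - _)) (powRN (height z)).
      have d0 := lt_le_trans h0 d1.
      rewrite lef_pV2 ?posrE ?powR_gt0//.
      by apply: ge0_ler_powR; rewrite ?nnegrE ?(ltW gam0) ?(ltW h0) ?(ltW d0).
    apply: (le_trans (powR_dyadic_strip gam0 e_gt0 h0)).
    rewrite e2 -/k; apply: leeD2l; apply: lee_nneseries => [i _ _|i _].
      by rewrite lee_fin; case: ifP.
    rewrite /u /patch; case: (boolP (z \in D i)) => [/set_mem|/negP zD].
      by rewrite /D/= => ->.
    by rewrite ifN//; apply/negP => hy; apply: zD; rewrite inE.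
have kE z : B z -> (0 <= k%:E)%E by rewrite lee_fin.
rewrite (ge0_integralD m mB kE (@measurable_cst _ _ _ _ _ _) (fun z _ => S0 z) mS).
rewrite (integral_nneseries m mB mu_ (fun i z _ => u0 i z)).
have HB : (\int[m]_(z in B) k%:E <= (k * (C * (r ^+ n.+1 * (2 * r))))%:E)%E.
  rewrite integral_cst// EFinM; apply: lee_wpmul2l; first by rewrite lee_fin.
  apply: le_trans (H zeta r (2 * r) zX r0 r2 hr).
  apply: (le_measure_sub m mB (measurableI _ _ mB (measurable_height_lt _))).
  by move=> z Bz; split => //; exact: pball_height Bz.
have HS : (\sum_(0 <= i <oo) \int[m]_(z in B) u i z <=
    (k * (C * (r ^+ n.+1 * (2 * r))) * (4 `^ gam / (1 - q)))%:E)%E.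
  apply: nneseries_le => [i|N]; first by apply: integral_ge0 => z _; exact: u0.
  apply: (@le_trans _ _ (\sum_(0 <= i < N)
      (k * (C * (r ^+ n.+1 * (2 * r))) * 4 `^ gam * q ^+ i)%:E)%E).
    apply: lee_sum => i _.
    rewrite -integral_mkcondr integral_cst; last exact: measurableI.
    have rho0 : 0 < (2^-1 ^+ i * e) ^+ 2 by rewrite exprn_gt0 ?mulr_gt0 ?exprn_gt0 ?invr_gt0.
    have ki : (0 <= (k * (4 `^ gam) ^+ i.+1)%:E)%E by rewrite lee_fin.
    apply: (le_trans (lee_wpmul2l ki (H zeta r _ zX r0 rho0 hr))).
    rewrite -EFinM lee_fin exprMn e2 le_eqVlt; apply/orP; left; apply/eqP.
    have -> : (2^-1 ^+ i) ^+ 2 = 4^-1 ^+ i :> R.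
      by rewrite -exprM mulnC exprM; congr (_ ^+ i); rewrite exprVn -natrX.
    rewrite /q expr_div_n exprS exprVn; field.
    by rewrite expf_neq0// pnatr_eq0.
  rewrite sumEFin lee_fin -mulr_sumr [leRHS]mulrA.
  apply: ler_wpM2l; last exact: sum_geometric_le.
  by rewrite !mulr_ge0 ?powR_ge0 ?exprn_ge0 ?(ltW C0) ?(ltW r0).
apply: (le_trans (leeD HB HS)); rewrite -EFinD lee_fin le_eqVlt; apply/orP; left; apply/eqP.
rewrite powN// /C1 /k powRM ?(ltW r0)// (@powRD _ 2 1 (- gam)).
  by rewrite powRr1// /gam opprK !exprSr; field; rewrite gt_eqF.
by rewrite pnatr_eq0 implybT.
Qed.

End ball_volume.

(** * The weights *)

(* No measurability is assumed: the integral is a difference of suprema over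
   simple functions. *)
Lemma le_integral_any d (T : measurableType d) (R : realType)
    (m : {measure set T -> \bar R}) (D : set T) (f g : T -> \bar R) :
  (forall x, D x -> f x <= g x)%E ->
  (\int[m]_(x in D) f x <= \int[m]_(x in D) g x)%E.
Proof.
move=> fg; have fgD x : ((f \_ D) x <= (g \_ D) x)%E.
  by rewrite /patch; case: ifPn => // /set_mem; exact: fg.
rewrite /integral; apply: leeB; apply: ereal_sup_le => _ [h hf <-]; exists h => // x.
  apply: (le_trans (hf x)); rewrite !funeposE.
  by rewrite ge_max !le_max lexx orbT fgD.
apply: (le_trans (hf x)); rewrite !funenegE.
by rewrite ge_max !le_max lexx orbT leeN2 fgD.
Qed.

(** The two divisions by [d] contribute 1 + (p - 1) = p powers of [d]. *)
Lemma le_of_div_powR {R : realType} (x y : \bar R) (p d K : R) :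
  (0 <= x)%E -> (0 <= y)%E -> 0 < d ->
  (x / d%:E * (y / d%:E) `^ (p - 1) <= K%:E)%E ->
  (x * y `^ (p - 1) <= (K * d `^ p)%:E)%E.
Proof.
move=> x0 y0 d0; rewrite inver gt_eqF// => H.
have dp : 0 < d `^ p by rewrite powR_gt0.
have -> : (x * y `^ (p - 1) =
    x * d^-1%:E * (y * d^-1%:E) `^ (p - 1) * (d `^ p)%:E)%E.
  have E : d^-1 * d^-1 `^ (p - 1) * d `^ p = 1.
    rewrite -powR_inv1 ?(ltW d0)// -powRrM -!powRD ?(gt_eqF d0) ?implybT//.
    by rewrite (_ : -1 + -1 * (p - 1) + p = 0) ?powRr0//; ring.
  rewrite poweRM ?lee_fin ?invr_ge0 ?(ltW d0)// poweR_EFin muleACA.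
  by rewrite -(muleA (x * _)%E) -!EFinM E mule1.
by rewrite EFinM; apply: lee_wpmul2r => //; rewrite lee_fin ltW.
Qed.

Lemma pdist_le3 {R : realType} {N : nat} (z w : 'rV[R[i]]_N) :
  pdomain z -> pdomain w -> pdist z w <= 3.
Proof.
move=> [z1 z0] [w1 w0]; have zp := cnorm_gt0 z0; have wp := cnorm_gt0 w0.
rewrite /unit_ball/= in z1 w1.
have H1 : `|cnorm z - cnorm w| <= 1 by rewrite ler_norml; apply/andP; split; lra.
have H2 : normc (cdot z w / ((cnorm z * cnorm w)%:C)%C) <= 1.
  rewrite normcM normcV normc_real ger0_norm ?mulr_ge0 ?cnorm_ge0//.
  by rewrite ler_pdivrMr ?mulr_gt0// mul1r cauchy_schwarz.
have := le_normcD 1 (- (cdot z w / ((cnorm z * cnorm w)%:C)%C)).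
rewrite normcN normc1 /pdist; lra.
Qed.

Section weights.
Context {R : realType} {n : nat}.
Local Notation V := 'rV[R[i]]_n.+1.
Local Notation m := (@ball_measure R n.+1).
Variables (p q Q s t : R) (omega : V -> R).
Hypotheses (p1 : 1 < p) (omega_weight : is_weight omega).

Let pos_set : set V := unit_ball `&` omega @^-1` `]0, +oo[.

Let mpos_set : measurable pos_set.
Proof.
by case: omega_weight => mo _ _; apply: mo => //; exact: measurable_unit_ball.
Qed.

(* [omega] made positive everywhere, by the value 1 on a null part of the ball
   and outside of the ball. *)
Definition wpos (z : V) : R := \1_pos_set z * (omega \_ pos_set) z + \1_(~` pos_set) z.

Lemma measurable_wpos : measurable_fun setT wpos.
Proof.
apply: measurable_funD; last by apply/measurable_indicP; exact: measurableC.
apply: measurable_funM; first exact/measurable_indicP.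
apply/(measurable_restrictT _ mpos_set).
case: omega_weight => mo _ _; apply: measurable_funS mo; first exact: measurable_unit_ball.
by move=> z [].
Qed.

Lemma wposE z : unit_ball z -> 0 < omega z -> wpos z = omega z.
Proof.
move=> z1 oz; have Pz : pos_set z by split => //=; rewrite in_itv/= oz.
rewrite /wpos /patch !indicE in_setC mem_set//= mul1r addr0//.
Qed.

Lemma wpos_gt0 z : 0 < wpos z.
Proof.
rewrite /wpos /patch !indicE in_setC; case: (boolP (z \in pos_set)) => [/set_mem[_ /=]|_].
  by rewrite in_itv/= andbT mul1r addr0.
by rewrite mul0r add0r.
Qed.

Lemma eq_integral_wpos (F F' : V -> R) (A : set V) : measurable A -> A `<=` unit_ball ->
  measurable_fun A F -> measurable_fun A F' ->
  (forall z, A z -> 0 < omega z -> F z = F' z) ->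
  (\int[m]_(z in A) (F z)%:E = \int[m]_(z in A) (F' z)%:E)%E.
Proof.
move=> mA Ab mF mF' FF'; apply: ae_eq_integral => //; [exact/measurable_EFinP|exact/measurable_EFinP|].
case: omega_weight => _ o0 _; apply: filterS o0 => z oz Az.
by rewrite FF'// oz//; exact: Ab.
Qed.

Let D (z : V) : R := 1 - cnorm z ^+ 2.

Definition weight_v z : R := wpos z * D z `^ (Q + p * t).
Definition weight_sg z : R :=
  wpos z `^ (- 1 / (p - 1)) * D z `^ (q + p / (p - 1) * (s - q)).

Lemma measurable_weight_v : measurable_fun setT weight_v.
Proof. by apply: measurable_funM; [exact: measurable_wpos|exact: measurable_defect_powR]. Qed.

Lemma measurable_weight_sg : measurable_fun setT weight_sg.
Proof.
apply: measurable_funM; last exact: measurable_defect_powR.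
exact: (measurableT_comp (measurable_powR _) measurable_wpos).
Qed.

Lemma weight_v_ge0 z : 0 <= weight_v z.
Proof. by rewrite mulr_ge0 ?powR_ge0// ltW// wpos_gt0. Qed.

Lemma weight_sg_ge0 z : 0 <= weight_sg z.
Proof. by rewrite mulr_ge0 ?powR_ge0. Qed.

Let pball_sub zeta r : pball zeta r `<=` @unit_ball R n.+1.
Proof. by move=> z []. Qed.

Let momega A : A `<=` @unit_ball R n.+1 -> measurable_fun A omega.
Proof.
by case: omega_weight => mo _ _ Ab; apply: measurable_funS mo => //; exact: measurable_unit_ball.
Qed.

Lemma integral_weight_v zeta r :
  integral_mu (Q + p * t) (pball zeta r) (EFin \o omega) =
  (\int[m]_(z in pball zeta r) (weight_v z)%:E)%E.
Proof.
rewrite -(@eq_integral_wpos (fun z => omega z * D z `^ (Q + p * t))).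
- by [].
- exact: measurable_pball.
- exact: pball_sub.
- apply: measurable_funM; first by apply: momega; exact: pball_sub.
  by apply: measurable_funTS; exact: measurable_defect_powR.
- by apply: measurable_funTS; exact: measurable_weight_v.
- by move=> z [z1 _ _] oz; rewrite /weight_v wposE.
Qed.

Lemma integral_weight_sg zeta r :
  integral_mu (q + p / (p - 1) * (s - q)) (pball zeta r)
    (fun w => (omega w `^ (- 1 / (p - 1)))%:E) =
  (\int[m]_(z in pball zeta r) (weight_sg z)%:E)%E.
Proof.
rewrite -(@eq_integral_wpos
  (fun z => omega z `^ (- 1 / (p - 1)) * D z `^ (q + p / (p - 1) * (s - q)))).
- by [].
- exact: measurable_pball.
- exact: pball_sub.
- apply: measurable_funM; last by apply: measurable_funTS; exact: measurable_defect_powR.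
  by apply: (measurableT_comp (measurable_powR _)); apply: momega; exact: pball_sub.
- by apply: measurable_funTS; exact: measurable_weight_sg.
- by move=> z [z1 _ _] oz; rewrite /weight_sg wposE.
Qed.

Let c : R := s + t + (Q - q) / p.
Let b : R := n.+2%:R + c.

(** In case (i) the normalizing factor is r^b itself. In case (ii) it is a measure, of which only
    the upper bound [ball_weighted_ub] is used; s + t > -1 and Q >= q make its exponent [c] exceed
    -1. *)
Lemma weight_bound : case_i n.+1 p q Q s t \/ case_ii p q Q s t ->
  D_class p q Q s t omega -> exists2 DC : R, 0 < DC &
  forall zeta r, pdomain zeta -> 0 < r -> height zeta < r ->
  (\int[m]_(z in pball zeta r) (weight_v z)%:E *
   (\int[m]_(z in pball zeta r) (weight_sg z)%:E) `^ (p - 1) <= (DC * r `^ (b * p))%:E)%E.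
Proof.
have p0 : 0 < p by exact: lt_trans ltr01 p1.
have V0 zeta r : (0 <= \int[m]_(z in pball zeta r) (weight_v z)%:E)%E.
  by apply: integral_ge0 => z _; rewrite lee_fin weight_v_ge0.
have S0 zeta r : (0 <= \int[m]_(z in pball zeta r) (weight_sg z)%:E)%E.
  by apply: integral_ge0 => z _; rewrite lee_fin weight_sg_ge0.
have char_le den : (D_characteristic p q Q s t omega den < +oo)%E -> exists2 K : R, 0 < K &
    forall zeta r, pdomain zeta -> height zeta < r ->
    (\int[m]_(z in pball zeta r) (weight_v z)%:E / den zeta r *
     (\int[m]_(z in pball zeta r) (weight_sg z)%:E / den zeta r) `^ (p - 1) <= K%:E)%E.
  move=> fin; exists (`|fine (D_characteristic p q Q s t omega den)| + 1).
    by rewrite ltr_wpDl.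
  move=> zeta r [z1 z0] hr.
  have : (\int[m]_(z in pball zeta r) (weight_v z)%:E / den zeta r *
     (\int[m]_(z in pball zeta r) (weight_sg z)%:E / den zeta r) `^ (p - 1) <=
      D_characteristic p q Q s t omega den)%E.
    rewrite -integral_weight_v -integral_weight_sg.
    apply: ereal_sup_ubound; exists zeta, r; split; first by split.
    reflexivity.
  move/le_trans; apply; move: fin.
  case: (D_characteristic p q Q s t omega den) => [k _|//|_]; last exact: leNye.
  by rewrite lee_fin /=; have := ler_norm k; lra.
have Eb : n.+1%:R + 1 + s + t + (Q - q) / p = b.
  by rewrite /b /c -[n.+2]addn1 natrD; ring.
move=> [ci|cii] [HDi HDii].
  have [K K0 HK] := char_le _ (HDi ci).
  exists K => // zeta r zX r0 hr; rewrite powRrM.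
  apply: le_of_div_powR => //; first by rewrite powR_gt0.
  by rewrite -Eb; exact: HK.
have [K K0 HK] := char_le _ (HDii cii).
have c1 : -1 < c.
  case: cii => st qQ; rewrite /c (lt_le_trans st)// lerDl divr_ge0 ?subr_ge0// ltW//.
have [C C0 HC] := @ball_weighted_ub R n c c1.
exists (K * C `^ p); first by rewrite mulr_gt0 ?powR_gt0.
move=> zeta r zX r0 hr.
have {}HC := HC zeta r zX r0 hr; have {}HK := HK zeta r zX hr.
have mB := measurable_pball zeta r.
have muE : mu_ c (pball zeta r) = (\int[m]_(z in pball zeta r) (D z `^ c)%:E)%E.
  by apply: eq_integral => z _; rewrite /= mul1e.
rewrite muE in HK.
have mDc : measurable_fun (pball zeta r) (fun z : V => (D z `^ c)%:E).
  by apply/measurable_EFinP; apply: measurable_funTS; exact: measurable_defect_powR.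
have I0 : (0 <= \int[m]_(z in pball zeta r) (D z `^ c)%:E)%E.
  by apply: integral_ge0 => z _; rewrite lee_fin powR_ge0.
have [I00|I0'] := eqVneq (\int[m]_(z in pball zeta r) (D z `^ c)%:E)%E 0%E.
  rewrite (_ : (\int[m]_(z in pball zeta r) (weight_v z)%:E)%E = 0%E).
    by rewrite mul0e lee_fin !mulr_ge0 ?powR_ge0 ?(ltW K0).
  rewrite -[RHS](integral0 m (pball zeta r)); apply: ae_eq_integral => //.
    by apply/measurable_EFinP; apply: measurable_funTS; exact: measurable_weight_v.
  have /(ae_eq_integral_abs m mB mDc) : (\int[m]_(z in pball zeta r) `|(D z `^ c)%:E| = 0)%E.
    rewrite -I00; apply: eq_integral => z _.
    by rewrite gee0_abs// lee_fin powR_ge0.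
  apply: filterS => z Dz Bz; have := Dz Bz => -[] /eqP.
  case: Bz => z1 z0 _; have /andP[d1 _] := defect_height (conj z1 z0).
  by rewrite gt_eqF// powR_gt0// (lt_le_trans (height_gt0 (conj z1 z0))).
have Ifin : (\int[m]_(z in pball zeta r) (D z `^ c)%:E)%E \is a fin_num.
  by rewrite ge0_fin_numE// (le_lt_trans HC)// ltry.
rewrite -(fineK Ifin) in HK HC I0 I0'.
move: (fine _) HK HC I0 I0' => d HK HC d0 dn.
have {d0 dn} d0 : 0 < d by rewrite lt0r -lee_fin d0 andbT; apply: contra dn => /eqP ->.
apply: (le_trans (le_of_div_powR _ _ d0 HK)) => //.
rewrite lee_fin in HC; rewrite lee_fin -mulrA (ler_pM2l K0) powRrM -powRM ?powR_ge0 ?(ltW C0)//.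
by apply: ge0_ler_powR; rewrite ?nnegrE ?mulr_ge0 ?powR_ge0 ?(ltW p0) ?(ltW d0) ?(ltW C0).
Qed.

(** The powers of the weight cancel, as (1 - 1/p) / (p - 1) = 1/p, and those of 1 - |z|^2 add up to
    [c]. The factor [kap] passes from 1 - |z|^2 to the height, which lies between half of it and all
    of it. *)
Lemma weight_product : exists2 kap : R, 0 < kap & forall z, pdomain z ->
  kap * height z `^ (b - n.+2%:R) <= weight_v z `^ p^-1 * weight_sg z `^ (1 - p^-1).
Proof.
have p0 : 0 < p by exact: lt_trans ltr01 p1.
have pm1 : 0 < p - 1 by rewrite subr_gt0.
pose kap : R := Num.min 1 (2 `^ c).
have k0 : 0 < kap by rewrite lt_min ltr01 powR_gt0.
exists kap => // z zX.
have w0 := wpos_gt0 z; have h0 := height_gt0 zX; have /andP[d1 d2] := defect_height zX.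
have d0 : 0 < D z by exact: lt_le_trans d1.
rewrite (_ : weight_v z `^ p^-1 * _ = D z `^ c); last first.
  rewrite /weight_v /weight_sg !powRM ?powR_ge0 ?(ltW w0)// -!powRrM mulrACA.
  rewrite -!powRD ?(gt_eqF w0) ?(gt_eqF d0) ?implybT//.
  rewrite (_ : p^-1 + _ = 0); last by field; rewrite !gt_eqF.
  rewrite powRr0 mul1r; congr (_ `^ _); rewrite /c; field; rewrite !gt_eqF//.
rewrite (_ : b - _ = c); last by rewrite /b; ring.
have [c0|c0] := leP 0 c.
  apply: (@le_trans _ _ (height z `^ c)).
    by rewrite ger_pMl ?powR_gt0// ge_min lexx.
  by apply: ge0_ler_powR; rewrite ?nnegrE ?(ltW h0) ?(ltW d0).
apply: (@le_trans _ _ ((2 * height z) `^ c)).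
  rewrite powRM ?(ltW h0)//; apply: ler_wpM2r; first exact: powR_ge0.
  by rewrite ge_min lexx orbT.
have h2 : 0 < 2 * height z by rewrite mulr_gt0.
rewrite -[c]opprK (powRN (D z)) (powRN (2 * _)) lef_pV2 ?posrE ?powR_gt0//.
by apply: ge0_ler_powR; rewrite ?nnegrE ?oppr_ge0 ?(ltW c0) ?(ltW h2) ?(ltW d0).
Qed.

End weights.

(** * The maximal operator *)

(** The least index whose radius is below [r] is [k.+1], unless the radius 4 of index 0 is already
    below [r]. *)
Lemma dyadic_scale {R : realType} (r : R) : 0 < r -> exists k : nat,
  (2 * 2^-1 ^+ k) ^+ 2 <= 4 * r /\ (r <= (2 * 2^-1 ^+ k) ^+ 2 \/ k = 0%N /\ 4 < r).
Proof.
move=> r0; have exN : exists k : nat, (2 * 2^-1 ^+ k) ^+ 2 < r.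
  exists (Num.trunc (4 / r)).+1; have := truncnS_gt (4 / r).
  move: (Num.trunc _).+1 => k H.
  rewrite ltr_pdivrMr// mulrC in H.
  have -> : (2 * 2^-1 ^+ k) ^+ 2 = 4 / (4 : R) ^+ k.
    have E4 : 4 = 2 ^+ 2 :> R by rewrite -natrX.
    by rewrite exprMn -[in LHS]exprM mulnC [in LHS]exprM [2^-1 ^+ 2]exprVn exprVn -E4.
  rewrite ltr_pdivrMr ?exprn_gt0//; apply: (lt_le_trans H).
  by rewrite ler_pM2l// -natrX ler_nat ltnW// ltn_expl.
have := ex_minnP exN; case=> [[|k]] Hk mink.
  exists 0%N; rewrite expr0 mulr1 in Hk *.
  have E4 : 2 ^+ 2 = 4 :> R by rewrite -natrX.
  by rewrite E4 in Hk *; split; [lra|right; split].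
exists k; split.
  have -> : (2 * 2^-1 ^+ k) ^+ 2 = 4 * (2 * 2^-1 ^+ k.+1) ^+ 2 :> R by rewrite [_ ^+ k.+1]exprS; field.
  by rewrite ler_pM2l// ltW.
by left; rewrite leNgt; apply/negP => /mink; rewrite ltnn.
Qed.

Section pointwise.
Context {R : realType} {n : nat}.
Local Notation V := 'rV[R[i]]_n.+1.
Local Notation m := (@ball_measure R n.+1).
Variables (p q Q s t : R) (omega : V -> R) (f : V -> R[i]).
Hypotheses (p1 : 1 < p) (omega_weight : is_weight omega)
  (f_measurable : measurable_fun unit_ball f).

Let D (z : V) : R := 1 - cnorm z ^+ 2.
Let v := weight_v p Q t omega.
Let sg := weight_sg p q s omega.
(** [f] is measurable on the ball only, hence its extension by 0. *)
Let f1 : V -> R := fun z => normc ((f \_ unit_ball) z).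
Let a : R := n.+2%:R + s + t.
Let p0 : 0 < p. Proof. exact: lt_trans ltr01 p1. Qed.

Definition weight_g z : R := f1 z `^ p * wpos omega z * D z `^ q.

Let measurable_f1 : measurable_fun setT f1.
Proof.
apply: measurable_normc; apply/(measurable_restrictT _ measurable_unit_ball).
exact: f_measurable.
Qed.

Lemma measurable_weight_g : measurable_fun setT weight_g.
Proof.
apply: measurable_funM; last exact: measurable_defect_powR.
apply: measurable_funM; last exact: measurable_wpos.
exact: (measurableT_comp (measurable_powR _)).
Qed.

Lemma weight_g_ge0 z : 0 <= weight_g z.
Proof. by rewrite !mulr_ge0 ?powR_ge0// ltW// wpos_gt0. Qed.

Let f1E z : unit_ball z -> f1 z = normc (f z).
Proof. by move=> z1; rewrite /f1 /patch mem_set. Qed.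

(** The powers of the weight cancel once the roots are taken, and the exponents of 1 - |z|^2 add up
    to q/p + q (1 - 1/p) + s - q = s. *)
Let integrandE z : pdomain z ->
  normc (f z) * D z `^ s = weight_g z `^ p^-1 * sg z `^ (1 - p^-1).
Proof.
move=> zX; have pm1 : 0 < p - 1 by rewrite subr_gt0.
have w0 := wpos_gt0 omega z; have h0 := height_gt0 zX; have /andP[d1 _] := defect_height zX.
have d0 : 0 < D z by exact: lt_le_trans d1.
rewrite /weight_g /sg /weight_sg -/(D z) !powRM ?mulr_ge0 ?powR_ge0 ?(ltW w0)// -!powRrM.
rewrite divff ?gt_eqF// powRr1 ?normc_ge0// (f1E zX.1).
rewrite [RHS]mulrACA -[X in _ = X * _]mulrA -!powRD ?(gt_eqF w0) ?(gt_eqF d0) ?implybT//.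
rewrite (_ : p^-1 + _ = 0); last by field; rewrite !gt_eqF.
rewrite powRr0 mulr1; congr (_ * _ `^ _); field; rewrite !gt_eqF//.
Qed.

Lemma integral_weight_g_le :
  (\int[m]_(z in pdomain) (weight_g z)%:E <=
   integral_mu q unit_ball (fun z => (normc (f z) `^ p * omega z)%:E))%E.
Proof.
have mub := @measurable_unit_ball R n.+1.
apply: (@le_trans _ _ (\int[m]_(z in unit_ball) (weight_g z)%:E)%E).
  apply: (ge0_subset_integral m measurable_pdomain mub).
  - by apply/measurable_EFinP; apply: measurable_funTS; exact: measurable_weight_g.
  - by move=> z _; rewrite lee_fin weight_g_ge0.
  - by move=> z [].
have [mo _ _] := omega_weight.
rewrite -(@eq_integral_wpos _ _ _ omega_weight (fun z => normc (f z) `^ p * omega z * D z `^ q)).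
- by [].
- exact: mub.
- by [].
- apply: measurable_funM; last by apply: measurable_funTS; exact: measurable_defect_powR.
  apply: measurable_funM => //.
  apply: (eq_measurable_fun (fun z => f1 z `^ p)) => [z /set_mem z1|]; first by rewrite f1E.
  by apply: measurable_funTS; exact: (measurableT_comp (measurable_powR _)).
- by apply: measurable_funTS; exact: measurable_weight_g.
- by move=> z z1 oz; rewrite /weight_g wposE// f1E.
Qed.

Let e k : R := 2 * 2^-1 ^+ k.
Let I k z := (\int[m]_(w in dball pdomain (@sdist R n.+1) z (2 * e k)%R)
       (weight_g w `^ p^-1 * sg w `^ (1 - p^-1))%:E)%E.
Let y k z := ((((e k ^+ 2) `^ (- a))%:E * I k z) `^ p)%E.

Let dsum : V -> \bar R :=
  dyadic_sum m pdomain (@sdist R n.+1) (@height R n.+1) p v sg a weight_g.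

Let e_gt0 k : 0 < e k. Proof. by rewrite mulr_gt0 ?exprn_gt0 ?invr_gt0. Qed.

Let I0 k z : (0 <= I k z)%E.
Proof. by apply: integral_ge0 => w _; rewrite lee_fin mulr_ge0 ?powR_ge0. Qed.

Let yk0 k z : (0 <= (if (height z < 2 * e k ^+ 2)%R then 1 else 0)%:E * y k z)%E.
Proof. by rewrite mule_ge0 ?poweR_ge0// lee_fin; case: ifP. Qed.

Let dsum_ge0 z : (0 <= dsum z)%E.
Proof. by apply: dyadic_sum_ge0; exact: weight_v_ge0. Qed.

(** The l^p norm over the scales: it dominates each single scale, and its [p]-th power can be
    integrated term by term. *)
Let M z := ((\sum_(0 <= k <oo)
  ((if (height z < 2 * e k ^+ 2)%R then 1 else 0)%:E * y k z)) `^ p^-1)%E.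

Let average_le z zeta (r : R) : 0 < a -> pdomain z ->
  touches_boundary zeta r -> pball zeta r z ->
  (integral_mu s (pball zeta r) (fun w => (normc (f w))%:E) /
     (r `^ (n.+1%:R + 1 + s + t))%:E <= (4 `^ a)%:E * M z)%E.
Proof.
move=> a0 zX [zeta1 zeta0 hr] Bz.
have zetaX : pdomain zeta by [].
have hr' : height zeta < r by [].
have r0 : 0 < r by apply: lt_trans hr'; exact: height_gt0.
have [k [ek4 ek]] := dyadic_scale r0; rewrite -/(e k) in ek4 ek.
have ek0 : 0 < e k ^+ 2 by rewrite exprn_gt0.
(* The height of [z] is below 2 r because [z] is in the pseudo-ball; at the top scale every height
   is below 8. *)
have hz : height z < 2 * e k ^+ 2.
  case: ek => [rek|[k0 r4]]; first by have := pball_height hr' Bz; lra.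
  rewrite /e k0 expr0 mulr1; have -> : 2 ^+ 2 = 4 :> R by rewrite -natrX.
  have := height_le1 z; lra.
(* Recentring at [z] doubles the radius in [sdist]; at the top scale the pseudo-distance is at most
   3, below 16. *)
have sub : pball zeta r `<=` dball pdomain (@sdist R n.+1) z (2 * e k)%R.
  move=> w Bw; have wX : pdomain w by case: Bw.
  split => //; rewrite -(@ltr_pXn2r _ 2) ?nnegrE ?sdist_ge0 ?mulr_ge0 ?(ltW (e_gt0 k))//.
  case: ek => [rek|[k0 r4]]; last first.
    rewrite sqr_sdist (le_lt_trans (pdist_le3 zX wX))// /e k0 expr0 mulr1 exprMn.
    by rewrite -!natrX -natrM ltr_nat.
  case: Bz => _ z0 dz; case: Bw => _ w0 dw.
  have h1 : sdist z w ^+ 2 <= (sdist z zeta + sdist zeta w) ^+ 2.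
    by rewrite ler_pXn2r ?nnegrE ?addr_ge0 ?sdist_ge0// sdist_triangle.
  have h2 : sdist z zeta ^+ 2 < r by rewrite sqr_sdist.
  have h3 : sdist zeta w ^+ 2 < r by rewrite sqr_sdist pdistC.
  rewrite exprMn; have := sqr_ge0 (sdist z zeta - sdist zeta w); lra.
have Ea : n.+1%:R + 1 + s + t = a by rewrite /a -[n.+2]addn1 natrD.
have ra0 : 0 < r `^ a by rewrite powR_gt0.
have mG D' : measurable_fun D' (fun w : V => (weight_g w `^ p^-1 * sg w `^ (1 - p^-1))%:E).
  apply/measurable_EFinP; apply: measurable_funTS; apply: measurable_funM;
  apply: (measurableT_comp (measurable_powR _)); first exact: measurable_weight_g.
  exact: measurable_weight_sg.
rewrite Ea inver gt_eqF// muleC.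
have H1 : (integral_mu s (pball zeta r) (fun w => (normc (f w))%:E) <= I k z)%E.
  rewrite (_ : integral_mu _ _ _ =
    \int[m]_(w in pball zeta r) (weight_g w `^ p^-1 * sg w `^ (1 - p^-1))%:E)%E.
    apply: (ge0_subset_integral m (measurable_pball _ _)
      (measurable_dball measurable_pdomain measurable_sdist _ zX) (mG _) _ sub).
    by move=> w _; rewrite lee_fin mulr_ge0 ?powR_ge0.
  apply: eq_integral => w /set_mem Bw; have wX : pdomain w by case: Bw.
  by rewrite -EFinM (integrandE wX).
(* From e_k^2 <= 4 r and a > 0. *)
have H2 : ((r `^ a)^-1 <= 4 `^ a * (e k ^+ 2) `^ (- a))%R.
  rewrite powRN -ler_pdivrMl ?powR_gt0// -invfM lef_pV2 ?posrE ?mulr_gt0 ?powR_gt0//.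
  rewrite -powRM ?(ltW r0)//.
  by apply: ge0_ler_powR; rewrite ?nnegrE ?(ltW a0) ?(ltW ek0) ?mulr_ge0 ?(ltW r0).
apply: (@le_trans _ _ ((4 `^ a * (e k ^+ 2) `^ (- a))%:E * I k z)%E).
  have A0 : (0 <= ((r `^ a)^-1)%:E)%E by rewrite lee_fin invr_ge0 ltW.
  have B0 : (0 <= integral_mu s (pball zeta r) (fun w => (normc (f w))%:E))%E.
    by apply: integral_ge0 => w _; rewrite mule_ge0 ?lee_fin ?powR_ge0 ?normc_ge0.
  by apply: (lee_pmul A0 B0 _ H1); rewrite lee_fin.
rewrite EFinM -muleA; apply: lee_wpmul2l; first by rewrite lee_fin powR_ge0.
have xk0 : (0 <= ((e k ^+ 2) `^ (- a))%:E * I k z)%E by rewrite mule_ge0 ?lee_fin ?powR_ge0.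
rewrite -[leLHS](poweRe1 xk0) -[1 in leLHS](mulfV (lt0r_neq0 p0)) poweRrM.
apply: gt0_ler_poweR; rewrite ?invr_ge0 ?(ltW p0)// ?in_itv/= ?leey ?andbT ?poweR_ge0//.
  by apply: nneseries_ge0 => i _ _; exact: yk0.
apply: le_trans (nneseries_lim_ge k.+1 (fun i _ _ => yk0 i z)).
rewrite big_nat_recr//= hz mul1e -/(y k z) -[leLHS]add0e.
by apply: leeD2r; apply: sume_ge0 => i _; exact: yk0.
Qed.

(** Proved at every point of the ball, also at 0 and where [omega] is not positive, so that it can
    be integrated without measurability of the supremum. *)
Lemma Oprime_le z : 0 < a -> unit_ball z ->
  (Oprime s t f z `^ p * (omega z)%:E * (D z `^ Q)%:E <=
   (4 `^ (a * p))%:E * (dsum \_ pdomain) z)%E.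
Proof.
move=> a0 z1.
have R0 : (0 <= (4 `^ (a * p))%:E * (dsum \_ pdomain) z)%E.
  apply: mule_ge0; first by rewrite lee_fin powR_ge0.
  by rewrite /patch; case: ifP => // _; exact: dsum_ge0.
have DQ0 : (0 <= (D z `^ Q)%:E)%E by rewrite lee_fin powR_ge0.
have [wz|wz] := leP (omega z) 0.
  apply: le_trans R0; apply: mule_le0_ge0 => //; apply: mule_ge0_le0; rewrite ?poweR_ge0//.
have [zE|z0] := eqVneq z 0.
  apply: le_trans R0; rewrite zE /Oprime; set S := [set x | _].
  have -> : S = set0.
    by apply/seteqP; split => // x [zeta [r [_ [_ /eqP]]]].
  have cn0 : cnorm (0 : V) = 0 by apply/eqP; rewrite cnorm_eq0.
  rewrite ereal_sup0 cn0 expr0n subr0 powR1 mul1e.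
  by rewrite poweRNyr ?gt_eqF// !mul0e.
have zX : pdomain z by [].
have h0 := height_gt0 zX; have /andP[d1 _] := defect_height zX.
have d0 : 0 < D z by exact: lt_le_trans d1.
have w0 := wpos_gt0 omega z.
rewrite /patch mem_set// -(wposE z1 wz).
set S := ereal_sup [set x | exists zeta r,
     [/\ touches_boundary zeta r, pball zeta r z &
         x = integral_mu s (pball zeta r) (fun w => (normc (f w))%:E) /
             (r `^ (n.+1%:R + 1 + s + t))%:E]]%E.
have OE : Oprime s t f z = ((D z `^ t)%:E * S)%E by [].
have SM : (S <= (4 `^ a)%:E * M z)%E.
  apply: ge_ereal_sup => _ [zeta [r [tb Bz ->]]]; exact: average_le.
(* The power [p] is monotone on nonnegative values, so the supremum must not be [-oo]: the
   pseudo-ball of radius 4 about [z] touches the boundary and contains [z]. *)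
have S0 : (0 <= S)%E.
  have tb : touches_boundary z (4 : R).
    by split => //; have := cnorm_ge0 z; lra.
  have Bz : pball z (4 : R) z.
    split => //; rewrite (le_lt_trans (pdist_le3 zX zX))// ltr_nat//.
  apply: (@le_trans _ _ (integral_mu s (pball z (4 : R)) (fun w => (normc (f w))%:E) /
             (4 `^ (n.+1%:R + 1 + s + t))%:E)%E).
    rewrite inver gt_eqF ?powR_gt0//; apply: mule_ge0; last by rewrite lee_fin invr_ge0 powR_ge0.
    by apply: integral_ge0 => w _; rewrite mule_ge0 ?lee_fin ?powR_ge0 ?normc_ge0.
  by apply: ereal_sup_ubound; exists z, 4; split.
pose Y := (\sum_(0 <= k <oo)
  ((if (height z < 2 * e k ^+ 2)%R then 1 else 0)%:E * y k z))%E.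
have Y0 : (0 <= Y)%E by apply: nneseries_ge0 => k _ _; exact: yk0.
have H1 : (Oprime s t f z `^ p <= (D z `^ (t * p) * 4 `^ (a * p))%:E * Y)%E.
  apply: (@le_trans _ _ (((D z `^ t)%:E * ((4 `^ a)%:E * M z)) `^ p)%E).
    have Dt0 : (0 <= (D z `^ t)%:E)%E by rewrite lee_fin powR_ge0.
    have M0 : (0 <= (4 `^ a)%:E * M z)%E by rewrite mule_ge0 ?poweR_ge0// lee_fin powR_ge0.
    rewrite OE; apply: (gt0_ler_poweR (ltW p0)).
    - by rewrite in_itv/= leey andbT mule_ge0.
    - by rewrite in_itv/= leey andbT mule_ge0.
    - exact: lee_wpmul2l.
  rewrite muleA -EFinM poweRM ?poweR_ge0 ?lee_fin ?mulr_ge0 ?powR_ge0//.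
  rewrite /M -poweRrM mulVf ?gt_eqF// poweRe1//.
  by rewrite poweR_EFin powRM ?powR_ge0// -!powRrM.
have vE : v z = wpos omega z * D z `^ (Q + p * t) by [].
have H2 : dsum z = ((v z)%:E * Y)%E.
  rewrite -nneseriesZl; last by move=> k _; exact: yk0.
  apply: eq_eseriesr => k _; rewrite muleA -EFinM -/(e k) -/(I k z) -/(y k z).
  by congr (_%:E * _)%E; case: ifP; rewrite ?mulr1 ?mulr0.
rewrite H2 -muleA -EFinM.
have wD0 : (0 <= (wpos omega z * D z `^ Q)%:E)%E by rewrite lee_fin mulr_ge0 ?powR_ge0 ?(ltW w0).
apply: (le_trans (lee_wpmul2r wD0 H1)).
rewrite -muleA [(Y * _)%E]muleC !muleA -!EFinM le_eqVlt; apply/orP; left; apply/eqP.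
congr (_%:E * _)%E; rewrite vE powRD; last by rewrite (gt_eqF d0) implybT.
by rewrite [t * p]mulrC; ring.
Qed.

End pointwise.

Theorem theorem1p16 (R : realType) (N : nat) (p q Q s t : R)
    (omega : 'rV[R[i]]_N -> R) :
  (0 < N)%N -> 1 < p -> -1 < s ->
  case_i N p q Q s t \/ case_ii p q Q s t ->
  is_weight omega -> D_class p q Q s t omega ->
  exists C : R, 0 < C /\
    forall f : 'rV[R[i]]_N -> R[i], in_Lp_weighted p q omega f ->
      (integral_mu Q unit_ball (fun z => Oprime s t f z `^ p * (omega z)%:E)
       <= C%:E * integral_mu q unit_ball
                   (fun z => (normc (f z) `^ p * omega z)%:E))%E.
Proof.
case: N omega => [//|n] omega _ p1 _ cases omega_weight D_omega.
have p0 : 0 < p by exact: lt_trans ltr01 p1.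
have n0 : (0 : R) <= n.+1%:R by [].
have N2 : n.+2%:R = n.+1%:R + 1 :> R by rewrite -[n.+2]addn1 natrD.
pose a : R := n.+2%:R + s + t.
have a0 : 0 < a by case: cases => [[h1 _ _]|[h1 _]]; rewrite /a; lra.
(* In case (i), s + t < -1 < s + t + (Q - q) / p forces Q > q. *)
have qQ : q <= Q.
  case: cases => [[_ h2 h3]|[]//].
  have : 0 < (Q - q) / p by lra.
  by rewrite pmulr_lgt0 ?invr_gt0// subr_gt0 => /ltW.
pose b : R := n.+2%:R + (s + t + (Q - q) / p).
have ab : 0 <= b * p - a * p.
  rewrite (_ : _ - _ = Q - q) ?subr_ge0// /a /b; field; rewrite gt_eqF//.
have [CU CU0 ball_ub] := @ball_ub R n.
have [cL [e0 [cL0 e00 annulus_lb]]] := @ball_annulus_lb R n.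
have [DC DC0 Dp] := weight_bound p1 omega_weight cases D_omega.
have [kap kap0 v_sg] := weight_product q Q s t omega p1.
have ballE x (r : R) : pdomain x -> 0 < r ->
    dball pdomain (@sdist R n.+1) x r = pball x (r ^+ 2).
  by move=> xX r0; rewrite (pball_dball xX) ?exprn_gt0// sqrtr_sqr ger0_norm// ltW.
have powE (r : R) : (r ^+ 2) `^ n.+2%:R = (r ^+ 2) ^+ n.+2.
  by rewrite powR_mulrn// sqr_ge0.
have h_dl x y : pdomain x -> pdomain y ->
    @height R n.+1 y <= height x + sdist x y ^+ 2.
  by move=> _ _; rewrite sqr_sdist; exact: height_le.
have sdC x y : pdomain x -> pdomain y -> @sdist R n.+1 x y = sdist y x.
  by move=> _ _; exact: sdistC.
have sdT x y z : pdomain x -> pdomain y -> pdomain z ->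
    @sdist R n.+1 x z <= sdist x y + sdist y z.
  by move=> [_ x0] [_ y0] [_ z0]; exact: sdist_triangle.
have ub x (r : R) : pdomain x -> 0 < r -> height x < r ^+ 2 ->
    (@ball_measure R n.+1 (dball pdomain (@sdist R n.+1) x r) <=
     (CU * (r ^+ 2) `^ n.+2%:R)%:E)%E.
  by move=> xX r0 hx; rewrite ballE// powE; apply: ball_ub; rewrite ?exprn_gt0.
have lb x (e : R) : pdomain x -> 0 < e <= e0 -> height x < 4 * e ^+ 2 ->
    ((cL * (e ^+ 2) `^ n.+2%:R)%:E <= @ball_measure R n.+1
      (dball pdomain (@sdist R n.+1) x (5 * e)%R `&` annulus pdomain (@height R n.+1) e))%E.
  by move=> xX e1 hx; rewrite powE; exact: annulus_lb.
have Dp' x (r : R) : pdomain x -> 0 < r -> height x < r ^+ 2 ->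
    (\int[@ball_measure R n.+1]_(y in dball pdomain (@sdist R n.+1) x r) (weight_v p Q t omega y)%:E *
     (\int[@ball_measure R n.+1]_(y in dball pdomain (@sdist R n.+1) x r)
        (weight_sg p q s omega y)%:E) `^ (p - 1) <= (DC * (r ^+ 2) `^ (b * p))%:E)%E.
  by move=> xX r0 hx; rewrite ballE//; apply: Dp; rewrite ?exprn_gt0.
have [C C0 HC] := maximal_bound measurable_pdomain measurable_sdist measurable_height
  sdist_ge0 sdC sdT (@height_gt0 R n.+1) h_dl e00 cL0 CU0 ub lb p1 DC0 kap0
  (measurable_weight_v _ _ _ omega_weight) (measurable_weight_sg _ _ _ omega_weight)
  (weight_v_ge0 _ _ _ _) (weight_sg_ge0 _ _ _ _) Dp' v_sg ab.
exists (4 `^ (a * p) * C); split; first by rewrite mulr_gt0 ?powR_gt0.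
move=> f [mf _].
have [mS HCf] := HC _ (measurable_weight_g p q omega_weight mf) (weight_g_ge0 p q omega f).
have a4 : 0 <= 4 `^ (a * p) by exact: powR_ge0.
set S := dyadic_sum _ _ _ _ _ _ _ _ _ in mS HCf *.
have OS : (integral_mu Q unit_ball (fun z => Oprime s t f z `^ p * (omega z)%:E) <=
    \int[@ball_measure R n.+1]_(z in unit_ball) ((4 `^ (a * p))%:E * (S \_ pdomain) z))%E.
  apply: (@le_integral_any _ _ _ (@ball_measure R n.+1)) => z z1.
  exact: Oprime_le.
apply: (le_trans OS).
have S0 z : pdomain z -> (0 <= S z)%E.
  by move=> _; apply: dyadic_sum_ge0; exact: weight_v_ge0.
rewrite EFinM -muleA.
apply: (@le_trans _ _ ((4 `^ (a * p))%:E * \int[@ball_measure R n.+1]_(z in pdomain) S z)%E).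
  rewrite -(ge0_integralZl _ measurable_pdomain mS S0) ?lee_fin//.
  have sub : pdomain `<=` @unit_ball R n.+1 by move=> z [].
  rewrite -[X in (_ <= \int[_]_(z in X) _)%E](setIidr sub) integral_mkcondr.
  apply: le_integral_any => z _; rewrite /patch.
  by case: ifP; rewrite ?mule0.
apply: lee_wpmul2l; first by rewrite lee_fin.
apply: (le_trans HCf); apply: lee_wpmul2l; first by rewrite lee_fin ltW.
exact: integral_weight_g_le.
Qed.
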